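(* Let $\lambda>0$ and let $S^{I\!I}_{d,\lambda}=\{S^{I\!I}_{d,\lambda}(t)\}_{t\in\mathbb{R}}$ be a tempered fractional Lévy process of the second kind (TFLP II) driven by $L$. (a) If $0<d\le\frac12$, then for every $0<\gamma<d$ there exists a locally $\gamma$-Hölder continuous modification of $S^{I\!I}_{d,\lambda}$ (again denoted $S^{I\!I}_{d,\lambda}$). That is, for $T>0$, $$\mathbb{P}\Bigg[\omega:\ \sup_{0<|s-t|<k_T(\omega),\,|s|\le T,\,|t|\le T}\frac{|S^{I\!I}_{d,\lambda}(t)-S^{I\!I}_{d,\lambda}(s)|}{|s-t|^{\gamma}}\le C\Bigg]=1,$$ where $k_T(\omega)$ is an almost surely positive random variable and $C>0$. (b) If $-\frac12<d<0$ and $L$ has symmetric finite-dimensional distributions, then $S^{I\!I}_{d,\lambda}$ has discontinuous and unbounded sample paths with positive probability.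
   Context: Driving Lévy process. $L=\{L(t)\}_{t\in\mathbb{R}}$ is the two-sided Lévy process $L(t)=L_1(t)\mathbf 1_{[0,\infty)}(t)-L_2((-t)-)\mathbf 1_{(-\infty,0)}(t)$, where $L_1,L_2$ are independent copies of a Lévy process on $[0,\infty)$. It is non-degenerate ($\nu\neq 0$), centered ($\mathbb{E}[L(1)]=0$), has no Brownian component, and $\mathbb{E}[e^{i\theta L(t)}]=e^{t\psi(\theta)}$ for $t\ge 0$, with $\psi(\theta)=\int_{\mathbb{R}}(e^{i\theta x}-1-i\theta x)\,\nu(dx)$, where the Lévy measure $\nu$ satisfies $\nu(\{0\})=0$, $\int(|x|^2\wedge 1)\nu(dx)<\infty$ and $\int_{|x|>1}x^2\nu(dx)<\infty$; hence $\mathbb{E}[L(1)^2]<\infty$. For deterministic $f\in L^2(\mathbb{R})$, $\int_{\mathbb{R}} f\,dL$ is the usual Wiener-type integral in $L^2(\Omega)$. Notation. $(x)_+=x\mathbf 1_{\{x>0\}}$, and $(x)_+^p$ is $x^p$ for $x>0$ and $0$ for $x\le 0$ (for every real $p$). Integrals $\int_0^t$ with $t<0$ are oriented. TFLP II. For $d>-\frac12$, $\lambda>0$, $$g^{I\!I}_{d,\lambda,t}(y)=(t-y)_+^{d}e^{-\lambda(t-y)_+}-(-y)_+^{d}e^{-\lambda(-y)_+}+\lambda\int_0^t(s-y)_+^{d}e^{-\lambda(s-y)_+}ds,\qquad S^{I\!I}_{d,\lambda}(t)=\frac{1}{\Gamma(d+1)}\int_{\mathbb{R}}g^{I\!I}_{d,\lambda,t}(y)\,dL(y),\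 t\in\mathbb{R}.$$ *)

(* Defs.v *)
From mathcomp Require Import all_boot all_order all_algebra.
From mathcomp Require Import complex.
From mathcomp Require Import all_classical all_reals all_analysis.

Set Implicit Arguments.
Unset Strict Implicit.
Unset Printing Implicit Defensive.

Import Order.TTheory GRing.Theory Num.Theory.
Import numFieldNormedType.Exports.

Local Open Scope classical_set_scope.
Local Open Scope ring_scope.

Section complex_valued.
Context {R : realType}.

Definition cexp (z : R[i]) : R[i] :=
  ((expR (complex.Re z) * cos (complex.Im z))
   +i* (expR (complex.Re z) * sin (complex.Im z)))%C.

Definition cintegral d (T : measurableType d) (mu : {measure set T -> \bar R})
    (f : T -> R[i]) : R[i] :=
  ((\int[mu]_x complex.Re (f x)) +i* (\int[mu]_x complex.Im (f x)))%C.

End complex_valued.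

Section levy_measure.
Context {R : realType}.
Implicit Type nu : {measure set (measurableTypeR R) -> \bar R}.

Record levy_measure nu : Prop := LevyMeasure {
  levy_measure_zero : nu [set 0] = 0%E ;
  levy_measure_small : (\int[nu]_x (Num.min (`|x| ^+ 2) 1)%:E < +oo)%E ;
  levy_measure_large :
    (\int[nu]_(x in [set x | 1 < `|x|]%R) (x ^+ 2)%:E < +oo)%E }.

Definition levy_exponent nu (theta : R) : R[i] :=
  cintegral nu (fun x : R =>
    cexp (0 +i* (theta * x))%C - 1 - (0 +i* (theta * x))%C).

End levy_measure.

(* A process is a family of random variables indexed by R.  A process on
   [0, +oo[ is represented by such a family whose members at negative times
   are irrelevant. *)
Section processes.
Context {R : realType} {dsp : measure_display} {Omega : measurableType dsp}.
Variable P : probability Omega R.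
Implicit Types X Y L : R -> {RV P >-> R}.

Definition sample n (X : R -> Omega -> R) (t : n.-tuple R) (w : Omega) :
    n.-tuple R :=
  [tuple X (tnth t i) w | i < n].

Definition same_fdd (D : set R) (X Y : R -> Omega -> R) : Prop :=
  forall n (t : n.-tuple R), (forall i, D (tnth t i)) ->
  forall A : set (n.-tuple R), measurable A ->
  P (sample X t @^-1` A) = P (sample Y t @^-1` A).

Definition symmetric_fdd (X : R -> Omega -> R) : Prop :=
  same_fdd setT X (fun t w => - X t w).

Definition independent_processes (D : set R) (X Y : R -> Omega -> R) : Prop :=
  forall n m (t : n.-tuple R) (s : m.-tuple R),
  (forall i, D (tnth t i)) -> (forall i, D (tnth s i)) ->
  forall (A : set (n.-tuple R)) (B : set (m.-tuple R)),
  measurable A -> measurable B ->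
  P (sample X t @^-1` A `&` sample Y s @^-1` B) =
  (P (sample X t @^-1` A) * P (sample Y s @^-1` B))%E.

(* Taking some of the B i equal to setT gives the product rule for every
   subfamily. *)
Definition mutually_independent n (X : 'I_n -> Omega -> R) : Prop :=
  forall B : 'I_n -> set R, (forall i, measurable (B i)) ->
  P (\bigcap_(i in [set: 'I_n]) X i @^-1` B i) =
  (\prod_(i < n) P (X i @^-1` B i))%E.

Definition increment (X : R -> Omega -> R) (s t : R) (w : Omega) : R :=
  X t w - X s w.

Definition cadlag (x : R -> R) : Prop :=
  (forall t, 0 <= t -> x s @[s --> t^'+] --> x t) /\
  (forall t, 0 < t -> cvg (x s @[s --> t^'-])).

Record levy_process X : Prop := LevyProcess {
  levy_start : {ae P, forall w, X 0 w = 0} ;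
  levy_independent_increments : forall n (t : nat -> R),
    0 <= t 0%N -> {homo t : i j / (i <= j)%N >-> i <= j} ->
    mutually_independent (fun i : 'I_n => increment X (t i) (t i.+1)) ;
  levy_stationary_increments : forall s h, 0 <= s -> 0 <= h ->
    forall B : set R, measurable B ->
    P (increment X s (s + h) @^-1` B) = P (increment X 0 h @^-1` B) ;
  levy_stochastically_continuous : forall t eps, 0 <= t -> 0 < eps ->
    P [set w | eps < `|X s w - X t w|]
      @[s --> within `[0, +oo[ (nbhs t)] --> 0%E ;
  levy_cadlag : {ae P, forall w, cadlag (fun t => X t w)} }.

Definition two_sided (X1 X2 : R -> Omega -> R) (t : R) (w : Omega) : R :=
  if 0 <= t then X1 t w else - lim (X2 s w @[s --> (- t)^'-]).

Record driving_levy_process (nu : {measure set (measurableTypeR R) -> \bar R})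
    L : Prop := DrivingLevyProcess {
  driving_levy_measure : levy_measure nu ;
  driving_nondegenerate : nu setT <> 0%E ;
  driving_two_sided : exists L1 L2 : R -> {RV P >-> R},
    [/\ levy_process L1, levy_process L2,
        same_fdd `[0, +oo[ L1 L2, independent_processes `[0, +oo[ L1 L2 &
        {ae P, forall w, forall t, L t w = two_sided L1 L2 t w}] ;
  driving_centered : ('E_P[L 1%R] = 0)%E ;
  driving_exponent : forall t theta : R, 0 <= t ->
    cintegral P (fun w => cexp (0 +i* (theta * L t w))%C) =
    cexp (t%:C%C * levy_exponent nu theta) }.

(* The triple (a, (s, t)) stands for a * \1_(]s, t]). *)
Definition step_function (phi : seq (R * (R * R))) (x : R) : R :=
  \sum_(p <- phi) p.1 * \1_(`]p.2.1, p.2.2]) x.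

Definition step_integral L (phi : seq (R * (R * R))) (w : Omega) : R :=
  \sum_(p <- phi) p.1 * increment L p.2.1 p.2.2 w.

(* Y is (a version of) the integral of f with respect to L: the limit in
   L^2(Omega) of the integrals of step functions converging to f in L^2(R). *)
Definition wiener_integral L (f : R -> R) (Y : {RV P >-> R}) : Prop :=
  f \in Lfun (@lebesgue_measure R) 2%:E /\
  exists phi : nat -> seq (R * (R * R)),
  [/\ forall n, all (fun p => p.2.1 <= p.2.2) (phi n),
      (\int[lebesgue_measure]_x ((f x - step_function (phi n) x) ^+ 2)%:E)%E
        @[n --> \oo] --> 0%E &
      (\int[P]_w ((Y w - step_integral L (phi n) w) ^+ 2)%:E)%E
        @[n --> \oo] --> 0%E].

Definition modification X Y : Prop :=
  forall t, {ae P, forall w, X t w = Y t w}.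

End processes.

Section tempered_fractional.
Context {R : realType}.

Definition Gamma (z : R) : R :=
  \int[lebesgue_measure]_(x in `]0, +oo[) (x `^ (z - 1) * expR (- x)).

(* The library's powR is nonzero at 0 when the exponent is 0, and at negative
   reals. *)
Definition pos_pow (p x : R) : R := if 0 < x then x `^ p else 0.

Definition tempered_pow (d lambda x : R) : R :=
  pos_pow d x * expR (- lambda * Num.max x 0).

Definition oriented_integral (a b : R) (f : R -> R) : R :=
  if a <= b then \int[lebesgue_measure]_(s in `[a, b]) f s
  else - \int[lebesgue_measure]_(s in `[b, a]) f s.

Definition g_II (d lambda t y : R) : R :=
  tempered_pow d lambda (t - y) - tempered_pow d lambda (- y)
  + lambda * oriented_integral 0 t (fun s => tempered_pow d lambda (s - y)).

Context {dsp : measure_display} {Omega : measurableType dsp}.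
Variable P : probability Omega R.

Definition is_TFLP_II (L : R -> {RV P >-> R}) (d lambda : R)
    (S : R -> {RV P >-> R}) : Prop :=
  forall t, exists Y : {RV P >-> R}, wiener_integral L (g_II d lambda t) Y /\
    {ae P, forall w, S t w = (Gamma (d + 1))^-1 * Y w}.

Definition holder_sup (x : R -> R) (gamma T k : R) : \bar R :=
  ereal_sup [set (`|x st.2 - x st.1| / `|st.1 - st.2| `^ gamma)%:E |
    st in [set st : R * R | [/\ 0 < `|st.1 - st.2|, `|st.1 - st.2| < k,
                               `|st.1| <= T & `|st.2| <= T]]].

Definition locally_holder (gamma : R) (X : R -> {RV P >-> R}) : Prop :=
  exists2 C : R, 0 < C & forall T : R, 0 < T ->
  exists k : {RV P >-> R}, {ae P, forall w, 0 < k w} /\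
    {ae P, forall w, (holder_sup (X ^~ w) gamma T (k w) <= C%:E)%E}.

Definition locally_unbounded (x : R -> R) : Prop :=
  exists2 T : R, 0 < T & ~ [bounded x t | t in `[- T, T]].

(* Path properties are not measurable events for a general version of a
   process, hence the measurable subset. *)
Definition with_positive_probability (E : set Omega) : Prop :=
  exists A : set Omega, [/\ measurable A, A `<=` E & (0 < P A)%E].

End tempered_fractional.

(* Main.v *)
(* (a) The characteristic function gives E[L(t)^2] = v t, hence
   E[(S(t) - S(s))^2] <= C int (g_t - g_s)^2.  For s <= t <= s + 1 and 0 < eta < d,
   |g_t - g_s| is at most C (t - s)^d on the part of (-oo, t] at distance of order
   t - s from t and at most C (t - s) (s - y)^(eta - 1) further left, so that this
   integral is O((t - s)^(1 + 2 eta)), and the Kolmogorov-Chentsov criterion applies.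

   (b) For d < 0, the maximum of g_t(y) over the t in (1/N)Z exceeds any given bound
   for all y in (0, 1) as soon as N is large.  Decompose the integrals of step
   functions close to these kernels along a common partition of [0, 1]: each sum is
   made of independent symmetric increments, and flipping the sign of the first
   increment whose contribution exceeds a shows that
   P(some contribution > a) <= 2 P(some |sum| > a).  Since
   P(|L(h)| > b) >= c h for small h, a jump of size > b occurs in the set where the
   kernels are large with probability at least 1 - exp(- c |set|).  Hence, for some
   p > 0 which does not depend on a, P(max_i |S(i / N)| > a) >= p for N large. *)

Require Import Defs.
From mathcomp Require Import all_boot all_order all_algebra.
From mathcomp Require Import complex.
From mathcomp Require Import all_classical all_reals all_analysis.
From mathcomp Require Import measurable_realfun ring lra zify.
Import Order.TTheory GRing.Theory Num.Theory.
Import numFieldNormedType.Exports.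
Local Open Scope classical_set_scope.
Local Open Scope ring_scope.

Set Implicit Arguments.
Unset Strict Implicit.

Set Implicit Arguments.
Unset Strict Implicit.

(** S is given at each time only up to a null set and through L2 limits, so both parts argue on
    countably many times. In (a) the weighted squares of all dyadic increments are summed into one
    random variable of finite mean; its square root is the random Hoelder constant, absorbed into
    the radius k_T so that C = 1 works. The strict inequality eta < d matters at d = 1/2, where the
    square (s - y)^(2 d - 2) of the untempered far bound has a logarithmically divergent tail; part
    of the exponential factor pays for a smaller exponent. For integrals over the whole line an
    inequality replaces the isometry: increment variances are computed on each side of 0 and the two
    sides are added crudely, which costs only a constant.

    In (b) a large contribution must survive the addition of all the others. The sign flip achieves
    this without estimating them, including the integral over negative times, which enters as an
    arbitrary function independent of the flipped increments. The bound P(|L(h)| > b) >= c h is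
    drawn from (1 - cos)^2: its fourth-order zero makes the values |L(h)| <= b contribute only a
    small multiple of h. *)

(** * Square integrals *)

Section square_integral.
Context {R : realType} {dsp : measure_display} {T : measurableType dsp}.
Variable mu : {measure set T -> \bar R}.
Implicit Types f g h : T -> R.

Lemma sqint_ge0 f : (0 <= \int[mu]_x ((f x) ^+ 2)%:E)%E.
Proof. by apply: integral_ge0 => x _; rewrite lee_fin sqr_ge0. Qed.

Lemma measurable_sqr_EFin f : measurable_fun setT f ->
  measurable_fun setT (EFin \o (fun x => (f x) ^+ 2)).
Proof. by move=> mf; apply/measurable_EFinP; exact: measurable_funX. Qed.

Lemma sqint_le f g : measurable_fun setT f -> measurable_fun setT g ->
  (forall x, (f x) ^+ 2 <= (g x) ^+ 2) ->
  (\int[mu]_x ((f x) ^+ 2)%:E <= \int[mu]_x ((g x) ^+ 2)%:E)%E.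
Proof.
move=> mf mg fg; apply: ge0_le_integral => //.
- by move=> x _; rewrite lee_fin sqr_ge0.
- exact: measurable_sqr_EFin.
- exact: measurable_sqr_EFin.
- by move=> x _; rewrite lee_fin fg.
Qed.

Lemma sqintZ f (a : R) : measurable_fun setT f ->
  (\int[mu]_x ((a * f x) ^+ 2)%:E = (a ^+ 2)%:E * \int[mu]_x ((f x) ^+ 2)%:E)%E.
Proof.
move=> mf; rewrite -ge0_integralZl_EFin ?sqr_ge0//.
- by apply: eq_integral => x _; rewrite exprMn EFinM.
- by move=> x _; rewrite lee_fin sqr_ge0.
- exact: measurable_sqr_EFin.
Qed.

Lemma sqintD f g : measurable_fun setT f -> measurable_fun setT g ->
  (\int[mu]_x ((f x + g x) ^+ 2)%:E <=
   2%:E * (\int[mu]_x ((f x) ^+ 2)%:E + \int[mu]_x ((g x) ^+ 2)%:E))%E.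
Proof.
move=> mf mg.
rewrite -ge0_integralD//; last 4 first.
- by move=> x _; rewrite lee_fin sqr_ge0.
- exact: measurable_sqr_EFin.
- by move=> x _; rewrite lee_fin sqr_ge0.
- exact: measurable_sqr_EFin.
rewrite -ge0_integralZl_EFin//; last 2 first.
- by move=> x _; rewrite adde_ge0// lee_fin sqr_ge0.
- by apply: emeasurable_funD; exact: measurable_sqr_EFin.
apply: ge0_le_integral => //.
- by move=> x _; rewrite lee_fin sqr_ge0.
- by apply: measurable_sqr_EFin; exact: measurable_funD.
- apply/measurable_EFinP; apply: measurable_funM => //.
  by apply: measurable_funD; exact: measurable_funX.
- move=> x _; rewrite -EFinD -EFinM lee_fin.
  by have := sqr_ge0 (f x - g x); nra.
Qed.

Lemma sqint_trans f g h : measurable_fun setT f -> measurable_fun setT g ->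
  measurable_fun setT h ->
  (\int[mu]_x ((f x - h x) ^+ 2)%:E <=
   2%:E * (\int[mu]_x ((f x - g x) ^+ 2)%:E +
           \int[mu]_x ((g x - h x) ^+ 2)%:E))%E.
Proof.
move=> mf mg mh.
have := @sqintD (fun x => f x - g x) (fun x => g x - h x)
  (measurable_funB mf mg) (measurable_funB mg mh).
apply: le_trans; rewrite le_eqVlt; apply/orP; left; apply/eqP.
by apply: eq_integral => x _; congr ((_ ^+ 2)%:E); lra.
Qed.

Lemma sqint_sub_sym f g : (\int[mu]_x ((f x - g x) ^+ 2)%:E =
  \int[mu]_x ((g x - f x) ^+ 2)%:E)%E.
Proof. by apply: eq_integral => x _; rewrite -sqrrN opprB. Qed.

Lemma ae_eq_sqint f g : measurable_fun setT f -> measurable_fun setT g ->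
  {ae mu, forall x, f x = g x} ->
  (\int[mu]_x ((f x) ^+ 2)%:E = \int[mu]_x ((g x) ^+ 2)%:E)%E.
Proof.
move=> mf mg fg; apply: ae_eq_integral => //; try exact: measurable_sqr_EFin.
by apply: filterS fg => x -> _.
Qed.

Lemma sqint_eq0 f : measurable_fun setT f ->
  (\int[mu]_x ((f x) ^+ 2)%:E = 0)%E -> {ae mu, forall x, f x = 0}.
Proof.
move=> mf f0.
have : (\int[mu]_x `| ((f x) ^+ 2)%:E | = 0)%E.
  by rewrite -[RHS]f0; apply: eq_integral => x _; rewrite gee0_abs// lee_fin sqr_ge0.
move/(ae_eq_integral_abs mu measurableT (measurable_sqr_EFin mf)).
by apply: filterS => x /(_ I) [] /eqP; rewrite sqrf_eq0 => /eqP.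
Qed.

Lemma sqint_markov f (a : R) : 0 < a -> measurable_fun setT f ->
  ((a ^+ 2)%:E * mu [set x | (a < `|f x|)%R] <= \int[mu]_x ((f x) ^+ 2)%:E)%E.
Proof.
move=> a0 mf.
have := @le_integral_abse _ _ _ mu setT measurableT _ (a ^+ 2)
  (measurable_sqr_EFin mf).
have -> : (\int[mu]_x `|((f x) ^+ 2)%:E| = \int[mu]_x ((f x) ^+ 2)%:E)%E.
  by apply: eq_integral => x _; rewrite gee0_abs// lee_fin sqr_ge0.
rewrite exprn_gt0// => /(_ isT); apply: le_trans.
apply: lee_wpmul2l; first by rewrite lee_fin sqr_ge0.
have mabs : measurable_fun setT (fun x => `|f x|) by exact: measurableT_comp.
apply: le_measure; rewrite ?inE.
- rewrite -[X in measurable X]setTI.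
  by have := measurable_fun_ltr (measurable_cst a) mabs => /(_ measurableT [set true]); apply.
- rewrite -[X in measurable (_ `&` X)]setTI; apply: measurableI => //.
  have -> : [set x | (a ^+ 2)%:E <= `|((f x) ^+ 2)%:E|]%E = [set x | a ^+ 2 <= (f x) ^+ 2].
    by apply/seteqP; split => x /=; rewrite lee_fin ger0_norm ?sqr_ge0.
  by have := measurable_fun_ler (measurable_cst (a ^+ 2)) (measurable_funX 2 mf) => /(_ measurableT [set true]); apply.
- move=> x /= ax; split=> //; rewrite lee_fin ger0_norm ?sqr_ge0//.
  by rewrite -(@real_normK _ (f x)) ?num_real// lerXn2r ?nnegrE ?(ltW a0)// ltW.
Qed.

(** A pointwise limit and an L2 limit of the same sequence agree: by Fatou the integral of (f - g)^2
    is at most the lower limit of those of (f_n - g)^2. *)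
Lemma fatou_sqint_eq (f_ : (T -> R)^nat) f g :
  (forall n, measurable_fun setT (f_ n)) ->
  measurable_fun setT f -> measurable_fun setT g ->
  {ae mu, forall x, f_ n x @[n --> \oo] --> f x} ->
  (\int[mu]_x ((f_ n x - g x) ^+ 2)%:E @[n --> \oo] --> 0)%E ->
  {ae mu, forall x, f x = g x}.
Proof.
move=> mf_ mf mg f_f f_g.
have mB n : measurable_fun setT (fun x => ((f_ n x - g x) ^+ 2)%:E).
  by apply: measurable_sqr_EFin; exact: measurable_funB.
have := @fatou _ _ _ mu setT measurableT _ mB
  (fun n x _ => ltac:(by rewrite lee_fin sqr_ge0)).
rewrite (cvg_limn_einf_sup f_g).1 => le0.
have : (\int[mu]_x ((f x - g x) ^+ 2)%:E = 0)%E.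
  apply/eqP; rewrite eq_le sqint_ge0 andbT; apply: le_trans le0.
  rewrite le_eqVlt; apply/orP; left; apply/eqP; apply: ae_eq_integral => //.
  - by apply: measurable_sqr_EFin; exact: measurable_funB.
  - under eq_fun do rewrite limn_einf_lim.
    apply: (emeasurable_fun_cvg (fun n x => einfs (fun m => ((f_ m x - g x) ^+ 2)%:E) n)).
      by move=> m; exact: measurable_fun_einfs.
    by move=> x _; exact: is_cvg_einfs.
  - apply: filterS f_f => x fx _.
    suff : (((f_ n x - g x) ^+ 2)%:E @[n --> \oo] --> ((f x - g x) ^+ 2)%:E)%E.
      by move=> /cvg_limn_einf_sup[-> _].
    apply: cvg_EFin; first by near=> n.
    rewrite /comp/=; under eq_fun do rewrite expr2; rewrite expr2.
    by apply: cvgM; apply: cvgB => //; exact: cvg_cst.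
move/sqint_eq0 => /(_ (measurable_funB mf mg)).
by apply: filterS => x /eqP; rewrite subr_eq0 => /eqP.
Unshelve. all: by end_near. Qed.

End square_integral.

(** * Kolmogorov-Chentsov criterion *)

Section dyadic.
Context {R : realType}.
Implicit Types (x : R -> R) (t s K q : R).

Definition dyadic_floor (n : nat) t : R := (Num.floor (t * 2 ^+ n))%:~R / 2 ^+ n.

Lemma exp2_gt0 n : 0 < 2 ^+ n :> R. Proof. by rewrite exprn_gt0. Qed.

Lemma dyadic_floor_itv n t :
  dyadic_floor n t <= t < dyadic_floor n t + (2 ^+ n)^-1.
Proof.
rewrite /dyadic_floor; have p := exp2_gt0 n.
rewrite -[X in _ + X]mul1r -mulrDl ler_pdivrMr// ltr_pdivlMr//.
have /andP[-> ] := floor_itv (t * 2 ^+ n); by rewrite intrD.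
Qed.

(** The bit b is the next binary digit, so consecutive dyadic floors of a point are equal or
    adjacent on the finer grid. *)
Lemma floor_double (y : R) : exists2 b : bool,
  Num.floor (y * 2) = Num.floor y * 2 + b%:Z & True.
Proof.
have /andP[] := floor_itv y.
have /andP[] := floor_itv (y * 2).
set z := Num.floor y; set z' := Num.floor (y * 2).
rewrite !intrD => h2 h1 h4 h3.
have l1 : (z * 2 < z' + 1)%R.
  by rewrite -(ltr_int R) intrD intrM; lra.
have l2 : (z' < z * 2 + 2)%R.
  by rewrite -(ltr_int R) intrD intrM; lra.
have : z' = z * 2 \/ z' = z * 2 + 1 by lia.
by case=> ->; [exists false|exists true] => //; rewrite addr0.
Qed.

(** Only neighbours on each dyadic grid are compared; the range of z keeps both points in
    [-N, N]. *)
Definition dyadic_modulus x (N : nat) K q := forall n (z : int),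
  - (N%:Z * 2 ^+ n) <= z -> z < N%:Z * 2 ^+ n ->
  `|x ((z + 1)%:~R / 2 ^+ n) - x (z%:~R / 2 ^+ n)| <= K * q ^+ n.

Lemma floor_scale_itv (N : nat) n t : - N%:R <= t -> t < N%:R ->
  - (N%:Z * 2 ^+ n) <= Num.floor (t * 2 ^+ n) < N%:Z * 2 ^+ n.
Proof.
move=> Nt tN; have p := exp2_gt0 n.
have e : (N%:Z * 2 ^+ n)%:~R = N%:R * 2 ^+ n :> R by rewrite intrM rmorphXn.
apply/andP; split.
  by rewrite floor_ge_int rmorphN /= e -mulNr ler_pM2r.
by rewrite floor_lt_int e ltr_pM2r.
Qed.

Section chain.
Variables (x : R -> R) (N : nat) (K q : R).
Hypotheses (K0 : 0 <= K) (q0 : 0 < q) (q1 : q < 1).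
Hypothesis xmod : dyadic_modulus x N K q.

Lemma dyadic_step n t : - N%:R <= t -> t < N%:R ->
  `|x (dyadic_floor n.+1 t) - x (dyadic_floor n t)| <= K * q ^+ n.+1.
Proof.
move=> Nt tN; have p := exp2_gt0 n.
have [b e _] := floor_double (t * 2 ^+ n).
rewrite -mulrA -exprSr in e.
have := floor_scale_itv n.+1 Nt tN; rewrite e => /andP[h1 h2].
have e2 : dyadic_floor n t = (Num.floor (t * 2 ^+ n) * 2)%:~R / 2 ^+ n.+1.
  by rewrite /dyadic_floor intrM exprS; field; rewrite gt_eqF.
rewrite {1}/dyadic_floor e e2; case: b e h1 h2 => e h1 h2.
  apply: xmod; last by lia.
  have : (0 <= N%:Z * 2 ^+ n.+1) by rewrite mulr_ge0// exprn_ge0.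
  move: h1; rewrite exprS; set w := (2 ^+ n : int); lia.
by rewrite addr0 subrr normr0 mulr_ge0// exprn_ge0// ltW.
Qed.

Let C := K / (1 - q).

Lemma geometric_tail_cvg (u : nat -> R) :
  (forall n, `|u n.+1 - u n| <= K * q ^+ n.+1) ->
  cvgn u /\ forall n, `|limn u - u n| <= C * q ^+ n.
Proof.
move=> hu.
have q1' : `|q| < 1 by rewrite ger0_norm ?ltW.
have hd n m : `|u (n + m)%N - u n| <= C * q ^+ n.
  (* The bound C q^n does not pass through an induction on m; the partial geometric sum does, since
     C (1 - q) = K. *)
  have : `|u (n + m)%N - u n| <= C * (q ^+ n - q ^+ (n + m)).
    elim: m => [|m IH]; first by rewrite addn0 !subrr normr0 mulr0.
    have := hu (n + m)%N; rewrite addnS => h.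
    rewrite -(subrKA (u (n + m)%N)) (le_trans (ler_normD _ _))//.
    rewrite (le_trans (lerD h IH))//.
    have -> : C * (q ^+ n - q ^+ (n + m).+1) =
        C * (q ^+ n - q ^+ (n + m)) + K * q ^+ (n + m).
      by rewrite /C exprS; field; rewrite subr_eq0 gt_eqF.
    rewrite addrC lerD2l ler_wpM2l// exprS ler_piMl ?exprn_ge0 ?ltW//.
  move/le_trans; apply; rewrite ler_wpM2l//.
    by rewrite /C divr_ge0 ?subr_ge0 ?(ltW q1).
  by rewrite gerBl exprn_ge0 ?ltW.
have cu : cvgn u.
  have -> : u = (cst (u 0%N) \+ series (telescope u))%R.
    by apply/funext => n; rewrite [LHS]eq_sum_telescope.
  apply: is_cvgD; first exact: is_cvg_cst.
  apply: normed_cvg.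
  apply: (@series_le_cvg _ _ (geometric (K * q) q)).
  - by move=> n; exact: normr_ge0.
  - by move=> n; rewrite /geometric/= mulr_ge0 ?mulr_ge0 ?exprn_ge0 ?(ltW q0).
  - by move=> n; rewrite /telescope/= /geometric/= -mulrA -exprS.
  - exact: is_cvg_geometric_series.
split=> // n.
have : `|u m - u n| @[m --> \oo] --> `|limn u - u n|.
  by apply: cvg_norm; apply: cvgB => //; exact: cvg_cst.
move=> h; rewrite -(cvg_lim _ h)//; apply: limr_le; first exact: cvgP h.
exists n => // m /= nm; by rewrite -(subnKC nm).
Qed.

Lemma dyadic_limit t : - N%:R <= t -> t < N%:R ->
  cvgn (fun n => x (dyadic_floor n t)) /\
  forall n, `|limn (fun n => x (dyadic_floor n t)) - x (dyadic_floor n t)|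
     <= C * q ^+ n.
Proof. by move=> Nt tN; apply: geometric_tail_cvg => n; exact: dyadic_step. Qed.

(** Three moves of cost at most C q^n each: from s and from t to their dyadic floors at level n, and
    between these floors, which are equal or adjacent because t - s <= 2^-n. *)
Lemma dyadic_limit_holder s t n : - N%:R <= s -> s < t -> t < N%:R ->
  t - s <= (2 ^+ n)^-1 ->
  `|limn (fun n => x (dyadic_floor n t)) - limn (fun n => x (dyadic_floor n s))|
    <= 3 * C * q ^+ n.
Proof.
move=> Ns st tN tsn; have p := exp2_gt0 n.
have [_ /(_ n) ht] := dyadic_limit (le_trans Ns (ltW st)) tN.
have [_ /(_ n) hs] := dyadic_limit Ns (lt_trans st tN).
have C0 : 0 <= C by rewrite /C divr_ge0 ?subr_ge0 ?(ltW q1).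
have qn0 : 0 <= q ^+ n by rewrite exprn_ge0 ?ltW.
have hm : `|x (dyadic_floor n t) - x (dyadic_floor n s)| <= C * q ^+ n.
  have /andP[s1 s2] := floor_itv (s * 2 ^+ n).
  have /andP[t1 t2] := floor_itv (t * 2 ^+ n).
  have /andP[n1 n2] := floor_scale_itv n Ns (lt_trans st tN).
  have /andP[n3 n4] := floor_scale_itv n (le_trans Ns (ltW st)) tN.
  rewrite /dyadic_floor; set z := Num.floor (s * 2 ^+ n) in s1 s2 n1 n2 *.
  set z' := Num.floor (t * 2 ^+ n) in t1 t2 n3 n4 *.
  have ts2 : t * 2 ^+ n <= s * 2 ^+ n + 1.
    by rewrite -lerBlDl -mulrBl -ler_pdivlMr// div1r.
  have ts3 : s * 2 ^+ n < t * 2 ^+ n by rewrite ltr_pM2r.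
  have z1 : (z' < z + 2).
    by rewrite -(ltr_int R) intrD; rewrite intrD in s2; lra.
  have z2 : (z < z' + 1) by rewrite -(ltr_int R); lra.
  have : z' = z \/ z' = z + 1 by move: z1 z2; clear; lia.
  case=> zz'; first by rewrite zz' subrr normr0 mulr_ge0.
  rewrite zz' (le_trans (xmod n1 n2))//.
  by rewrite ler_wpM2r// /C ler_pdivlMr ?subr_gt0// ler_piMr// gerBl ltW.
rewrite (_ : limn _ - _ = (limn (fun n => x (dyadic_floor n t)) - x (dyadic_floor n t))
  + (x (dyadic_floor n t) - x (dyadic_floor n s))
  - (limn (fun n => x (dyadic_floor n s)) - x (dyadic_floor n s))); last by ring.
rewrite (le_trans (ler_normB _ _))// (le_trans (lerD (ler_normD _ _) hs))//.
by move: ht hm; set a := `|_|; set b := `|_|; lra.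
Qed.

End chain.
End dyadic.

Section powers.
Context {R : realType}.

Lemma powRX (a p : R) n : 0 <= a -> (a ^+ n) `^ p = (a `^ p) ^+ n.
Proof.
move=> a0; rewrite -powR_mulrn// -powRrM mulrC powRrM.
by rewrite powR_mulrn// powR_ge0.
Qed.

Lemma dyadic_scale (h : R) : 0 < h -> h <= 1 ->
  exists n, h <= (2 ^+ n)^-1 /\ (2 ^+ n)^-1 < 2 * h.
Proof.
move=> h0 h1.
have ex : exists n, (2 ^+ n.+1)^-1 < h.
  exists (Num.truncn h^-1).
  rewrite -[ltRHS]invrK ltf_pV2 ?posrE ?exprn_gt0 ?invr_gt0//.
  apply: (@lt_le_trans _ _ (Num.truncn h^-1).+1%:R); first by rewrite truncnS_gt.
  by rewrite -natrX ler_nat ltnW// ltn_expl.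
pose n := ex_minn ex.
have : (2 ^+ n.+1)^-1 < h by rewrite /n; case: ex_minnP.
have min m : (2 ^+ m.+1)^-1 < h -> (n <= m)%N.
  by rewrite /n; case: ex_minnP => ? _; exact.
move=> hn; exists n; split; last first.
  by move: hn; rewrite exprS invfM -ltr_pdivrMl ?invr_gt0// invrK; lra.
case: (n) min => [|m] min; first by rewrite expr0 invr1.
by rewrite leNgt; apply/negP => /min; rewrite ltnn.
Qed.

End powers.

Section kolmogorov.
Context {R : realType} {dsp : measure_display} {Omega : measurableType dsp}.
Variable P : probability Omega R.
Variables (S : R -> {RV P >-> R}) (C eta : R).
Hypotheses (eta0 : 0 < eta) (C0 : 0 <= C).
Hypothesis momS : forall s t, s <= t -> t - s <= 1 ->
  (\int[P]_w ((S t w - S s w) ^+ 2)%:E <= (C * (t - s) `^ (1 + 2 * eta))%:E)%E.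
Variable gamma : R.
Hypotheses (gamma0 : 0 < gamma) (gamma_eta : gamma < eta).

(** An exponent strictly between gamma and eta: the gap eta - b makes the series of moments
    converge, and the gap b - gamma absorbs the random Hoelder constant. *)
Let b := (gamma + eta) / 2.
Let q : R := 2^-1 `^ b.
Let half0 : 0 < 2^-1 :> R. Proof. by rewrite invr_gt0. Qed.
Let b0 : 0 < b. Proof. by have := eta0; have := gamma0; have := gamma_eta; rewrite /b; lra. Qed.
Let q0 : 0 < q. Proof. exact: powR_gt0. Qed.
Let powR_half_lt1 (a : R) : 0 < a -> 2^-1 `^ a < 1.
Proof.
move=> a0; rewrite [ltRHS](_ : 1 = 1 `^ a); last by rewrite powR1.
by apply: gt0_ltr_powR => //; rewrite ?nnegrE//; lra.
Qed.
Let q1 : q < 1. Proof. exact: powR_half_lt1. Qed.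

Let r := 2^-1 `^ (2 * (eta - b)).
Let r0 : 0 < r. Proof. exact: powR_gt0. Qed.
Let r1 : r < 1. Proof. by apply: powR_half_lt1; have := eta0; have := gamma0; have := gamma_eta; rewrite /b; lra. Qed.

(** The left-hand side collects the weight q^(-2n), the moment bound for an increment of length
    2^-n, and the number 2^n of such increments per unit of time; r < 1 is thus the ratio of the
    series of means. *)
Let rE n : (q ^- n) ^+ 2 * ((2 ^+ n)^-1 `^ (1 + 2 * eta)) * 2 ^+ n = r ^+ n.
Proof.
rewrite -exprVn powRX ?(ltW half0)// -exprVn -!exprM [(n * 2)%N]mulnC exprM -!exprMn.
congr (_ ^+ n); rewrite /q /r -powR_inv1 ?powR_ge0// -powRrM -powR_mulrn ?powR_ge0//.
rewrite -powRrM [X in _ * _ * X](_ : 2 = 2^-1 `^ (-1)); last first.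
  by rewrite powR_inv1 ?invrK// ltW.
rewrite -!powRD ?(gt_eqF half0) ?implybT//.
by congr (_ `^ _); rewrite /b; lra.
Qed.

(** Reindexes the integers z of [dyadic_modulus] by the naturals k < 2 N 2^n. *)
Let pt (N n k : nat) : int := k%:Z - N%:Z * 2 ^+ n.
Let D (N n k : nat) (w : Omega) : R :=
  S ((pt N n k + 1)%:~R / 2 ^+ n) w - S ((pt N n k)%:~R / 2 ^+ n) w.
Let term (N n : nat) (w : Omega) : \bar R :=
  (\sum_(k < 2 * N * 2 ^ n) ((q ^- n) ^+ 2)%:E * ((D N n k w) ^+ 2)%:E)%E.
(** Every weighted squared increment is one nonnegative summand of Z, so where Z is finite its
    square root is a constant K for [dyadic_modulus]. This plays the part of a Borel-Cantelli
    argument. *)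
Let Z (N : nat) (w : Omega) : \bar R := (\sum_(n <oo) term N n w)%E.

Let mD N n k : measurable_fun setT (D N n k).
Proof. by apply: measurable_funB. Qed.

Let mterm N n : measurable_fun setT (term N n).
Proof.
apply: emeasurable_sum => k; apply: emeasurable_funM => //.
exact: measurable_sqr_EFin.
Qed.

Let summand_ge0 N n k w : (0 <= ((q ^- n) ^+ 2)%:E * ((D N n k w) ^+ 2)%:E)%E.
Proof. by rewrite mule_ge0 // lee_fin sqr_ge0. Qed.

Let term_ge0 N n w : (0 <= term N n w)%E.
Proof. by apply: sume_ge0 => k _; exact: summand_ge0. Qed.

Let mZ N : measurable_fun setT (Z N).
Proof. exact: (@ge0_emeasurable_sum _ _ _ setT (term N) xpredT). Qed.

Let int_term N n :
  (\int[P]_w term N n w <= ((2 * N)%:R * C * r ^+ n)%:E)%E.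
Proof.
rewrite ge0_integral_sum//; last first.
  by move=> k; apply: emeasurable_funM => //; exact: measurable_sqr_EFin.
have -> : ((2 * N)%:R * C * r ^+ n =
    \sum_(k < 2 * N * 2 ^ n) (q ^- n) ^+ 2 * (C * (2 ^+ n)^-1 `^ (1 + 2 * eta)))%R.
  rewrite sumr_const card_ord -rE -[RHS]mulr_natl (natrM _ (2 * N)%N (2 ^ n)%N) natrX.
  by ring.
rewrite -sumEFin; apply: lee_sum => k _.
rewrite ge0_integralZl_EFin ?sqr_ge0//; last 2 first.
- by move=> w _; rewrite lee_fin sqr_ge0.
- exact: measurable_sqr_EFin.
rewrite [leRHS]EFinM; apply: lee_wpmul2l; first by rewrite lee_fin sqr_ge0.
have e : (pt N n k + 1)%:~R / 2 ^+ n - (pt N n k)%:~R / 2 ^+ n = (2 ^+ n)^-1 :> R.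
  by rewrite intrD -mulrBl addrAC subrr add0r mul1r.
rewrite -e; apply: momS.
  by rewrite -subr_ge0 e invr_ge0 exprn_ge0.
by rewrite e invf_le1 ?exprn_gt0// exprn_ege1// ler1n.
Qed.

Let Z_fin N : {ae P, forall w, (Z N w < +oo)%E}.
Proof.
have int_Z : (\int[P]_w Z N w < +oo)%E.
  rewrite integral_nneseries//; apply: le_lt_trans (ltry ((2 * N)%:R * C * (1 - r)^-1)).
  apply: lime_le; first by apply: is_cvg_nneseries => n _ _; exact: integral_ge0.
  apply: nearW => m.
  apply: le_trans (lee_sum _ (fun n _ => int_term N n)) _.
  rewrite sumEFin lee_fin.
  apply: (@geometric_le_lim R m ((2 * N)%:R * C) r) => //.
    by rewrite mulr_ge0.
  by rewrite ger0_norm ?ltW.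
have iZ : P.-integrable setT (Z N).
  apply/integrableP; split => //.
  under eq_integral do rewrite gee0_abs ?nneseries_ge0//.
  exact: int_Z.
have := integrable_ae measurableT iZ; apply: filterS => w /(_ I).
by rewrite ge0_fin_numE// nneseries_ge0.
Qed.

Let G : set Omega := \bigcap_N [set w | (Z N w < +oo)%E].
Let mG : measurable G.
Proof.
apply: bigcapT_measurable => N; rewrite -[X in measurable X]setTI.
exact: (emeasurable_fun_infty_o _ (mZ N)).
Qed.
Let aeG : {ae P, forall w, G w}.
Proof.
have : {ae P, forall w, forall N, (Z N w < +oo)%E} by exact/ae_foralln.
by apply: filterS => w h N _; exact: h.
Qed.

Let K N w : R := Num.sqrt (fine (Z N w)).

Let modulus N w : G w -> dyadic_modulus (S ^~ w) N (K N w) q.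
Proof.
move=> Gw n z h1 h2.
have ZN := Gw N I; rewrite /= in ZN.
have Z0 : (0 <= Z N w)%E by rewrite nneseries_ge0.
have Zf : Z N w \is a fin_num by rewrite ge0_fin_numE.
pose k := absz (z + N%:Z * 2 ^+ n).
have kE : k%:Z = z + N%:Z * 2 ^+ n by rewrite /k gez0_abs// addrC -[X in X + _]opprK addrC subr_ge0.
have k2 : (k < 2 * N * 2 ^ n)%N.
  rewrite -ltz_nat kE -mulnA mul2n -addnn PoszD PoszM.
  by rewrite (_ : (2 ^ n)%N%:Z = 2 ^+ n) ?ltrD2r// -natrX natz.
have zE : z = pt N n k by rewrite /pt kE addrK.
have : (((q ^- n) ^+ 2)%:E * ((D N n k w) ^+ 2)%:E <= Z N w)%E.
  apply: (@le_trans _ _ (term N n w)).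
    rewrite /term (bigD1 (Ordinal k2))//= leeDl// sume_ge0//.
  apply: le_trans (nneseries_lim_ge n.+1 _); last by [].
  by rewrite big_nat_recr//= leeDr// sume_ge0.
rewrite -(fineK Zf) -EFinM lee_fin -exprMn => h.
have qn : 0 < q ^+ n by rewrite exprn_gt0.
rewrite zE -[X in `|X|]/(D N n k w) -ler_pdivrMr// mulrC.
rewrite -[X in X * _]ger0_norm ?invr_ge0 ?(ltW qn)// -normrM -sqrtr_sqr /K.
by rewrite ler_wsqrtr.
Qed.

(** The factor \1_G makes the sequence converge for every w, so that its limit X t is a measurable
    function on the whole of Omega. *)
Let u n t w := S (dyadic_floor n t) w * \1_G w.
Let X t w := limn (fun n => u n t w).

Let u_in n t w : G w -> u n t w = S (dyadic_floor n t) w.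
Proof. by move=> Gw; rewrite /u indicE mem_set// mulr1. Qed.

Let ex_bound (t : R) : exists N : nat, `|t| < N%:R.
Proof. by exists (Num.truncn `|t|).+1; rewrite truncnS_gt. Qed.

Let cvg_u t w : u n t w @[n --> \oo] --> X t w.
Proof.
rewrite /X; have [Gw|Gw] := pselect (G w); last first.
  have -> : (fun n => u n t w) = cst 0.
    by apply/funext => n; rewrite /u indicE memNset// mulr0.
  exact: is_cvg_cst.
have [N] := ex_bound t; rewrite ltr_norml => /andP[t1 t2].
have -> : (fun n => u n t w) = (fun n => S (dyadic_floor n t) w).
  by apply/funext => n; exact: u_in.
exact: (dyadic_limit (sqrtr_ge0 _) q0 q1 (modulus (N := N) Gw) (ltW t1) t2).1.
Qed.

Let mX t : measurable_fun setT (X t).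
Proof.
apply: (measurable_fun_cvg (h := fun n w => u n t w)).
  by move=> n; apply: measurable_funM => //; exact: measurable_indic.
by move=> w _; exact: cvg_u.
Qed.

Let XRV t : {RV P >-> R} := mfun_Sub (mem_set (mX t) : X t \in mfun).

(** The dyadic floors of t tend to t, so S along them tends to S t in L2 by the moment bound, and to
    X t pointwise on G. *)
Let mod_X : modification XRV S.
Proof.
move=> t.
have mS n : measurable_fun setT (S (dyadic_floor n t)) by [].
apply: (@fatou_sqint_eq _ _ _ P (fun n => S (dyadic_floor n t))) => //.
  apply: filterS aeG => w Gw.
  have -> : (fun n => S (dyadic_floor n t) w) = (fun n => u n t w).
    by apply/funext => n; rewrite u_in.
  exact: cvg_u.
have h n : (\int[P]_w ((S (dyadic_floor n t) w - S t w) ^+ 2)%:E <=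
    (C * (2^-1 `^ (1 + 2 * eta)) ^+ n)%:E)%E.
  have /andP[d1 d2] := dyadic_floor_itv n t.
  have d3 : t - dyadic_floor n t <= (2 ^+ n)^-1 by lra.
  have d4 : (2 ^+ n)^-1 <= 1 :> R.
    by rewrite invf_le1 ?exprn_gt0// exprn_ege1// ler1n.
  rewrite sqint_sub_sym (le_trans (momS d1 _))//; first exact: le_trans d3 d4.
  rewrite lee_fin ler_wpM2l// -powRX ?(ltW half0)//.
  apply: ge0_ler_powR; rewrite ?nnegrE ?subr_ge0 ?exprVn ?invr_ge0 ?exprn_ge0//; have := eta0; lra.
apply: (@squeeze_cvge _ _ _ _ (cst 0%E) _
  (fun n => (C * (2^-1 `^ (1 + 2 * eta)) ^+ n)%:E)).
- by apply: nearW => n; rewrite sqint_ge0 h.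
- exact: cvg_cst.
- apply: cvg_EFin; first exact: nearW.
  apply: (@cvg_geometric R C (2^-1 `^ (1 + 2 * eta))).
  by rewrite ger0_norm ?powR_ge0// powR_half_lt1//; have := eta0; lra.
Qed.

(** The factor 3 / (1 - q) comes from [dyadic_limit_holder], and 2^b from replacing 2^-n by 2 (t -
    s). The 1 added in [B] keeps the random radius k = B^(-c) positive and at most 1. *)
Let M := 3 / (1 - q) * 2 `^ b.
Let B N w : R := 1 + M * K N w.
Let B_ge1 N w : 1 <= B N w.
Proof.
by rewrite /B lerDl /M !mulr_ge0 ?sqrtr_ge0 ?powR_ge0// invr_ge0 subr_ge0 ltW.
Qed.

Let holder_X N w s t : G w -> - N%:R <= s -> s < t -> t < N%:R -> t - s <= 1 ->
  `|X t w - X s w| <= B N w * (t - s) `^ b.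
Proof.
move=> Gw Ns st tN ts1.
have ts0 : 0 < t - s by rewrite subr_gt0.
have [n [n1 n2]] := dyadic_scale ts0 ts1.
have := dyadic_limit_holder (sqrtr_ge0 _) q0 q1 (modulus (N := N) Gw) Ns st tN n1.
have XE v : X v w = limn (fun n => S (dyadic_floor n v) w).
  by rewrite /X; congr (limn _); apply/funext => m; rewrite u_in.
rewrite !XE => /le_trans; apply.
have qn : q ^+ n <= 2 `^ b * (t - s) `^ b.
  rewrite /q -powRX ?(ltW half0)// exprVn -powRM ?(ltW ts0)//.
  by apply: ge0_ler_powR; rewrite ?nnegrE ?invr_ge0 ?exprn_ge0 ?(ltW b0) ?(ltW n2)// mulr_ge0 ?(ltW ts0).
have c0 : 0 <= 3 * (K N w / (1 - q)).
  by rewrite !mulr_ge0 ?sqrtr_ge0// invr_ge0 subr_ge0 ltW.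
apply: le_trans (ler_wpM2l c0 qn) _.
have p0 : 0 <= (t - s) `^ b by exact: powR_ge0.
have -> : 3 * (K N w / (1 - q)) * (2 `^ b * (t - s) `^ b) = M * K N w * (t - s) `^ b.
  by rewrite /M; ring.
by rewrite ler_wpM2r// /B lerDr.
Qed.

Lemma kolmogorov_chentsov : exists X : R -> {RV P >-> R},
  modification X S /\ locally_holder gamma X.
Proof.
exists XRV; split; first exact: mod_X.
exists 1 => // T T0; have [N] := ex_bound T; rewrite gtr0_norm// => TN.
(* For 0 < h < B^(-1 / (b - gamma)) one has B h^b <= h^gamma: shrinking the radius turns the random
   constant B into the deterministic constant 1. *)
pose c := (b - gamma)^-1.
have bg : 0 < b - gamma by have := gamma_eta; rewrite /b; lra.
pose k w : R := (B N w) `^ (- c).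
have mk : measurable_fun setT k.
  have mB : measurable_fun setT (B N).
    apply: measurable_funD => //; apply: measurable_funM => //.
    apply: measurableT_comp; last exact: measurableT_comp.
    by apply: continuous_measurable_fun; exact: sqrt_continuous.
  exact: (measurableT_comp (measurable_powR (- c)) mB).
exists (mfun_Sub (mem_set mk : k \in mfun)); split.
  by apply: filterE => w; rewrite /k /=; apply: powR_gt0; exact: lt_le_trans (B_ge1 N w).
apply: filterS aeG => w Gw; apply: ge_ereal_sup.
move=> _ [[s t] /= [st0 stk sT tT] <-]; rewrite lee_fin.
have Bgt0 : 0 < B N w by exact: lt_le_trans (B_ge1 N w).
rewrite ler_pdivrMr ?powR_gt0// mul1r.
have bnd : forall s t, `|s| <= T -> `|t| <= T -> s < t -> t - s < k w ->
    `|X t w - X s w| <= (t - s) `^ gamma.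
  move=> s' t' sT' tT' st' stk'.
  have ts0 : 0 < t' - s' by rewrite subr_gt0.
  have kle1 : k w <= 1.
    rewrite /k powRN invf_le1 ?powR_gt0// [leLHS](_ : 1 = 1 `^ c); last by rewrite powR1.
    by apply: ge0_ler_powR; rewrite ?nnegrE ?B_ge1 ?(ltW Bgt0)// /c invr_ge0 ltW.
  have := @holder_X N w s' t' Gw.
  have -> : - N%:R <= s' by move: sT'; rewrite ler_norml => /andP[]; lra.
  have -> : t' < N%:R by move: tT'; rewrite ler_norml => /andP[]; lra.
  rewrite st' (ltW (lt_le_trans stk' kle1)) => /(_ isT isT isT isT) /le_trans; apply.
  have -> : (t' - s') `^ b = (t' - s') `^ (b - gamma) * (t' - s') `^ gamma.
    by rewrite -powRD ?subrK// (gt_eqF ts0) implybT.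
  rewrite mulrA -[leRHS]mul1r ler_wpM2r ?powR_ge0//.
  rewrite -ler_pdivlMl// mulr1.
  have -> : (B N w)^-1 = (k w) `^ (b - gamma).
    by rewrite /k -powRrM /c mulNr mulVf ?gt_eqF// powRN powRr1// ltW.
  by apply: ge0_ler_powR; rewrite ?nnegrE ?(ltW bg) ?(ltW ts0) ?powR_ge0// ltW.
have [st'|ts'|e] := ltgtP s t.
- rewrite [`|s - t|]distrC (gtr0_norm (_ : 0 < t - s)) ?subr_gt0//.
  by apply: bnd => //; move: stk; rewrite distrC gtr0_norm ?subr_gt0.
- rewrite (gtr0_norm (_ : 0 < s - t)) ?subr_gt0// distrC.
  by apply: bnd => //; move: stk; rewrite gtr0_norm ?subr_gt0.
- by move: st0; rewrite e subrr normr0 ltxx.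
Qed.

End kolmogorov.

(** * Trigonometric and exponential bounds *)

Section trigonometric_bounds.
Context {R : realType}.
Implicit Types x : R.

Lemma abs_sin_le x : `|sin x| <= `|x|.
Proof.
wlog x0 : x / 0 <= x.
  move=> h; have [/h//|x0] := leP 0 x.
  by rewrite -normrN -sinN -(normrN x) h// oppr_ge0 ltW.
have [] := @MVT_segment R sin cos 0 x x0 (fun y _ => is_derive_sin y).
  by apply: continuous_subspaceT => y; exact: continuous_sin.
move=> c _; rewrite sin0 !subr0 => ->.
by rewrite normrM ler_piMl// cos_max.
Qed.

Lemma one_sub_cosE x : 1 - cos x = 2 * sin (x / 2) ^+ 2.
Proof.
have -> : cos x = cos ((x / 2) *+ 2) by congr cos; rewrite mulr2n; lra.
by rewrite cos_mulr2n sin2cos2 mulr2n; ring.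
Qed.

Lemma one_sub_cos_ge0 x : 0 <= 1 - cos x.
Proof. by rewrite subr_ge0 cos_le1. Qed.

Lemma one_sub_cos_le x : 1 - cos x <= x ^+ 2 / 2.
Proof.
rewrite one_sub_cosE.
have : sin (x / 2) ^+ 2 <= (x / 2) ^+ 2.
  by rewrite -[leLHS]real_normK ?num_real// -[leRHS]real_normK ?num_real// lerXn2r ?nnegrE// abs_sin_le.
by rewrite expr_div_n; lra.
Qed.

Lemma one_sub_cos_le_abs x : 1 - cos x <= `|x|.
Proof.
have h1 := one_sub_cos_le x; have h2 := cos_geN1 x.
rewrite -(@real_normK _ x) ?num_real// in h1.
have [h|h] := leP `|x| 2; last lra.
have := normr_ge0 x; move: h1 h; set a := `|x|; nra.
Qed.

(** A quadratic bound valid for all x is the one that integrates against nu, whose second moment is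
    finite. *)
Lemma abs_sin_sub_le x : `|sin x - x| <= x ^+ 2.
Proof.
wlog x0 : x / 0 <= x.
  move=> h; have [/h//|x0] := leP 0 x.
  by rewrite -normrN opprB -sqrrN (le_trans _ (h (- x) _)) ?oppr_ge0 ?(ltW x0)// sinN opprK addrC.
have dg (y : R) : is_derive y 1 (fun z => sin z - z) (cos y - 1).
  by apply: is_deriveB.
have [] := @MVT_segment R (fun z => sin z - z) (fun y => cos y - 1) 0 x x0 (fun y _ => dg y).
  by apply: continuous_subspaceT => y; apply/differentiable_continuous/derivable1_diffP; have := dg y.
move=> c; rewrite in_itv/= => /andP[c0 cx]; rewrite sin0 !subr0 => ->.
rewrite normrM (ger0_norm x0) expr2 ler_wpM2r// distrC ger0_norm ?one_sub_cos_ge0//.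
by rewrite (le_trans (one_sub_cos_le_abs c))// ger0_norm.
Qed.

(** When a and b are both of order t, this says that 1 - Re exp(- a + i b) is a up to O(t^2); it is
    applied to the characteristic function of L(t). *)
Lemma exp_cos_expansion (a b : R) : 0 <= a ->
  `|1 - expR (- a) * cos b - a| <= a ^+ 2 + b ^+ 2 / 2.
Proof.
move=> a0.
have h1 := expR_ge1Dx (- a).
(* Follows from exp(- a) (1 + a) <= 1 <= 1 + a^3 = (1 - a + a^2) (1 + a). *)
have h2 : expR (- a) <= 1 - a + a ^+ 2.
  have e1 := expR_ge1Dx a; have e2 := expRxMexpNx_1 a.
  have e3 := expR_gt0 (- a).
  have : expR (- a) * (1 + a) <= 1 by rewrite mulrC -[leRHS]e2 ler_wpM2r// (ltW e3).
  have : 0 <= a ^+ 3 by rewrite exprn_ge0.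
  move: (expR (- a)) e3 => E e3 a3 h.
  have : E * (1 + a) <= (1 - a + a ^+ 2) * (1 + a) by nra.
  by rewrite ler_pM2r//; lra.
have h3 : expR (- a) <= 1 by rewrite -[leRHS]expR0 ler_expR oppr_le0.
have h4 := one_sub_cos_le b; have h5 := one_sub_cos_ge0 b.
have h6 := expR_ge0 (- a).
rewrite (_ : _ - a = (1 - expR (- a) - a) + expR (- a) * (1 - cos b)); last by ring.
have b1 : 0 <= expR (- a) * (1 - cos b) by rewrite mulr_ge0.
have b2 : expR (- a) * (1 - cos b) <= b ^+ 2 / 2.
  by apply: le_trans h4; rewrite ler_piMl.
have : 0 <= a ^+ 2 by rewrite sqr_ge0.
have : 0 <= b ^+ 2 by rewrite sqr_ge0.
by move=> b0 a20; rewrite ler_norml; apply/andP; split; lra.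
Qed.

End trigonometric_bounds.

(** * Variance of the driving process *)

Section second_moment.
Context {R : realType} {dsp : measure_display} {Omega : measurableType dsp}.
Variable P : probability Omega R.
Variable Y : Omega -> R.
Hypothesis mY : measurable_fun setT Y.

Lemma measurable_cosZ (a : R) : measurable_fun setT (fun w => cos (a * Y w)).
Proof.
apply: measurableT_comp; last exact: measurable_funM.
by apply: continuous_measurable_fun; exact: continuous_cos.
Qed.

Lemma integrable_cosZ (a : R) :
  P.-integrable setT (EFin \o (fun w => cos (a * Y w))).
Proof.
apply: measurable_bounded_integrable => //.
- by apply: (@le_lt_trans _ _ 1%E); [exact: probability_le1|exact: ltry].
- exact: measurable_cosZ.
- exists 1; split; first exact: num_real.
  by move=> M M1 w _ /=; rewrite (le_trans (cos_max _))// ltW.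
Qed.

Lemma integral_one_sub_cos (a : R) :
  (\int[P]_w (1 - cos (a * Y w))%:E = (1 - \int[P]_w cos (a * Y w))%:E)%E.
Proof.
have i1 : P.-integrable setT (EFin \o cst 1) by exact: finite_measure_integrable_cst.
rewrite integralB_EFin//; last exact: integrable_cosZ.
rewrite EFinB /Rintegral fineK; last exact: integrable_fin_num (integrable_cosZ a).
suff -> : (\int[P]_w (1%:E) = 1)%E by [].
by rewrite integral_cst// mul1e; exact: probability_setT.
Qed.

Let th n : R := n.+1%:R^-1.
Let th0 n : 0 < th n. Proof. by rewrite invr_gt0. Qed.

(* (1 - cos (theta Y)) / theta ^ 2 is at most Y ^ 2 / 2 and tends to it as theta
   tends to 0; unlike the second moment, its mean can be read off the
   characteristic function. *)
Definition cos_moment n := (1 - \int[P]_w cos (th n * Y w)) / th n ^+ 2.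

Let g n w : R := (1 - cos (th n * Y w)) / th n ^+ 2.

Let mg n : measurable_fun setT (g n).
Proof.
apply: measurable_funM => //; apply: measurable_funB => //.
exact: measurable_cosZ.
Qed.

Let g0 n w : 0 <= g n w.
Proof. by rewrite divr_ge0 ?one_sub_cos_ge0// sqr_ge0. Qed.

Let g_le n w : g n w <= Y w ^+ 2 / 2.
Proof.
rewrite /g ler_pdivrMr ?exprn_gt0// (le_trans (one_sub_cos_le _))//.
by rewrite exprMn; lra.
Qed.

Let int_g n : (\int[P]_w (g n w)%:E = (cos_moment n)%:E)%E.
Proof.
rewrite /cos_moment mulrC EFinM -integral_one_sub_cos.
rewrite -ge0_integralZl_EFin ?invr_ge0 ?sqr_ge0//.
- by apply: eq_integral => w _; rewrite -EFinM mulrC.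
- by apply/measurable_EFinP; apply: measurable_funB => //; exact: measurable_cosZ.
Qed.

Let cvg_g w : g n w @[n --> \oo] --> Y w ^+ 2 / 2.
Proof.
have h : sin (th n * Y w / 2) / th n @[n --> \oo] --> Y w / 2.
  apply/cvgrPdist_le => e e0.
  have [N _ hN] : \forall n \near \oo, th n * ((Y w / 2) ^+ 2) <= e.
    have : th n * ((Y w / 2) ^+ 2) @[n --> \oo] --> 0 * ((Y w / 2) ^+ 2).
      by apply: cvgM; [exact: cvg_harmonic|exact: cvg_cst].
    rewrite mul0r => /cvgr0_norm_le/(_ e e0); apply: filterS => n.
    by apply: le_trans; exact: ler_norm.
  exists N => // n Nn; apply: le_trans (hN n Nn).
  rewrite distrC -[X in _ - X](mulfK (_ : th n != 0)) ?gt_eqF//.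
  rewrite -mulrBl normrM normfV (gtr0_norm (th0 n)) ler_pdivrMr//.
  have -> : th n * Y w / 2 = Y w / 2 * th n by ring.
  have -> : th n * (Y w / 2) ^+ 2 * th n = (Y w / 2 * th n) ^+ 2 by ring.
  exact: abs_sin_sub_le.
have -> : (fun n => g n w) = (fun n => 2 * (sin (th n * Y w / 2) / th n) ^+ 2).
  by apply/funext => n; rewrite /g one_sub_cosE [in RHS]expr_div_n; set s := sin _; set t := (_ ^+ 2)^-1; ring.
have -> : Y w ^+ 2 / 2 = 2 * (Y w / 2) ^+ 2 by rewrite expr_div_n; lra.
apply: cvgM; first exact: cvg_cst.
by under eq_fun do rewrite expr2; rewrite expr2; exact: cvgM.
Qed.

(** Fatou's lemma is used here because no integrable dominating function is available before the
    second moment is known to be finite. *)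
Lemma cos_moment_bound (K : R) : (forall n, cos_moment n <= K) ->
  (\int[P]_w ((Y w) ^+ 2)%:E <= (2 * K)%:E)%E.
Proof.
move=> hK.
have mgE n : measurable_fun setT (fun w => (g n w)%:E) by exact/measurable_EFinP.
have := @fatou _ _ _ P setT measurableT _ mgE (fun n w _ => ltac:(by rewrite lee_fin g0)).
have -> : (\int[P]_w limn_einf (fun n => (g n w)%:E) =
    (2^-1)%:E * \int[P]_w ((Y w) ^+ 2)%:E)%E.
  rewrite -ge0_integralZl_EFin//; last 2 first.
  - by move=> w _; rewrite lee_fin sqr_ge0.
  - exact: measurable_sqr_EFin.
  apply: eq_integral => w _; rewrite -EFinM mulrC.
  suff : (g n w)%:E @[n --> \oo] --> (Y w ^+ 2 / 2)%:E by move=> /cvg_limn_einf_sup[-> _].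
  by apply: cvg_EFin; [exact: nearW|exact: cvg_g].
move=> le1.
have : (limn_einf (fun n => \int[P]_w (g n w)%:E) <= K%:E)%E.
  rewrite limn_einf_lim; apply: lime_le; first exact: is_cvg_einfs.
  apply: nearW => n; apply: (@le_trans _ _ (\int[P]_w (g n w)%:E)%E).
    by apply: ereal_inf_lbound; exists n => /=.
  by rewrite int_g lee_fin.
move=> /(le_trans le1); rewrite EFinM lee_pdivrMl//.
Qed.

(** Once the second moment is finite, Y^2 / 2 dominates the integrands. *)
Lemma cos_moment_cvg : (\int[P]_w ((Y w) ^+ 2)%:E < +oo)%E ->
  cos_moment n @[n --> \oo] --> fine (\int[P]_w ((Y w) ^+ 2)%:E) / 2.
Proof.
move=> Yfin.
have mY2 := measurable_sqr_EFin mY.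
have iY : P.-integrable setT (fun w => (Y w ^+ 2 / 2)%:E).
  apply/integrableP; split.
    by apply/measurable_EFinP; apply: measurable_funM => //; exact: measurable_funX.
  under eq_integral do rewrite gee0_abs ?lee_fin ?divr_ge0 ?sqr_ge0// mulrC EFinM.
  rewrite ge0_integralZl_EFin//; last by move=> w _; rewrite lee_fin sqr_ge0.
  by rewrite lte_mul_pinfty ?lee_fin.
have mgE n : measurable_fun setT (fun w => (g n w)%:E) by exact/measurable_EFinP.
have cvgE w : (g n w)%:E @[n --> \oo] --> (Y w ^+ 2 / 2)%:E.
  by apply: cvg_EFin; [exact: nearW|exact: cvg_g].
have gle n w : (`|(g n w)%:E| <= (Y w ^+ 2 / 2)%:E)%E.
  by rewrite gee0_abs lee_fin ?g0 ?g_le.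
have [_ _] := @dominated_convergence _ _ _ P setT measurableT
  (fun n w => (g n w)%:E) (fun w => (Y w ^+ 2 / 2)%:E) (fun w => (Y w ^+ 2 / 2)%:E) mgE
  (measurable_int _ iY) (aeW _ (fun w _ => cvgE w)) iY
  (aeW _ (fun w n _ => gle n w)).
have -> : (\int[P]_w (Y w ^+ 2 / 2)%:E =
    (fine (\int[P]_w ((Y w) ^+ 2)%:E) / 2)%:E)%E.
  rewrite mulrC EFinM fineK; last by rewrite ge0_fin_numE// sqint_ge0.
  rewrite -ge0_integralZl_EFin//; last by move=> w _; rewrite lee_fin sqr_ge0.
  by apply: eq_integral => w _; rewrite mulrC EFinM.
under eq_fun do rewrite int_g.
by move=> /fine_cvgP[_].
Qed.

End second_moment.

Section levy_exponent_bounds.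
Context {R : realType}.
Variable nu : {measure set (measurableTypeR R) -> \bar R}.
Hypothesis Hnu : levy_measure nu.

Lemma levy_measure_sq_fin : (\int[nu]_x (x ^+ 2)%:E < +oo)%E.
Proof.
have [_ h1 h2] := Hnu.
have mabs : measurable_fun setT (fun x : measurableTypeR R => `|x| : R).
  by apply: (@measurableT_comp _ _ _ _ _ _ (fun x : R => `|x|)).
have mbig : measurable ([set x : measurableTypeR R | 1 < `|x|]).
  rewrite -[X in measurable X]setTI.
  by have := measurable_fun_ltr (measurable_cst (1 : R)) mabs => /(_ measurableT [set true]); apply.
pose f1 (x : measurableTypeR R) : \bar R := (Num.min (`|x| ^+ 2) 1)%:E.
pose f2 (x : measurableTypeR R) : \bar R := (x ^+ 2)%:E.
have m1 : measurable_fun setT f1.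
  apply/measurable_EFinP; apply: measurable_minr => //.
  exact: (measurable_funX 2 mabs).
have m2 : measurable_fun setT f2.
  by apply/measurable_EFinP; apply: measurable_funX.
have m2' : measurable_fun setT (f2 \_ [set x | 1 < `|x|]).
  by apply/(measurable_restrictT f2 mbig); exact: measurable_funS m2.
apply: (@le_lt_trans _ _ (\int[nu]_x (f1 x + (f2 \_ [set x | (1 < `|x|)%R]) x))%E).
  apply: ge0_le_integral => //.
  - by move=> x _; rewrite lee_fin sqr_ge0.
  - by apply: emeasurable_funD.
  - move=> x _; rewrite /f1 /patch; case: ifPn => [_|].
      by rewrite /f2 leeDr// lee_fin le_min ler01 sqr_ge0.
    rewrite notin_setE /= => /negP; rewrite -leNgt => x1; rewrite adde0 lee_fin.
    have e : `|x| ^+ 2 = x ^+ 2 by rewrite real_normK ?num_real.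
    by rewrite le_min -e lexx/= expr_le1.
rewrite ge0_integralD//; last 2 first.
- by move=> x _; rewrite /f1 lee_fin le_min ler01 sqr_ge0.
- by move=> x _; rewrite /patch; case: ifP => // _; rewrite /f2 lee_fin sqr_ge0.
by rewrite -integral_mkcond lte_add_pinfty.
Qed.

Let M := fine (\int[nu]_x (x ^+ 2)%:E).

Lemma levy_sq_integral : (\int[nu]_x (x ^+ 2)%:E = M%:E)%E.
Proof.
rewrite fineK// ge0_fin_numE ?levy_measure_sq_fin//.
by apply: integral_ge0 => x _; rewrite lee_fin sqr_ge0.
Qed.

Lemma levy_sq_integral_ge0 : 0 <= M.
Proof.
by rewrite fine_ge0//; apply: integral_ge0 => x _; rewrite lee_fin sqr_ge0.
Qed.

Lemma integrable_le_sq (f : measurableTypeR R -> R) (c : R) : measurable_fun setT f ->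
  (forall x, `|f x| <= c * x ^+ 2) ->
  nu.-integrable setT (EFin \o f) /\ `|\int[nu]_x f x| <= c * M.
Proof.
move=> mf fc.
have mx2 : measurable_fun setT (fun x : measurableTypeR R => x ^+ 2 : R).
  by apply: measurable_funX.
have c0 : 0 <= c.
  by have := fc 1; rewrite expr1n mulr1; apply: le_trans.
have Ic : (\int[nu]_x ((c * x ^+ 2)%R)%:E = (c * M)%:E)%E.
  rewrite EFinM -levy_sq_integral -ge0_integralZl_EFin//.
  - by move=> x _; rewrite lee_fin sqr_ge0.
  - exact/measurable_EFinP.
have le1 : (\int[nu]_x `|(f x)%:E| <= (c * M)%:E)%E.
  rewrite -Ic; apply: ge0_le_integral => //.
  - by apply: measurableT_comp => //; exact/measurable_EFinP.
  - by apply/measurable_EFinP; exact: measurable_funM.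
  - by move=> x _; rewrite lee_fin.
have fi : nu.-integrable setT (EFin \o f).
  apply/integrableP; split; first exact/measurable_EFinP.
  exact: le_lt_trans le1 (ltry _).
split=> //; rewrite -lee_fin; apply: le_trans le1.
rewrite /Rintegral -abse_EFin fineK; last exact: integrable_fin_num.
by apply: le_abse_integral => //; exact/measurable_EFinP.
Qed.

(** Minus the real part of psi, hence nonnegative; [levy_im] is the imaginary part itself. *)
Definition levy_re theta := \int[nu]_x (1 - cos (theta * x)).
Definition levy_im theta := \int[nu]_x (sin (theta * x) - theta * x).

Lemma measurable_mulRT (theta : R) :
  measurable_fun setT (fun x : measurableTypeR R => theta * x : R).
Proof. exact: measurable_funM. Qed.

Lemma measurable_cos_mul (theta : R) :
  measurable_fun setT (fun x : measurableTypeR R => cos (theta * x)).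
Proof.
apply: measurableT_comp; last exact: measurable_mulRT.
by apply: continuous_measurable_fun; exact: continuous_cos.
Qed.

Lemma levy_re_integrable theta :
  nu.-integrable setT (fun x => (1 - cos (theta * x))%:E) /\
  `|levy_re theta| <= theta ^+ 2 / 2 * M.
Proof.
apply: (@integrable_le_sq (fun x => 1 - cos (theta * x))).
  by apply: measurable_funB => //; exact: measurable_cos_mul.
move=> x; rewrite ger0_norm ?one_sub_cos_ge0// (le_trans (one_sub_cos_le _))//.
by rewrite exprMn; lra.
Qed.

Lemma levy_im_le theta : `|levy_im theta| <= theta ^+ 2 * M.
Proof.
apply: (@integrable_le_sq (fun x => sin (theta * x) - theta * x) _ _ _).2.
  apply: measurable_funB; last exact: measurable_mulRT.
  apply: measurableT_comp; last exact: measurable_mulRT.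
  by apply: continuous_measurable_fun; exact: continuous_sin.
by move=> x; rewrite -exprMn abs_sin_sub_le.
Qed.

Lemma levy_re_ge0 theta : 0 <= levy_re theta.
Proof.
rewrite /levy_re /Rintegral fine_ge0//; apply: integral_ge0 => x _.
by rewrite lee_fin one_sub_cos_ge0.
Qed.

Lemma levy_exponentE theta :
  levy_exponent nu theta = ((- levy_re theta) +i* levy_im theta)%C.
Proof.
rewrite /levy_exponent /cintegral; congr (_ +i* _)%C.
- transitivity (\int[nu]_x (- (1 - cos (theta * x)))).
    by apply: eq_Rintegral => x _ /=; rewrite expR0; ring.
  rewrite /levy_re /Rintegral -fineN -integral_ge0N//.
- by apply: eq_Rintegral => x _ /=; rewrite expR0; ring.
Qed.

End levy_exponent_bounds.

Section driving_process.
Context {R : realType} {dsp : measure_display} {Omega : measurableType dsp}.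
Variable P : probability Omega R.
Variable nu : {measure set (measurableTypeR R) -> \bar R}.
Variable L : R -> {RV P >-> R}.
Hypothesis HL : driving_levy_process nu L.

Let Hnu := driving_levy_measure HL.
Let A := levy_re nu.
Let B := levy_im nu.
Let M := fine (\int[nu]_x (x ^+ 2)%:E).

Lemma levy_char_re t theta : 0 <= t ->
  \int[P]_w cos (theta * L t w) =
  expR (- (t * levy_re nu theta)) * cos (t * levy_im nu theta).
Proof.
move=> t0.
have := congr1 (@complex.Re R) (driving_exponent HL theta t0).
rewrite (levy_exponentE nu) /cintegral /= !mul0r subr0 addr0 mulrN => <-.
by apply: eq_Rintegral => w _; rewrite expR0 mul1r.
Qed.

Let mL t : measurable_fun setT (L t).
Proof. by []. Qed.

(** Both t [levy_re] and t [levy_im] are O(theta^2), so the error in [exp_cos_expansion] is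
    O(theta^4), of which theta^2 is left after the division: to leading order the cosine moment is
    linear in t. *)
Let cos_moment_near t n : 0 <= t ->
  `|cos_moment P (L t) n - t * levy_re nu n.+1%:R^-1 / n.+1%:R^-1 ^+ 2|
   <= n.+1%:R^-1 ^+ 2 * (t ^+ 2 * M ^+ 2).
Proof.
move=> t0; set th : R := n.+1%:R^-1.
have th0 : 0 < th by rewrite invr_gt0.
have h1 := (levy_re_integrable Hnu th).2; have h2 := levy_im_le Hnu th.
rewrite ger0_norm ?levy_re_ge0// in h1.
have a0 := levy_re_ge0 nu th.
rewrite /cos_moment -/th levy_char_re// -mulrBl normrM normfV.
rewrite (ger0_norm (sqr_ge0 th)) ler_pdivrMr ?exprn_gt0//.
apply: le_trans (exp_cos_expansion _ (mulr_ge0 t0 a0)) _.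
have M0 := levy_sq_integral_ge0 nu; rewrite -/M in h1 h2 M0.
have e1 : levy_re nu th ^+ 2 <= (th ^+ 2 / 2 * M) ^+ 2.
  by rewrite lerXn2r ?nnegrE// mulr_ge0// divr_ge0// sqr_ge0.
have e2 : levy_im nu th ^+ 2 <= (th ^+ 2 * M) ^+ 2.
  by rewrite -[leLHS]real_normK ?num_real// lerXn2r ?nnegrE// mulr_ge0// sqr_ge0.
have t2 : 0 <= t ^+ 2 by rewrite sqr_ge0.
rewrite !exprMn in e1 e2 *.
have f1 := ler_wpM2l t2 e1; have f2 := ler_wpM2l t2 e2.
have X : 0 <= t ^+ 2 * (th ^+ 2 * th ^+ 2 * M ^+ 2).
  by rewrite mulr_ge0// mulr_ge0 ?sqr_ge0// mulr_ge0 ?sqr_ge0.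
by move: f1 f2 X; set y := t ^+ 2; set z := th ^+ 2; set m := M ^+ 2; lra.
Qed.

Lemma L_sq_fin t : 0 <= t -> (\int[P]_w ((L t w) ^+ 2)%:E < +oo)%E.
Proof.
move=> t0; pose K := t * M / 2 + t ^+ 2 * M ^+ 2.
suff /(cos_moment_bound (mL t)) h : forall n, cos_moment P (L t) n <= K.
  exact: le_lt_trans h (ltry _).
move=> n; have := cos_moment_near n t0.
set th : R := n.+1%:R^-1; have th0 : 0 < th by rewrite invr_gt0.
have th1 : th <= 1 by rewrite invf_le1 ?ler1n.
have h1 := (levy_re_integrable Hnu th).2.
rewrite ger0_norm ?levy_re_ge0// in h1.
have e : t * levy_re nu th / th ^+ 2 <= t * M / 2.
  rewrite ler_pdivrMr ?exprn_gt0// (_ : t * M / 2 * th ^+ 2 = t * (th ^+ 2 / 2 * M)); last by ring.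
  by rewrite ler_wpM2l.
have e2 : th ^+ 2 * (t ^+ 2 * M ^+ 2) <= t ^+ 2 * M ^+ 2.
  have th2 : th ^+ 2 <= 1 by rewrite expr_le1// ltW.
  by rewrite ler_piMl// mulr_ge0 ?sqr_ge0.
by rewrite ler_norml => /andP[_]; rewrite /K; lra.
Qed.

Definition levy_var := fine (\int[P]_w ((L 1 w) ^+ 2)%:E).

Lemma levy_var_ge0 : 0 <= levy_var.
Proof. by rewrite fine_ge0// sqint_ge0. Qed.

(** The cosine moments of L(t) have the limit of t [levy_re] / theta^2. Taking t = 1 identifies the
    limit of [levy_re] / theta^2 as [levy_var] / 2, and uniqueness of limits carries this to every
    t. *)
Lemma L_sq t : 0 <= t -> (\int[P]_w ((L t w) ^+ 2)%:E = (levy_var * t)%:E)%E.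
Proof.
move=> t0.
have lim_near s : 0 <= s ->
    s * (levy_re nu n.+1%:R^-1 / n.+1%:R^-1 ^+ 2) @[n --> \oo] -->
    fine (\int[P]_w ((L s w) ^+ 2)%:E) / 2.
  move=> s0.
  have h1 := cos_moment_cvg (mL s) (L_sq_fin s0).
  have h2 : cos_moment P (L s) n - s * (levy_re nu n.+1%:R^-1 / n.+1%:R^-1 ^+ 2)
      @[n --> \oo] --> 0.
    apply/norm_cvg0P; apply: (squeeze_cvgr (f := cst 0)
      (h := fun n => n.+1%:R^-1 * n.+1%:R^-1 * (s ^+ 2 * M ^+ 2))).
    - apply: nearW => n; rewrite normr_ge0/= -expr2 mulrA.
      exact: cos_moment_near.
    - exact: cvg_cst.
    - have := @cvg_harmonic R; rewrite -[X in _ --> X]/(0 : R) => c.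
      have c2 : n.+1%:R^-1 * n.+1%:R^-1 * (s ^+ 2 * M ^+ 2) @[n --> \oo] -->
          0 * 0 * (s ^+ 2 * M ^+ 2).
        by apply: cvgM; [exact: cvgM|exact: cvg_cst].
      by rewrite !mul0r in c2.
  rewrite -[X in _ --> X]subr0.
  rewrite (_ : (fun n => _) = (fun n => cos_moment P (L s) n - (cos_moment P (L s) n -
    s * (levy_re nu n.+1%:R^-1 / n.+1%:R^-1 ^+ 2)))); last first.
    by apply/funext => n; ring.
  exact: cvgB.
have h1 := lim_near 1 ler01; have ht := lim_near t t0.
have h1' : t * (levy_re nu n.+1%:R^-1 / n.+1%:R^-1 ^+ 2) @[n --> \oo] -->
    t * (levy_var / 2).
  apply: cvgM; first exact: cvg_cst.
  by under eq_fun do rewrite -[X in X / _]mul1r -mulrA.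
have : fine (\int[P]_w ((L t w) ^+ 2)%:E) / 2 = t * (levy_var / 2).
  exact: (cvg_unique (@Rhausdorff R) ht h1').
move=> e; rewrite -[LHS]fineK; last by rewrite ge0_fin_numE ?L_sq_fin ?sqint_ge0.
by congr (_%:E); move: e; lra.
Qed.

End driving_process.

(** * L2 bound for integrals of step functions *)

Section has_integral.
Context {R : realType} {dsp : measure_display} {T : measurableType dsp}.
Variable mu : {measure set T -> \bar R}.

(** Integrability travels with the value, so that the double sums below can be integrated term by
    term. *)
Definition has_integral (f : T -> R) (r : R) :=
  mu.-integrable setT (EFin \o f) /\ (\int[mu]_x (f x)%:E = r%:E)%E.

Lemma has_integralD f g r s : has_integral f r -> has_integral g s ->
  has_integral (fun x => f x + g x) (r + s).
Proof.
move=> [fi fr] [gi gs]; split; first exact: (integrableD measurableT fi gi).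
under eq_integral do rewrite EFinD.
by rewrite integralD// fr gs EFinD.
Qed.

Lemma has_integralZ f r c : has_integral f r ->
  has_integral (fun x => c * f x) (c * r).
Proof.
move=> [fi fr]; split; first exact: (integrableZl measurableT c fi).
under eq_integral do rewrite EFinM.
by rewrite integralZl// fr EFinM.
Qed.

Lemma has_integral0 : has_integral (fun=> 0) 0.
Proof. by split; [exact: integrable0|rewrite integral0]. Qed.

Lemma has_integral_sum (I : Type) (s : seq I) (f : I -> T -> R) (r : I -> R) :
  (forall i, List.In i s -> has_integral (f i) (r i)) ->
  has_integral (fun x => \sum_(i <- s) f i x) (\sum_(i <- s) r i).
Proof.
elim: s => [|i s IH] h.
  rewrite big_nil (_ : (fun x => _) = fun=> 0); first exact: has_integral0.
  by apply/funext => x; rewrite big_nil.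
rewrite big_cons (_ : (fun x => _) = fun x => f i x + \sum_(j <- s) f j x); last first.
  by apply/funext => x; rewrite big_cons.
apply: has_integralD; first by apply: h; left.
by apply: IH => j js; apply: h; right.
Qed.

Section quadratic_form.
Variables (D : set R) (Y : R -> T -> R) (v : R).
Hypothesis mY : forall t, measurable_fun setT (Y t).
Hypothesis varY : forall s t, D s -> D t ->
  (\int[mu]_x ((Y t x - Y s x) ^+ 2)%:E = (v * `|t - s|)%:E)%E.

Let has_var s t : D s -> D t ->
  has_integral (fun x => (Y t x - Y s x) ^+ 2) (v * `|t - s|).
Proof.
move=> Ds Dt; split; last exact: varY.
apply/integrableP; split.
  by apply: measurable_sqr_EFin; exact: measurable_funB.
under eq_integral do rewrite gee0_abs ?lee_fin ?sqr_ge0//.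
by rewrite varY// ltry.
Qed.

(** For s <= t and s' <= t' this is the length of the overlap of the two intervals, in the form that
    polarization produces. *)
Definition increment_cov (s t s' t' : R) : R :=
  2^-1 * (`|t - s'| + `|s - t'| + (- 1 * `|t - t'| + - 1 * `|s - s'|)).

(* Polarization: the covariance of two increments depends only on their
   variances. *)
Let has_cov s t s' t' : D s -> D t -> D s' -> D t' ->
  has_integral (fun x => (Y t x - Y s x) * (Y t' x - Y s' x))
    (v * increment_cov s t s' t').
Proof.
move=> Ds Dt Ds' Dt'.
rewrite (_ : (fun x => _) = fun x => 2^-1 * ((Y t x - Y s' x) ^+ 2 + (Y s x - Y t' x) ^+ 2 +
   (- 1 * (Y t x - Y t' x) ^+ 2 + - 1 * (Y s x - Y s' x) ^+ 2))); last first.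
  by apply/funext => x; field.
rewrite (_ : v * _ = 2^-1 * (v * `|t - s'| + v * `|s - t'| +
   (- 1 * (v * `|t - t'|) + - 1 * (v * `|s - s'|)))); last first.
  by rewrite /increment_cov; ring.
by apply: has_integralZ; apply: has_integralD; apply: has_integralD;
  do ?apply: has_integralZ; exact: has_var.
Qed.

Definition quad_form (phi : seq (R * (R * R))) : R :=
  \sum_(p <- phi) \sum_(q <- phi)
    p.1 * q.1 * increment_cov p.2.1 p.2.2 q.2.1 q.2.2.

(** The value depends only on v and on the intervals, so two families with proportional increment
    variances can be compared. The set D confines this to times at which the variances are known. *)
Lemma sqint_increments (phi : seq (R * (R * R))) :
  (forall p, List.In p phi -> D p.2.1 /\ D p.2.2) ->
  (\int[mu]_x ((\sum_(p <- phi) p.1 * (Y p.2.2 x - Y p.2.1 x)) ^+ 2)%:E =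
   (v * quad_form phi)%:E)%E.
Proof.
move=> hD.
suff [_] : has_integral
  (fun x => (\sum_(p <- phi) p.1 * (Y p.2.2 x - Y p.2.1 x)) ^+ 2) (v * quad_form phi) by [].
rewrite (_ : (fun x => _) = fun x => \sum_(p <- phi) \sum_(q <- phi)
   p.1 * q.1 * ((Y p.2.2 x - Y p.2.1 x) * (Y q.2.2 x - Y q.2.1 x))); last first.
  apply/funext => x; rewrite expr2 mulr_suml; apply: eq_bigr => p _.
  by rewrite mulr_sumr; apply: eq_bigr => q _; ring.
rewrite /quad_form mulr_sumr; apply: has_integral_sum => p /hD[p1 p2].
rewrite mulr_sumr; apply: has_integral_sum => q /hD[q1 q2].
by rewrite mulrCA; apply: has_integralZ; exact: has_cov.
Qed.

End quadratic_form.
End has_integral.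

Section indicator_increments.
Context {R : realType}.

(* A family of square-integrable functions with the same increment variances as
   L (up to the constant): sqint_increments applied to it computes the L2 norm of
   a step function. *)
Definition half_line (u x : R) : R := \1_(`]-oo, u]) x - \1_(`]-oo, 0]) x.

Lemma half_line_increment (s t x : R) : s <= t ->
  half_line t x - half_line s x = \1_(`]s, t]) x.
Proof.
move=> st; rewrite /half_line opprB addrA subrK !indicE !mem_setE !in_itv/=.
by have [xt|xt] := leP x t; have [xs|xs] := leP x s; rewrite ?subrr ?subr0//; lra.
Qed.

Lemma measurable_half_line u : measurable_fun setT (half_line u).
Proof. by apply: measurable_funB; exact: measurable_indic. Qed.

Lemma half_line_var (s t : R) :
  (\int[lebesgue_measure]_x ((half_line t x - half_line s x) ^+ 2)%:E =
   (1 * `|t - s|)%:E)%E.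
Proof.
wlog st : s t / s <= t.
  move=> h; have [/h//|/ltW/h] := leP s t.
  by rewrite sqint_sub_sym distrC.
transitivity (\int[lebesgue_measure]_x (\1_(`]s, t]) x)%:E)%E.
  apply: eq_integral => x _; rewrite half_line_increment//.
  by rewrite indicE; case: (_ \in _); rewrite /= ?expr1n ?expr0n.
transitivity (lebesgue_measure (`]s, t]%classic : set R)).
  by rewrite integral_indic// setIT.
rewrite lebesgue_measure_itv/= mul1r ger0_norm ?subr_ge0//.
by rewrite lte_fin; case: ltgtP st => // -> _; rewrite subrr.
Qed.

Lemma step_functionE (phi : seq (R * (R * R))) x : all (fun p => p.2.1 <= p.2.2) phi ->
  step_function phi x = \sum_(p <- phi) p.1 * (half_line p.2.2 x - half_line p.2.1 x).
Proof.
rewrite /step_function; elim: phi => [|p phi IH] /=; first by rewrite !big_nil.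
by move=> /andP[h1 h2]; rewrite !big_cons IH// half_line_increment.
Qed.

Lemma measurable_step_function (phi : seq (R * (R * R))) :
  measurable_fun setT (step_function phi).
Proof.
rewrite (_ : step_function phi = fun x => \sum_(p <- phi) (fun x => p.1 * \1_(`]p.2.1, p.2.2]) x) x)//.
apply: measurable_sum => p; apply: measurable_funM => //.
Qed.

Lemma sqint_step_function (phi : seq (R * (R * R))) :
  all (fun p => p.2.1 <= p.2.2) phi ->
  (\int[lebesgue_measure]_x ((step_function phi x) ^+ 2)%:E = (quad_form phi)%:E)%E.
Proof.
move=> hphi; rewrite -(mul1r (quad_form phi)).
rewrite -(@sqint_increments _ _ _ lebesgue_measure setT half_line 1) //.
- by apply: eq_integral => x _; rewrite step_functionE.
- exact: measurable_half_line.
- by move=> s t _ _; exact: half_line_var.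
Qed.

End indicator_increments.

Section levy_increments.
Context {R : realType} {dsp : measure_display} {Omega : measurableType dsp}.
Variable P : probability Omega R.

Lemma sqint_same_law (X Y : Omega -> R) :
  measurable_fun setT X -> measurable_fun setT Y ->
  (forall B : set R, measurable B -> P (X @^-1` B) = P (Y @^-1` B)) ->
  (\int[P]_w ((X w) ^+ 2)%:E = \int[P]_w ((Y w) ^+ 2)%:E)%E.
Proof.
move=> mX mY XY.
pose X' : {RV P >-> R} := mfun_Sub (mem_set mX : X \in mfun).
pose Y' : {RV P >-> R} := mfun_Sub (mem_set mY : Y \in mfun).
have msq : measurable_fun [set: R] (fun x : R => (x ^+ 2)%:E).
  by apply/measurable_EFinP; exact: measurable_funX.
have sq0 (y : R) : (0 <= (y ^+ 2)%:E)%E by rewrite lee_fin sqr_ge0.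
transitivity (\int[distribution P X']_y (y ^+ 2)%:E)%E.
  by rewrite ge0_integral_distribution.
transitivity (\int[distribution P Y']_y (y ^+ 2)%:E)%E; last first.
  by rewrite ge0_integral_distribution.
by apply: eq_measure_integral => B mB _; exact: XY.
Qed.

Lemma levy_process_var (X : R -> {RV P >-> R}) (v : R) : levy_process X ->
  (forall t, 0 <= t -> (\int[P]_w ((X t w) ^+ 2)%:E = (v * t)%:E)%E) ->
  forall s t, 0 <= s -> s <= t ->
    (\int[P]_w ((X t w - X s w) ^+ 2)%:E = (v * (t - s))%:E)%E.
Proof.
move=> HX varX s t s0 st.
have ts0 : 0 <= t - s by rewrite subr_ge0.
have mB u r : measurable_fun setT (fun w => X u w - X r w) by exact: measurable_funB.
have statX := levy_stationary_increments HX s0 ts0.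
rewrite addrC subrK in statX.
rewrite (sqint_same_law (mB _ _) (mB _ _) statX) -(varX _ ts0).
apply: ae_eq_sqint => //.
by apply: filterS (levy_start HX) => w ->; rewrite subr0.
Qed.

Lemma same_fdd_increment (X Y : R -> {RV P >-> R}) (D : set R) s t :
  same_fdd P D X Y -> D s -> D t -> forall B : set R, measurable B ->
  P ((fun w => X t w - X s w) @^-1` B) = P ((fun w => Y t w - Y s w) @^-1` B).
Proof.
move=> XY Ds Dt B mB.
have mA : measurable_fun setT (fun u : 2.-tuple R => tnth u (lift ord0 ord0) - tnth u ord0).
  by apply: measurable_funB; exact: measurable_tnth.
have := XY 2%N [tuple s; t] _ _ (mA measurableT B mB).
rewrite setTI => h; rewrite (_ : _ @^-1` B = sample X [tuple s; t] @^-1` 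
  ((fun u : 2.-tuple R => tnth u (lift ord0 ord0) - tnth u ord0) @^-1` B)).
  rewrite h; first by congr (P _); apply/seteqP; split=> w /=; rewrite !tnth_mktuple.
  by move=> i; rewrite (tnth_nth 0); case: i => -[|[]//] /=.
by apply/seteqP; split=> w /=; rewrite !tnth_mktuple.
Qed.

Variable nu : {measure set (measurableTypeR R) -> \bar R}.
Variable L : R -> {RV P >-> R}.
Hypothesis HL : driving_levy_process nu L.

Let v := levy_var L.

Let nbhs_near_pos (u : R) : 0 < u -> exists s : nat -> R,
  (forall n, 0 <= s n /\ s n < u) /\ s n @[n --> \oo] --> u.
Proof.
move=> u0; exists (fun n => u - u * n.+1%:R^-1); split=> [n|].
  have h1 : 0 < n.+1%:R^-1 :> R by rewrite invr_gt0.
  have h2 : n.+1%:R^-1 <= 1 :> R by rewrite invf_le1 ?ler1n.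
  split; first by rewrite subr_ge0 ler_piMr// ltW.
  by rewrite gtrBl mulr_gt0.
have : u - u * n.+1%:R^-1 @[n --> \oo] --> u - u * 0.
  apply: cvgB; first exact: cvg_cst.
  by apply: cvgM; [exact: cvg_cst|exact: cvg_harmonic].
by rewrite mulr0 subr0.
Qed.

(** At a negative time - t, L is minus a left limit of L2. Since L2(t) - L2(s) has variance v (t -
    s), L2(s) tends to L2(t) in L2 as s increases to t, so at each fixed t the left limit is almost
    surely L2(t). *)
Lemma driving_increments_law : exists L1 L2 : R -> {RV P >-> R},
  [/\ levy_process L1, levy_process L2,
      same_fdd P `[0, +oo[ L1 L2 & independent_processes P `[0, +oo[ L1 L2] /\
  (forall t, 0 <= t -> {ae P, forall w, L t w = L1 t w}) /\
  (forall t, 0 <= t -> {ae P, forall w, L (- t) w = - L2 t w}).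
Proof.
have [L1 [L2 [H1 H2 H12 HI HE]]] := driving_two_sided HL.
exists L1, L2; split=> //.
have pos t : 0 <= t -> {ae P, forall w, L t w = L1 t w}.
  by move=> t0; apply: filterS HE => w /(_ t) ->; rewrite /two_sided t0.
split=> // t t0.
have mX (X : R -> {RV P >-> R}) s r : measurable_fun setT (fun w => X s w - X r w).
  exact: measurable_funB.
have [t_gt0|t_le0] := ltP 0 t; last first.
  have -> : t = 0 by apply/eqP; rewrite eq_le t0 t_le0.
  rewrite oppr0; apply: filterS3 (pos 0 (lexx 0)) (levy_start H1) (levy_start H2).
  by move=> w -> -> ->; rewrite oppr0.
have var1 : forall s r, 0 <= s -> s <= r ->
    (\int[P]_w ((L1 r w - L1 s w) ^+ 2)%:E = (v * (r - s))%:E)%E.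
  apply: levy_process_var => // s s0.
  rewrite -(L_sq HL s0); apply: ae_eq_sqint => //.
  by apply: filterS (pos s s0) => w ->.
have [s [sP scvg]] := nbhs_near_pos t_gt0.
have mL2n n : measurable_fun setT (fun w => - L2 (s n) w) by exact: measurableT_comp.
have mL2t : measurable_fun setT (fun w => - L2 t w) by exact: measurableT_comp.
apply: (fatou_sqint_eq (f_ := fun n w => - L2 (s n) w)) => //.
  apply: filterS2 HE (levy_cadlag H2) => w /(_ (- t)) -> [_ /(_ t t_gt0) lc].
  rewrite /two_sided oppr_ge0 leNgt t_gt0 /= opprK; apply: cvgN.
  by move/cvg_at_leftP : lc; apply; split=> // n; have [] := sP n.
have e n : (\int[P]_w ((- L2 (s n) w - - L2 t w) ^+ 2)%:E = (v * (t - s n))%:E)%E.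
  have [sn0 snt] := sP n.
  rewrite -(var1 _ _ sn0 (ltW snt)).
  rewrite -[RHS](sqint_same_law (mX L2 t (s n)) (mX L1 t (s n))) => [|B mB].
    by apply: eq_integral => w _; congr ((_ ^+ 2)%:E); ring.
  by apply/esym/(same_fdd_increment H12) => //=; rewrite in_itv/= ?sn0 ?t0.
under eq_fun do rewrite e.
apply: cvg_EFin; first exact: nearW.
have : v * (t - s n) @[n --> \oo] --> v * (t - t).
  by apply: cvgM; [exact: cvg_cst|apply: cvgB => //; exact: cvg_cst].
by rewrite subrr mulr0.
Qed.

Lemma L_increment_var_ge0 s t : 0 <= s -> s <= t ->
  (\int[P]_w ((L t w - L s w) ^+ 2)%:E = (v * (t - s))%:E)%E.
Proof.
have [L1 [L2 [[H1 H2 H12 _] [pos neg]]]] := driving_increments_law.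
move=> s0 st; have t0 := le_trans s0 st.
rewrite -(levy_process_var H1 _ s0 st).
  apply: ae_eq_sqint; [exact: measurable_funB|exact: measurable_funB|].
  by apply: filterS2 (pos s s0) (pos t t0) => w -> ->.
move=> r r0; rewrite -(L_sq HL r0); apply: ae_eq_sqint => //.
by apply: filterS (pos r r0) => w ->.
Qed.

Lemma L_increment_var_le0 s t : t <= 0 -> s <= t ->
  (\int[P]_w ((L t w - L s w) ^+ 2)%:E = (v * (t - s))%:E)%E.
Proof.
have [L1 [L2 [[H1 H2 H12 _] [pos neg]]]] := driving_increments_law.
move=> t0 st; have s0 := le_trans st t0.
have nt0 : 0 <= - t by rewrite oppr_ge0.
have ns0 : 0 <= - s by rewrite oppr_ge0.
have nst : - t <= - s by rewrite lerN2.
have mX (X : R -> {RV P >-> R}) r u : measurable_fun setT (fun w => X r w - X u w).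
  exact: measurable_funB.
have -> : v * (t - s) = v * (- s - - t) by ring.
rewrite -(L_increment_var_ge0 nt0 nst).
transitivity (\int[P]_w ((L2 (- s) w - L2 (- t) w) ^+ 2)%:E)%E.
  apply: ae_eq_sqint => //.
  have := neg _ nt0; have := neg _ ns0; rewrite !opprK.
  by apply: filterS2 => w -> ->; ring.
rewrite -(sqint_same_law (mX L1 (- s) (- t)) (mX L2 (- s) (- t))) => [|B mB].
  apply: ae_eq_sqint => //.
  by apply: filterS2 (pos _ ns0) (pos _ nt0) => w -> ->.
by apply: (same_fdd_increment H12) => //=; rewrite in_itv/= ?nt0 ?ns0.
Qed.

(** Clipping both endpoints at 0 restricts a step function to x > 0; an interval on the other side
    collapses to the empty ]0, 0]. *)
Definition nonneg_part (phi : seq (R * (R * R))) :=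
  [seq (p.1, (Num.max p.2.1 0, Num.max p.2.2 0)) | p <- phi].
Definition nonpos_part (phi : seq (R * (R * R))) :=
  [seq (p.1, (Num.min p.2.1 0, Num.min p.2.2 0)) | p <- phi].

Lemma step_integral_split phi w : step_integral L phi w =
  step_integral L (nonneg_part phi) w + step_integral L (nonpos_part phi) w.
Proof.
rewrite /step_integral !big_map -big_split /=; apply: eq_bigr => p _.
rewrite -mulrDr; congr (_ * _); rewrite /increment.
have key r : L (Num.max r 0) w + L (Num.min r 0) w = L r w + L 0 w.
  have [h|h] := leP r 0; last by [].
  exact: addrC.
have := key p.2.1; have := key p.2.2; move: (L (Num.max _ _) w) (L (Num.min _ _) w).
by move=> a b; move: (L (Num.max _ _) w) (L (Num.min _ _) w) => c e; lra.
Qed.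

Lemma step_function_nonneg phi x : step_function (nonneg_part phi) x =
  step_function phi x * (0 < x)%R%:R.
Proof.
rewrite /step_function big_map mulr_suml; apply: eq_bigr => p _ /=.
rewrite -mulrA; congr (_ * _); rewrite !indicE !mem_setE !in_itv/= -natrM mulnb.
congr (nat_of_bool _)%:R; rewrite gt_max le_max.
by have [x0|x0] := ltP 0 x; rewrite ?orbF ?andbT ?andbF.
Qed.

Lemma step_function_nonpos phi x : step_function (nonpos_part phi) x =
  step_function phi x * (x <= 0)%R%:R.
Proof.
rewrite /step_function big_map mulr_suml; apply: eq_bigr => p _ /=.
rewrite -mulrA; congr (_ * _); rewrite !indicE !mem_setE !in_itv/= -natrM mulnb.
congr (nat_of_bool _)%:R; rewrite gt_min le_min.
by have [x0|x0] := leP x 0; rewrite ?orbF ?andbT ?andbF.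
Qed.

Lemma measurable_step_integral (phi : seq (R * (R * R))) :
  measurable_fun setT (step_integral L phi).
Proof.
rewrite (_ : step_integral L phi = fun w =>
  \sum_(p <- phi) (fun w => p.1 * increment L p.2.1 p.2.2 w) w)//.
apply: measurable_sum => p; apply: measurable_funM => //.
by apply: measurable_funB.
Qed.

(** The variance of an increment is available when both times lie on the same side of 0. Each half
    of the step function therefore costs v, and (x + y)^2 <= 2 (x^2 + y^2) joins the halves, whence
    4 v. *)
Lemma sqint_step_integral (phi : seq (R * (R * R))) :
  all (fun p => p.2.1 <= p.2.2) phi ->
  (\int[P]_w ((step_integral L phi w) ^+ 2)%:E <=
   (4 * v)%:E * \int[lebesgue_measure]_x ((step_function phi x) ^+ 2)%:E)%E.
Proof.
move=> hphi.
have v0 : 0 <= v by exact: levy_var_ge0.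
have side (psi : seq (R * (R * R))) (D : set R) :
    all (fun p => p.2.1 <= p.2.2) psi ->
    (forall s t, D s -> D t ->
      (\int[P]_w ((L t w - L s w) ^+ 2)%:E = (v * `|t - s|)%:E)%E) ->
    (forall p, List.In p psi -> D p.2.1 /\ D p.2.2) ->
    (forall x, (step_function psi x) ^+ 2 <= (step_function phi x) ^+ 2) ->
    (\int[P]_w ((step_integral L psi w) ^+ 2)%:E <=
      v%:E * \int[lebesgue_measure]_x ((step_function phi x) ^+ 2)%:E)%E.
  move=> hpsi varL Dpsi le_phi.
  rewrite [leLHS](sqint_increments (fun t => _ : measurable_fun setT (L t)) varL Dpsi)//.
  rewrite EFinM -sqint_step_function// lee_wpmul2l ?lee_fin//.
  by apply: sqint_le => //; exact: measurable_step_function.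
have hpos : (\int[P]_w ((step_integral L (nonneg_part phi) w) ^+ 2)%:E <=
      v%:E * \int[lebesgue_measure]_x ((step_function phi x) ^+ 2)%:E)%E.
  apply: (side _ [set t | 0 <= t]).
  - rewrite all_map; apply: sub_all hphi => p /= p12.
    by rewrite ge_max !le_max p12 lexx !orbT.
  - move=> s t /= s0 t0; have [st|/ltW ts] := leP s t.
      by rewrite L_increment_var_ge0// ger0_norm ?subr_ge0.
    by rewrite sqint_sub_sym L_increment_var_ge0// distrC ger0_norm ?subr_ge0.
  - by move=> p /List.in_map_iff[q [<- _]] /=; rewrite !le_max !lexx !orbT.
  - move=> x; rewrite step_function_nonneg exprMn.
    by case: (0 < x); rewrite ?expr1n ?mulr1// expr0n mulr0 sqr_ge0.
have hneg : (\int[P]_w ((step_integral L (nonpos_part phi) w) ^+ 2)%:E <=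
      v%:E * \int[lebesgue_measure]_x ((step_function phi x) ^+ 2)%:E)%E.
  apply: (side _ [set t | t <= 0]).
  - rewrite all_map; apply: sub_all hphi => p /= p12.
    by rewrite le_min !ge_min p12 lexx !orbT.
  - move=> s t /= s0 t0; have [st|/ltW ts] := leP s t.
      by rewrite L_increment_var_le0// ger0_norm ?subr_ge0.
    by rewrite sqint_sub_sym L_increment_var_le0// distrC ger0_norm ?subr_ge0.
  - by move=> p /List.in_map_iff[q [<- _]] /=; rewrite !ge_min !lexx !orbT.
  - move=> x; rewrite step_function_nonpos exprMn.
    by case: (x <= 0); rewrite ?expr1n ?mulr1// expr0n mulr0 sqr_ge0.
rewrite (_ : (4 * v)%:E = 2%:E * (v%:E + v%:E))%E; last first.
  by rewrite -EFinD -EFinM; congr (_%:E); ring.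
under eq_integral do rewrite step_integral_split.
apply: le_trans (sqintD _ (measurable_step_integral _) (measurable_step_integral _)) _.
rewrite -muleA lee_wpmul2l// ge0_muleDl ?lee_fin//.
exact: leeD.
Qed.

Lemma step_integralB (phi psi : seq (R * (R * R))) w :
  step_integral L (phi ++ [seq (- p.1, p.2) | p <- psi]) w =
  step_integral L phi w - step_integral L psi w.
Proof.
rewrite /step_integral big_cat big_map -sumrN; congr (_ + _).
by apply: eq_bigr => p _; rewrite mulNr.
Qed.

Lemma step_functionB (phi psi : seq (R * (R * R))) x :
  step_function (phi ++ [seq (- p.1, p.2) | p <- psi]) x =
  step_function phi x - step_function psi x.
Proof.
rewrite /step_function big_cat big_map -sumrN; congr (_ + _).
by apply: eq_bigr => p _; rewrite mulNr.
Qed.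

End levy_increments.

(** * Regularity of the kernel *)

Section kernel.
Context {R : realType}.
Local Notation leb := (@lebesgue_measure R).

Lemma Lfun_measurable (f : R -> R) (p : \bar R) : f \in Lfun leb p ->
  measurable_fun setT f.
Proof. by move=> /andP[h _]; move: h; rewrite inE. Qed.

Variables (d lambda : R).
Hypothesis lambda0 : 0 < lambda.
Local Notation F := (tempered_pow d lambda).

Lemma tempered_pow_gt0 (x : R) : 0 < x -> F x = x `^ d * expR (- (lambda * x)).
Proof. by move=> x0; rewrite /tempered_pow /pos_pow x0 mulNr max_l// ltW. Qed.

Lemma tempered_pow_le0 (x : R) : x <= 0 -> F x = 0.
Proof. by move=> x0; rewrite /tempered_pow /pos_pow ltNge x0 mul0r. Qed.

Lemma tempered_pow_ge0 (x : R) : 0 <= F x.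
Proof.
have [x0|x0] := ltP 0 x; last by rewrite tempered_pow_le0.
by rewrite tempered_pow_gt0// mulr_ge0 ?powR_ge0 ?expR_ge0.
Qed.

Lemma measurable_tempered_pow : measurable_fun setT F.
Proof.
have -> : F = fun x => \1_(`]0, +oo[) x * x `^ d * expR (- lambda * Num.max x 0).
  apply/funext => x; rewrite /tempered_pow /pos_pow indicE mem_setE in_itv/= andbT.
  by case: ifPn; rewrite ?mul1r ?mul0r.
apply: measurable_funM; last first.
  apply: measurableT_comp; first exact: measurable_expR.
  by apply: measurable_funM => //; exact: measurable_maxr.
by apply: measurable_funM; [exact: measurable_indic|exact: measurable_powR].
Qed.

Definition powexp_bound : R := 1 + 4 / lambda ^+ 2.

(* x ^ p <= 1 + x ^ 2 for 0 <= p <= 2, while x ^ 2 exp (- lambda x) is bounded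
   since exp (lambda x / 2) >= lambda x / 2. *)
Lemma powR_expR_le (p x : R) : 0 <= p -> p <= 2 -> 0 < x ->
  x `^ p * expR (- (lambda * x)) <= powexp_bound.
Proof.
move=> p0 p2 x0.
have xp : x `^ p <= 1 + x ^+ 2.
  have [x1|/ltW x1] := leP x 1.
    have : x `^ p <= 1.
      rewrite [leRHS](_ : 1 = 1 `^ p); last by rewrite powR1.
      by apply: ge0_ler_powR => //; rewrite nnegrE ltW.
    by move/le_trans; apply; rewrite lerDl sqr_ge0.
  rewrite -powR_mulrn ?(ltW x0)//.
  by rewrite (le_trans (ler_powR x1 p2))// lerDr.
have e1 : expR (- (lambda * x)) <= 1.
  by rewrite -[leRHS]expR0 ler_expR oppr_le0 mulr_ge0// ltW.
have e2 : x ^+ 2 * expR (- (lambda * x)) <= 4 / lambda ^+ 2.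
  rewrite expRN ler_pdivrMr ?expR_gt0//.
  have h : lambda * x / 2 <= expR (lambda * x / 2).
    by apply: le_trans (expR_ge1Dx _); rewrite lerDr.
  have h0 : 0 <= lambda * x / 2 by rewrite divr_ge0// mulr_ge0// ltW.
  have : (lambda * x / 2) ^+ 2 <= expR (lambda * x).
    rewrite (_ : expR (lambda * x) = expR (lambda * x / 2) ^+ 2); last first.
      by rewrite expr2 -expRD; congr expR; lra.
    by rewrite lerXn2r// nnegrE expR_ge0.
  move=> h3; rewrite mulrAC ler_pdivlMr ?exprn_gt0//.
  by move: h3; rewrite !exprMn exprVn; set a := lambda ^+ 2; set b := x ^+ 2; set c := expR _; lra.
apply: le_trans (ler_wpM2r (expR_ge0 _) xp) _.
by rewrite mulrDl mul1r /powexp_bound lerD.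
Qed.

Lemma powexp_bound_ge1 : 1 <= powexp_bound.
Proof. by rewrite /powexp_bound lerDl divr_ge0// sqr_ge0. Qed.

Hypotheses (d0 : 0 < d) (d1 : d <= 1).

Let F_bounded (x : R) : F x <= powexp_bound.
Proof.
have [x0|x0] := ltP 0 x; last first.
  by rewrite tempered_pow_le0// (le_trans ler01)// powexp_bound_ge1.
by rewrite tempered_pow_gt0// powR_expR_le ?(ltW d0)// (le_trans d1)// ler1n.
Qed.

Let measurable_Fshift (y : R) : measurable_fun setT (fun u : R => F (u - y)).
Proof.
apply: measurableT_comp; first exact: measurable_tempered_pow.
by apply: measurable_funB.
Qed.

Let integrable_Fshift (y a b : R) : leb.-integrable `[a, b] (EFin \o (fun u => F (u - y))).
Proof.
apply: measurable_bounded_integrable => //.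
- by rewrite /= lebesgue_measure_itv/=; case: ifP => // _; rewrite ltry.
- exact: measurable_funS (measurable_Fshift y).
- exists powexp_bound; split; first exact: num_real.
  move=> M M1 w _ /=; rewrite ger0_norm ?tempered_pow_ge0//.
  by rewrite (le_trans (F_bounded _))// ltW.
Qed.

Let int_split (y a b c : R) : a <= b -> b <= c ->
  \int[leb]_(u in `[a, c]) F (u - y) =
  \int[leb]_(u in `[a, b]) F (u - y) + \int[leb]_(u in `[b, c]) F (u - y).
Proof.
move=> ab bc; have := @Rintegral_itvB R _ (BLeft a) (BRight c) b (integrable_Fshift y a c).
rewrite !bnd_simp => /(_ ab bc) h.
rewrite -[X in _ + X]Rintegral_itv_obnd_cbnd.
  by rewrite -h; ring.
apply: integrableS (integrable_Fshift y b c) => //.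
by apply: subset_itvr; rewrite bnd_simp.
Qed.

Let oriented_diff (y s t : R) : s <= t ->
  oriented_integral 0 t (fun u => F (u - y)) - oriented_integral 0 s (fun u => F (u - y)) =
  \int[leb]_(u in `[s, t]) F (u - y).
Proof.
move=> st; rewrite /oriented_integral.
have [s0|s0] := leP 0 s.
  by rewrite (le_trans s0 st) (int_split y s0 st); ring.
have [t0|t0] := leP 0 t.
  by rewrite (int_split y (ltW s0) t0); ring.
by rewrite (int_split y st (ltW t0)); ring.
Qed.

Lemma g_II_diff (s t y : R) : s <= t ->
  g_II d lambda t y - g_II d lambda s y =
  F (t - y) - F (s - y) + lambda * \int[leb]_(u in `[s, t]) F (u - y).
Proof. by move=> st; rewrite -(oriented_diff y st) /g_II; ring. Qed.

Let int_F_le (s t y m : R) : s <= t -> (forall u, s <= u -> u <= t -> F (u - y) <= m) ->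
  0 <= \int[leb]_(u in `[s, t]) F (u - y) <= m * (t - s).
Proof.
move=> st hm; apply/andP; split.
  by apply: Rintegral_ge0 => u _; exact: tempered_pow_ge0.
have -> : m * (t - s) = \int[leb]_(u in `[s, t]) m.
  rewrite Rintegral_cst//= lebesgue_measure_itv/= lte_fin.
  by move: st; rewrite le_eqVlt => /predU1P[->|->] //; rewrite ltxx subrr.
have im : leb.-integrable `[s, t] (EFin \o (fun=> m)).
  apply: measurable_bounded_integrable => //.
    by rewrite /= lebesgue_measure_itv/=; case: ifP => // _; rewrite ltry.
  exists `|m|; split; first exact: num_real.
  by move=> M M1 w _ /=; exact: ltW.
apply: (le_Rintegral _ (integrable_Fshift y s t) im) => //.
by move=> u /=; rewrite in_itv/= => /andP[su ut]; exact: hm.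
Qed.

Lemma g_II_diff_right (s t y : R) : s <= t -> t <= y ->
  g_II d lambda t y - g_II d lambda s y = 0.
Proof.
move=> st ty; rewrite g_II_diff//.
have h0 u : u <= t -> F (u - y) <= 0.
  by move=> ut; rewrite tempered_pow_le0// subr_le0 (le_trans ut).
have := int_F_le st (fun u _ ut => h0 u ut); rewrite mul0r => hI.
have -> : \int[leb]_(u in `[s, t]) F (u - y) = 0 by apply/eqP; rewrite eq_le andbC.
by rewrite !tempered_pow_le0 ?subr_le0// ?(le_trans st)//; ring.
Qed.

(** Every argument u - y with u <= t is at most 2 (t - s), and 2^d <= 2; the integral over [s, t]
    brings a further factor t - s <= 1 and the term in lambda. *)
Lemma g_II_diff_near (s t y : R) : s <= t -> t - s <= 1 -> t - y <= 2 * (t - s) ->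
  `|g_II d lambda t y - g_II d lambda s y| <= 2 * (1 + lambda) * (t - s) `^ d.
Proof.
move=> st ts1 ty; rewrite g_II_diff//.
set h := t - s in ts1 ty *; have h0 : 0 <= h by rewrite subr_ge0.
have hd0 := powR_ge0 h d.
have hF u : u <= t -> F (u - y) <= 2 * h `^ d.
  move=> ut; have [uy|uy] := ltP 0 (u - y); last by rewrite tempered_pow_le0// mulr_ge0.
  rewrite tempered_pow_gt0//.
  have e1 : expR (- (lambda * (u - y))) <= 1.
    by rewrite -[leRHS]expR0 ler_expR oppr_le0 mulr_ge0// ltW.
  apply: le_trans (ler_piMr (powR_ge0 _ _) e1) _.
  apply: (@le_trans _ _ ((2 * h) `^ d)).
    apply: ge0_ler_powR; rewrite ?nnegrE ?(ltW d0) ?(ltW uy) ?mulr_ge0//.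
    by apply: le_trans ty; rewrite lerD2r.
  by rewrite powRM// ler_wpM2r// ler1_powR// ler1n.
have /andP[i0 i1] := int_F_le st (fun u _ ut => hF u ut).
have f1 := hF t (lexx t); have f2 := hF s st.
have f3 := tempered_pow_ge0 (t - y); have f4 := tempered_pow_ge0 (s - y).
have i2 : \int[leb]_(u in `[s, t]) F (u - y) <= 2 * h `^ d.
  by apply: le_trans i1 _; rewrite -/h ler_piMr// mulr_ge0.
have l0 := ltW lambda0.
have i3 : lambda * \int[leb]_(u in `[s, t]) F (u - y) <= lambda * (2 * h `^ d).
  by rewrite ler_wpM2l.
have i4 : 0 <= lambda * \int[leb]_(u in `[s, t]) F (u - y) by rewrite mulr_ge0.
have i5 : 0 <= lambda * (2 * h `^ d) by rewrite mulr_ge0// mulr_ge0.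
by rewrite ler_norml; apply/andP; split; lra.
Qed.

(** With x = s - y and h = t - s, the bound (1 + h / x)^d <= 1 + h / x controls the power from above
    and exp(- lambda h) >= 1 - lambda h the exponential from below. This leaves h x^(d - 1) and h
    x^d, both times exp(- lambda x), and the exponential lowers either power to x^(eta - 1) at the
    price of [powexp_bound]. *)
Lemma g_II_diff_far (s t y eta : R) : s <= t -> t - s <= s - y -> y < s ->
  0 < eta -> eta <= d ->
  `|g_II d lambda t y - g_II d lambda s y| <=
    powexp_bound * (1 + 3 * lambda) * ((t - s) * (s - y) `^ (eta - 1)).
Proof.
move=> st tsy ys eta0 etad; rewrite g_II_diff//.
set h := t - s in tsy *; set x := s - y in tsy *.
have h0 : 0 <= h by rewrite subr_ge0.
have x0 : 0 < x by rewrite subr_gt0.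
have l0 := ltW lambda0.
pose E := expR (- (lambda * x)); have E0 : 0 <= E := expR_ge0 _.
pose A := x `^ (d - 1); pose B := x `^ d.
have A0 : 0 <= A := powR_ge0 _ _; have B0 : 0 <= B := powR_ge0 _ _.
have AB : x * A = B by rewrite /A /B mulr_powRB1// ltW.
have pw u : 0 <= u -> (x + u) `^ d <= B + u * A.
  move=> u0.
  have -> : x + u = x * (1 + u / x) by rewrite mulrDr mulr1 mulrCA mulfV ?mulr1// gt_eqF.
  rewrite powRM ?(ltW x0)//; last by rewrite addr_ge0// divr_ge0// ltW.
  apply: (@le_trans _ _ (B * (1 + u / x))).
    by rewrite /B ler_wpM2l ?powR_ge0// ler1_powR// lerDl divr_ge0// ltW.
  by rewrite -AB le_eqVlt; apply/orP; left; apply/eqP; field; rewrite gt_eqF.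
have Eu u : 0 <= u -> expR (- (lambda * (x + u))) <= E.
  by move=> u0; rewrite ler_expR lerN2 ler_wpM2l// lerDl.
have hF u : s <= u -> u <= t -> F (u - y) <= 2 * B * E.
  move=> su ut; have u0 : 0 <= u - s by rewrite subr_ge0.
  have -> : u - y = x + (u - s) by rewrite /x; ring.
  rewrite tempered_pow_gt0; last by rewrite ltr_wpDr.
  apply: ler_pM; rewrite ?powR_ge0 ?expR_ge0 ?Eu//.
  apply: le_trans (pw _ u0) _; rewrite mulr_natl mulr2n lerD2l -AB ler_wpM2r//.
  by apply: le_trans tsy; rewrite /h lerD2r.
have /andP[i0 i1] := int_F_le st hF.
have Ft : F (t - y) <= (B + h * A) * E.
  have -> : t - y = x + h by rewrite /x /h; ring.
  rewrite tempered_pow_gt0; last by rewrite ltr_wpDr.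
  by apply: ler_pM; rewrite ?powR_ge0 ?expR_ge0 ?Eu ?pw.
have Ft' : B * (E * (1 - lambda * h)) <= F (t - y).
  have -> : t - y = x + h by rewrite /x /h; ring.
  rewrite tempered_pow_gt0; last by rewrite ltr_wpDr.
  apply: (@le_trans _ _ (B * expR (- (lambda * (x + h))))).
    rewrite ler_wpM2l// (_ : - (lambda * (x + h)) = - (lambda * x) + - (lambda * h)); last by ring.
    rewrite expRD ler_wpM2l//.
    by have := expR_ge1Dx (- (lambda * h)).
  rewrite ler_wpM2r ?expR_ge0//.
  have xh : x <= x + h by rewrite lerDl.
  rewrite /B; apply: ge0_ler_powR => //; first exact: ltW.
    by rewrite nnegrE ltW.
  by rewrite nnegrE addr_ge0// ltW.
have Fs : F (s - y) = B * E by rewrite -/x tempered_pow_gt0.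
have ABk : A * E <= x `^ (eta - 1) * powexp_bound.
  have -> : A = x `^ (eta - 1) * x `^ (d - eta).
    by rewrite -powRD ?(gt_eqF x0) ?implybT// /A; congr (_ `^ _); ring.
  rewrite -mulrA ler_wpM2l ?powR_ge0// powR_expR_le//; have := d1; lra.
have BBk : B * E <= x `^ (eta - 1) * powexp_bound.
  have -> : B = x `^ (eta - 1) * x `^ (1 + d - eta).
    by rewrite -powRD ?(gt_eqF x0) ?implybT// /B; congr (_ `^ _); ring.
  rewrite -mulrA ler_wpM2l ?powR_ge0// powR_expR_le//; have := d1; have := d0; lra.
rewrite Fs.
have i2 : lambda * \int[leb]_(u in `[s, t]) F (u - y) <= lambda * (2 * B * E * h).
  by rewrite ler_wpM2l.
have i3 : 0 <= lambda * \int[leb]_(u in `[s, t]) F (u - y) by rewrite mulr_ge0.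
apply: (@le_trans _ _ (h * (A * E) + 3 * lambda * h * (B * E))).
  have z1 : 0 <= h * (A * E) by rewrite !mulr_ge0.
  have z2 : 0 <= lambda * h * (B * E) by rewrite mulr_ge0 ?mulr_ge0.
  by rewrite ler_norml; apply/andP; split; lra.
rewrite (_ : _ * (h * _) = h * (x `^ (eta - 1) * powexp_bound) +
   3 * lambda * h * (x `^ (eta - 1) * powexp_bound)); last by ring.
by apply: lerD; rewrite ler_wpM2l// !mulr_ge0.
Qed.

End kernel.

Section tail_integral.
Context {R : realType}.
Local Notation leb := (@lebesgue_measure R).

Lemma cvg_powR_neg (q s : R) : q < 0 -> (s + x) `^ q @[x --> +oo] --> (0 : R).
Proof.
move=> q0; apply/cvgrPdist_le => e e0; near=> x.
have x0 : 0 < s + x by rewrite -ltrBlDl sub0r; near: x; apply: nbhs_pinfty_gt; exact: num_real.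
rewrite sub0r normrN ger0_norm ?powR_ge0//.
have ex : e `^ q^-1 <= s + x.
  by rewrite -lerBlDl; near: x; apply: nbhs_pinfty_ge; exact: num_real.
rewrite -(opprK q) powRN -[leRHS]invrK lef_pV2 ?posrE ?invr_gt0 ?powR_gt0//.
have -> : e^-1 = (e `^ q^-1) `^ (- q).
  by rewrite powRN -powRrM mulVf ?lt_eqF// powRr1// ltW.
by apply: ge0_ler_powR; rewrite ?nnegrE ?powR_ge0 ?(ltW x0)// oppr_ge0 ltW.
Unshelve. all: by end_near. Qed.

Lemma is_derive_shift_powR (q s x : R) : 0 < s + x ->
  is_derive x 1 (fun x : R => (s + x) `^ q) (q * (s + x) `^ (q - 1)).
Proof.
move=> sx.
have sxI : s + x \in `]0, +oo[%classic by rewrite inE/= in_itv/= sx.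
have sxI' : s + x \in `]0, +oo[ by rewrite in_itv/= sx.
have dp : is_derive (s + x) 1 (fun z : R => z `^ q) (q * (s + x) `^ (q - 1)).
  apply: DeriveDef; first exact: derivable_powR.
  by rewrite -derive1E (powR_derive1 q sxI').
have ds : is_derive x 1 (fun x : R => s + x) 1.
  by have := is_deriveD (is_derive_cst s x 1) (is_derive_id x 1); rewrite add0r.
have := @is_derive1_comp R (fun z : R => z `^ q) (fun x : R => s + x) x _ _ dp ds.
by rewrite mulr1.
Qed.

(** The substitution y -> - y leads to [h - s, +oo[, where (s + x)^(p + 1) / (p + 1) is a primitive
    that vanishes at infinity. *)
Lemma integral_powR_tail (p s h : R) : p < - 1 -> 0 < h ->
  (\int[leb]_(y in `]-oo, (s - h)%R]) ((s - y) `^ p)%:E =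
   (h `^ (p + 1) / - (p + 1))%:E)%E.
Proof.
move=> p1 h0.
have p10 : p + 1 < 0 by lra.
have pos x : h - s <= x -> 0 < s + x by move=> hx; lra.
have contx x : h - s <= x -> {for x, continuous (fun x : R => (s + x) `^ p)}.
  move=> /pos sx; have := is_derive_shift_powR p sx => -[dx _].
  exact/differentiable_continuous/derivable1_diffP.
have dF x : h - s <= x -> is_derive x 1 (fun x : R => (s + x) `^ (p + 1) / (p + 1)) ((s + x) `^ p).
  move=> /pos sx; have := is_derive_shift_powR (p + 1) sx; rewrite addrK => h1.
  apply: is_derive_eq; rewrite scaler0 add0r; rewrite /GRing.scale/=.
  by rewrite mulrA mulVf ?mul1r// lt_eqF.
have -> : s - h = - (h - s) by ring.
rewrite ge0_integration_by_substitutionNy; last 2 first.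
- apply: continuous_in_subspaceT => y; rewrite inE/= in_itv/= => yh.
  have cy := contx (- y) ltac:(by rewrite lerNr).
  apply: (@continuous_comp _ _ _ (fun y : R => - y) (fun x : R => (s + x) `^ p)) => //.
  exact: opp_continuous.
- by move=> y _; exact: powR_ge0.
under eq_integral do rewrite /= opprK.
rewrite (@ge0_continuous_FTC2y R _ (fun x : R => (s + x) `^ (p + 1) / (p + 1)) _ 0).
- by rewrite -EFinB sub0r addrC subrK invrN mulrN.
- by move=> x _; exact: powR_ge0.
- apply: continuous_in_subspaceT => x; rewrite inE/= in_itv/= andbT; exact: contx.
- rewrite -(mul0r (p + 1)^-1); apply: cvgM; last exact: cvg_cst.
  exact: cvg_powR_neg.
- by move=> x /ltW /dF [].
- have [dh _] := dF _ (lexx (h - s)).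
  apply: cvg_at_right_filter.
  by move/derivable1_diffP/differentiable_continuous: dh.
- move=> x; rewrite in_itv/= andbT => /ltW /dF [_ <-].
  by rewrite derive1E.
Qed.
End tail_integral.

Section kernel_increment.
Context {R : realType}.
Local Notation leb := (@lebesgue_measure R).

(** With h = t - s, the near part ]s - h, t] has length 2 h and gives h^(2 d + 1) <= h^(1 + 2 eta).
    The far part gives h^2 times the integral of x^(2 eta - 2) over x >= h, that is h^2 h^(2 eta -
    1) / (1 - 2 eta), finite because eta < 1/2. Measurability of the kernels is a premise because
    membership in L2 within [wiener_integral] supplies it. *)
Lemma g_II_increment_sq (d lambda eta : R) : 0 < lambda -> 0 < d -> d <= 2^-1 ->
  0 < eta -> eta < d -> exists2 C : R, 0 <= C & forall s t,
  measurable_fun setT (g_II d lambda s) -> measurable_fun setT (g_II d lambda t) ->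
  s <= t -> t - s <= 1 ->
  (\int[leb]_y ((g_II d lambda t y - g_II d lambda s y) ^+ 2)%:E <=
   (C * (t - s) `^ (1 + 2 * eta))%:E)%E.
Proof.
move=> l0 d0 d2 eta0 etad.
pose c1 := 2 * (1 + lambda); pose c2 := powexp_bound lambda * (1 + 3 * lambda).
have e12 : 0 < 1 - 2 * eta by lra.
have c10 : 0 <= c1 by rewrite /c1; lra.
have c20 : 0 <= c2.
  by rewrite mulr_ge0 ?(le_trans ler01 (powexp_bound_ge1 _))//; lra.
have C0 : 0 <= 2 * c1 ^+ 2 + c2 ^+ 2 / (1 - 2 * eta).
  apply: addr_ge0; first by rewrite mulr_ge0 ?sqr_ge0.
  by rewrite divr_ge0 ?sqr_ge0 ?(ltW e12).
exists (2 * c1 ^+ 2 + c2 ^+ 2 / (1 - 2 * eta)) => //.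
move=> s t mgs mgt st h1; set h := t - s in h1 *.
have hE : h = t - s by [].
have d1 : d <= 1 by lra.
have [|h0] := leP h 0.
  rewrite /h subr_le0 => ts; have -> : s = t by apply/eqP; rewrite eq_le st ts.
  rewrite integral0_eq ?lee_fin ?(mulr_ge0 C0) ?powR_ge0//.
  by move=> y _; rewrite subrr expr0n.
pose D1 y : \bar R := (c1 ^+ 2 * h `^ (2 * d) * \1_(`]s - h, t]) y)%:E.
pose D2 := (fun y => (c2 ^+ 2 * h ^+ 2)%:E * ((s - y) `^ (2 * eta - 2))%:E)%E
  \_ (`]-oo, s - h] : set R).
have mpw : measurable_fun setT (fun y : R => ((s - y) `^ (2 * eta - 2))%:E).
  apply/measurable_EFinP; apply: (measurableT_comp (measurable_powR _)).
  exact: measurable_funB.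
have mD1 : measurable_fun setT D1.
  by apply/measurable_EFinP; apply: measurable_funM => //; exact: measurable_indic.
have mD2 : measurable_fun setT D2.
  apply/(measurable_restrictT _ _).1 => //.
  apply: measurable_funS (_ : measurable_fun setT _) => //.
  exact: emeasurable_funM.
have D10 y : (0 <= D1 y)%E.
  by rewrite /D1 indicE lee_fin mulr_ge0 ?ler0n// mulr_ge0 ?sqr_ge0 ?powR_ge0.
have D20 y : (0 <= D2 y)%E.
  rewrite /D2 /patch; case: ifP => // _.
  by rewrite -EFinM lee_fin mulr_ge0 ?powR_ge0// mulr_ge0 ?sqr_ge0.
have I1 : (\int[leb]_y D1 y = (2 * c1 ^+ 2 * (h `^ (2 * d) * h))%:E)%E.
  under eq_integral do rewrite /D1 EFinM.
  rewrite ge0_integralZl_EFin ?(mulr_ge0 (sqr_ge0 c1) (powR_ge0 _ _))//; last first.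
    by apply/measurable_EFinP; exact: measurable_indic.
  transitivity ((c1 ^+ 2 * h `^ (2 * d))%:E * leb (`](s - h)%R, t]%classic : set R))%E.
    by rewrite integral_indic// setIT.
  rewrite lebesgue_measure_itv/= lte_fin (_ : s - h < t); last by lra.
  by rewrite -EFinB -EFinM; congr (_%:E); rewrite /h; ring.
have I2 : (\int[leb]_y D2 y =
    (c2 ^+ 2 / (1 - 2 * eta) * (h ^+ 2 * h `^ (2 * eta - 1)))%:E)%E.
  rewrite /D2 -integral_mkcond ge0_integralZl_EFin ?(mulr_ge0 (sqr_ge0 c2) (sqr_ge0 h))//; last 2 first.
  - by move=> x _; rewrite lee_fin powR_ge0.
  - exact: measurable_funS mpw.
  rewrite integral_powR_tail//; last lra.
  rewrite -EFinM; congr (_%:E); rewrite (_ : 2 * eta - 2 + 1 = 2 * eta - 1); last by ring.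
  rewrite (_ : - (2 * eta - 1) = 1 - 2 * eta); last by ring.
  by set z := (1 - 2 * eta)^-1; set y := _ `^ _; ring.
apply: (@le_trans _ _ (\int[leb]_y (D1 y + D2 y))%E).
  apply: ge0_le_integral => //.
  - by move=> y _; rewrite lee_fin sqr_ge0.
  - by apply: measurable_sqr_EFin; exact: measurable_funB.
  - exact: emeasurable_funD.
  - move=> y _.
    have [ty|yt] := leP t y.
      by rewrite g_II_diff_right// expr0n/= adde_ge0.
    have [ysh|ysh] := leP y (s - h).
      apply: (@le_trans _ _ (D2 y)); last by rewrite leeDr.
      rewrite /D2 /patch mem_set/=; last by rewrite in_itv/=.
      rewrite -EFinM lee_fin.
      have sy : 0 < s - y by lra.
      have -> : (s - y) `^ (2 * eta - 2) = ((s - y) `^ (eta - 1)) ^+ 2.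
        rewrite expr2 -powRD; first by congr (_ `^ _); ring.
        by rewrite (gt_eqF sy) implybT.
      rewrite -!exprMn -[leLHS]real_normK ?num_real//.
      rewrite lerXn2r ?nnegrE ?normr_ge0//.
        by rewrite mulr_ge0 ?powR_ge0// mulr_ge0// ltW.
      by rewrite -mulrA; apply: g_II_diff_far => //; rewrite -/h; lra.
    apply: (@le_trans _ _ (D1 y)); last by rewrite leeDl.
    rewrite /D1 indicE mem_set/= ?in_itv/= ?ysh ?(ltW yt)// mulr1 lee_fin.
    have -> : h `^ (2 * d) = (h `^ d) ^+ 2.
      rewrite expr2 -powRD; first by congr (_ `^ _); ring.
      by rewrite (gt_eqF h0) implybT.
    rewrite -exprMn -[leLHS]real_normK ?num_real//.
    rewrite lerXn2r ?nnegrE ?normr_ge0//.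
      by rewrite mulr_ge0 ?powR_ge0.
    by apply: g_II_diff_near => //; rewrite -/h; lra.
rewrite ge0_integralD// I1 I2 -EFinD lee_fin [leRHS]mulrDl.
apply: lerD.
  apply: ler_wpM2l; first by rewrite mulr_ge0 ?sqr_ge0.
  rewrite -[X in _ * X](powRr1 (ltW h0)).
  rewrite -powRD; last by rewrite (gt_eqF h0) implybT.
  by apply: ger_powR; rewrite ?h0 ?h1//; lra.
apply: ler_wpM2l; first by rewrite divr_ge0 ?sqr_ge0 ?(ltW e12).
rewrite -powR_mulrn ?(ltW h0)// -powRD; last by rewrite (gt_eqF h0) implybT.
by rewrite (_ : 2%:R + (2 * eta - 1) = 1 + 2 * eta)//; ring.
Qed.

End kernel_increment.

(** * Hoelder continuity *)

Section wiener.
Context {R : realType} {dsp : measure_display} {Omega : measurableType dsp}.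
Variable P : probability Omega R.
Variable nu : {measure set (measurableTypeR R) -> \bar R}.
Variable L : R -> {RV P >-> R}.
Hypothesis HL : driving_levy_process nu L.
Local Notation leb := (@lebesgue_measure R).
Let v := levy_var L.

Lemma cvge0_near_le (u : (\bar R)^nat) (e : R) : u n @[n --> \oo] --> 0%E -> 0 < e ->
  \forall n \near \oo, (u n <= e%:E)%E.
Proof.
move=> /fine_cvgP[fu cu] e0.
have /cvgr0_norm_le/(_ e e0) h := cu.
by apply: filterS2 fu h => n fn; rewrite -(fineK fn) lee_fin; apply: le_trans; exact: ler_norm.
Qed.

Lemma wiener_integral_sub (f g : R -> R) (Y Z : {RV P >-> R}) (c : R) :
  wiener_integral L f Y -> wiener_integral L g Z ->
  (\int[leb]_x ((f x - g x) ^+ 2)%:E <= c%:E)%E ->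
  (\int[P]_w ((Y w - Z w) ^+ 2)%:E <= (64 * v * c)%:E)%E.
Proof.
move=> [fL [phi [hphi cphi cY]]] [gL [psi [hpsi cpsi cZ]]] fg.
have mf := Lfun_measurable fL; have mg := Lfun_measurable gL.
have v0 : 0 <= v by exact: levy_var_ge0.
have mY : measurable_fun setT Y by []. have mZ : measurable_fun setT Z by [].
apply/lee_addgt0Pr => e e0.
(* The total coefficient of e' after the five approximate triangle inequalities below; c goes
   through four factors 2 and the factor 4 v, hence 64 v. *)
pose k := 6 + 96 * v; have k0 : 0 < k by rewrite /k; lra.
pose e' := e / k; have e'0 : 0 < e' by rewrite divr_gt0.
have [n [[h1 h2] [h3 h4]]] : exists n,
  ((\int[leb]_x ((f x - step_function (phi n) x) ^+ 2)%:E <= e'%:E)%E /\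
   (\int[P]_w ((Y w - step_integral L (phi n) w) ^+ 2)%:E <= e'%:E)%E) /\
  ((\int[leb]_x ((g x - step_function (psi n) x) ^+ 2)%:E <= e'%:E)%E /\
   (\int[P]_w ((Z w - step_integral L (psi n) w) ^+ 2)%:E <= e'%:E)%E).
  have [N1 _ H1] := cvge0_near_le cphi e'0.
  have [N2 _ H2] := cvge0_near_le cY e'0.
  have [N3 _ H3] := cvge0_near_le cpsi e'0.
  have [N4 _ H4] := cvge0_near_le cZ e'0.
  exists (maxn (maxn N1 N2) (maxn N3 N4)).
  split; split; [apply: H1|apply: H2|apply: H3|apply: H4];
    by rewrite /= !leq_max leqnn ?orbT.
have mI a : measurable_fun setT (step_integral L a) by exact: measurable_step_integral.
have mS a : measurable_fun setT (@step_function R a) by exact: measurable_step_function.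
have s1 := sqint_trans P mY (mI (phi n)) mZ.
have s2 := sqint_trans P (mI (phi n)) (mI (psi n)) mZ.
have s3 : (\int[P]_w ((step_integral L (phi n) w - step_integral L (psi n) w) ^+ 2)%:E <=
    (4 * v)%:E * \int[leb]_x ((step_function (phi n) x - step_function (psi n) x) ^+ 2)%:E)%E.
  under eq_integral do rewrite -step_integralB.
  under [in leRHS]eq_integral do rewrite -step_functionB.
  apply: (sqint_step_integral HL); rewrite all_cat hphi/= all_map.
  by apply: sub_all (hpsi n).
have s4 := sqint_trans leb (mS (phi n)) mf (mS (psi n)).
have s5 := sqint_trans leb mf mg (mS (psi n)).
rewrite [X in (_ <= 2%:E * (X + _))%E]sqint_sub_sym in s4.
rewrite [X in (_ <= 2%:E * (_ + X))%E]sqint_sub_sym in s2.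
have p2 : (0 <= 2%:E :> \bar R)%E by rewrite lee_fin.
have p4 : (0 <= (4 * v)%:E)%E by rewrite lee_fin mulr_ge0.
have t5 := le_trans s5 (lee_wpmul2l p2 (leeD fg h3)).
have t4 := le_trans s4 (lee_wpmul2l p2 (leeD h1 t5)).
have t3 := le_trans s3 (lee_wpmul2l p4 t4).
have t2 := le_trans s2 (lee_wpmul2l p2 (leeD t3 h4)).
have t1 := le_trans s1 (lee_wpmul2l p2 (leeD h2 t2)).
apply: (le_trans t1).
rewrite -?EFinM -?EFinD -?EFinM -?EFinD -?EFinM -?EFinD -?EFinM -?EFinD -?EFinM -?EFinD lee_fin.
have -> : e = e' * k by rewrite /e' mulfVK// gt_eqF.
rewrite /k; have : 0 <= e' * v by rewrite mulr_ge0// ltW.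
lra.
Qed.

Lemma TFLP_II_holder (lambda d : R) (S : R -> {RV P >-> R}) : 0 < lambda ->
  0 < d -> d <= 2^-1 -> is_TFLP_II L d lambda S ->
  forall gamma : R, 0 < gamma -> gamma < d ->
  exists X : R -> {RV P >-> R}, modification X S /\ locally_holder gamma X.
Proof.
move=> l0 d0 d2 HS gamma gamma0 gammad.
pose eta := (gamma + d) / 2.
have eta0 : 0 < eta by rewrite /eta; lra.
have etad : eta < d by rewrite /eta; lra.
have ge : gamma < eta by rewrite /eta; lra.
have [C C0 hC] := g_II_increment_sq l0 d0 d2 eta0 etad.
pose a := (Gamma (d + 1))^-1.
have v0 : 0 <= v by exact: levy_var_ge0.
apply: (@kolmogorov_chentsov _ _ _ P S (a ^+ 2 * (64 * v * C)) eta) => //.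
  by rewrite mulr_ge0 ?sqr_ge0// !mulr_ge0.
move=> s t st ts1.
have [Ys [Ws Es]] := HS s; have [Yt [Wt Et]] := HS t.
have mB : measurable_fun setT (fun w => Yt w - Ys w) by exact: measurable_funB.
rewrite (_ : (\int[P]_w _)%E = (\int[P]_w ((a * (Yt w - Ys w)) ^+ 2)%:E)%E); last first.
  apply: ae_eq_sqint; [exact: measurable_funB|exact: measurable_funM|].
  by apply: filterS2 Es Et => w -> ->; rewrite /a; ring.
rewrite sqintZ// (_ : a ^+ 2 * (64 * v * C) * (t - s) `^ (1 + 2 * eta) =
  a ^+ 2 * (64 * v * (C * (t - s) `^ (1 + 2 * eta)))); last by ring.
rewrite [leRHS]EFinM; apply: lee_wpmul2l; first by rewrite lee_fin sqr_ge0.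
apply: (wiener_integral_sub Wt Ws).
by apply: hC => //; [exact: Lfun_measurable Ws.1|exact: Lfun_measurable Wt.1].
Qed.

End wiener.

Lemma sqr_one_sub_cos (R : realType) (x : R) :
  (1 - cos x) ^+ 2 = 2 * (1 - cos x) - 2^-1 * (1 - cos (2 * x)).
Proof.
have -> : 2 * x = x *+ 2 by rewrite mulr_natl.
by rewrite cos_mulr2n; field.
Qed.

Lemma ae_and (R : realType) (d : measure_display) (T : measurableType d)
    (mu : {measure set T -> \bar R}) (A B : T -> Prop) :
  {ae mu, forall x, A x} -> {ae mu, forall x, B x} -> {ae mu, forall x, A x /\ B x}.
Proof. by move=> hA hB; apply: filterS2 hA hB. Qed.

(** * Small-time jumps *)

Section jumps.
Context {R : realType} {dsp : measure_display} {Omega : measurableType dsp}.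
Variable P : probability Omega R.
Variable nu : {measure set (measurableTypeR R) -> \bar R}.
Variable L : R -> {RV P >-> R}.
Hypothesis HL : driving_levy_process nu L.
Let v := levy_var L.
Let Hnu := driving_levy_measure HL.
Let mL t : measurable_fun setT (L t). Proof. by []. Qed.

(** The integral of (1 - cos (theta x))^2 against nu, written through psi at theta and 2 theta so
    that the mean of (1 - cos (theta L(h)))^2 can be compared with h times it. *)
Definition jump_energy (theta : R) : R :=
  2 * levy_re nu theta - 2^-1 * levy_re nu (2 * theta).

Let jump_energyE theta :
  (\int[nu]_x ((1 - cos (theta * x)) ^+ 2)%:E = (jump_energy theta)%:E)%E.
Proof.
have i1 := (levy_re_integrable Hnu theta).1.
have i2 := (levy_re_integrable Hnu (2 * theta)).1.
transitivity (\int[nu]_x (2%:E * (1 - cos (theta * x))%:E +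
   (- 2^-1)%:E * (1 - cos (2 * theta * x))%:E))%E.
  apply: eq_integral => x _; rewrite sqr_one_sub_cos -!EFinM -EFinD mulrA.
  by congr (_%:E); ring.
rewrite integralD//; [|exact: integrableZl|exact: integrableZl].
rewrite !integralZl// /jump_energy /levy_re /Rintegral.
rewrite -{1}(fineK (integrable_fin_num measurableT i1)).
rewrite -{1}(fineK (integrable_fin_num measurableT i2)).
by rewrite -!EFinM -EFinD; congr (_%:E); ring.
Qed.

(** If it vanished at every theta = 1 / (n + 1), then nu-almost every x would satisfy cos (x / (n +
    1)) = 1 for all n. For x nonzero and n large this contradicts sin > 0 on ]0, 2[, so nu would
    live on {0}, which it does not charge. *)
Lemma jump_energy_gt0 : exists2 theta : R, 0 < theta & 0 < jump_energy theta.
Proof.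
apply: contrapT => h.
have z n : jump_energy n.+1%:R^-1 = 0.
  apply/eqP; rewrite eq_le; apply/andP; split.
    by rewrite leNgt; apply/negP => j0; apply: h; exists n.+1%:R^-1.
  rewrite -lee_fin -jump_energyE.
  exact: (sqint_ge0 nu (fun x => 1 - cos (n.+1%:R^-1 * x))).
have ae0 : {ae nu, forall x, forall n, 1 - cos (n.+1%:R^-1 * x) = 0}.
  apply: ae_foralln => n.
  apply: (@sqint_eq0 _ _ _ nu (fun x => 1 - cos (n.+1%:R^-1 * x))); last first.
    by rewrite jump_energyE z.
  by apply: measurable_funB => //; exact: measurable_cos_mul.
have ne0 : {ae nu, forall x, x <> 0}.
  exists [set 0]; split => //; first exact: levy_measure_zero Hnu.
  by move=> x /= /contrapT.
have [N [mN N0 sub]] := ae_and ae0 ne0.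
have : N = setT.
  apply/seteqP; split=> // x _; apply: sub => -[hx x0].
  have [n hn] : exists n : nat, `|x| < n.+1%:R by exists (Num.truncn `|x|); rewrite truncnS_gt.
  have n0 : 0 < n.+1%:R :> R by [].
  have : 0 < sin (n.+1%:R^-1 * `|x|).
    apply: sin2_gt0; apply/andP; split.
      by rewrite mulr_gt0 ?invr_gt0// normr_gt0; apply/eqP.
    by rewrite mulrC ltr_pdivrMr//; lra.
  move/eqP: (hx n); rewrite subr_eq0 => /eqP c1.
  have : sin (n.+1%:R^-1 * `|x|) ^+ 2 = 0.
    rewrite sin2cos2 -{1}(gtr0_norm (_ : 0 < n.+1%:R^-1)) ?invr_gt0// -normrM cos_norm.
    by rewrite -c1 expr1n subrr.
  by move=> /eqP; rewrite sqrf_eq0 => /eqP ->; rewrite ltxx.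
by move=> e; move: N0; rewrite e; exact: driving_nondegenerate HL.
Qed.

Let sq_small_time theta h : 0 <= h ->
  (\int[P]_w ((1 - cos (theta * L h w)) ^+ 2)%:E =
   (2 * (1 - \int[P]_w cos (theta * L h w)) -
    2^-1 * (1 - \int[P]_w cos (2 * theta * L h w)))%:E)%E.
Proof.
move=> h0.
have i a : P.-integrable setT (EFin \o (fun w => 1 - cos (a * L h w))).
  have i1 : P.-integrable setT (EFin \o cst 1) by exact: finite_measure_integrable_cst.
  exact: (integrableB measurableT i1 (integrable_cosZ P (mL h) a)).
transitivity (\int[P]_w (2%:E * (1 - cos (theta * L h w))%:E +
   (- 2^-1)%:E * (1 - cos (2 * theta * L h w))%:E))%E.
  apply: eq_integral => w _; rewrite sqr_one_sub_cos -!EFinM -EFinD mulrA.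
  by congr (_%:E); ring.
rewrite integralD//; [|exact: (integrableZl _ _ (i theta))|exact: (integrableZl _ _ (i (2 * theta)))].
rewrite (integralZl _ (i theta))// (integralZl _ (i (2 * theta)))//.
rewrite !(integral_one_sub_cos P (mL h)) -!EFinM -EFinD.
by congr (_%:E); ring.
Qed.

Lemma small_time_jumps : exists b c h0 : R, [/\ 0 < b, 0 < c, 0 < h0 &
  forall h, 0 < h -> h <= h0 -> ((c * h)%:E <= P [set w | (b < `|L h w|)%R])%E].
Proof.
have [theta th0 k0] := jump_energy_gt0.
set k := jump_energy theta in k0.
have v0 : 0 <= v by exact: levy_var_ge0.
pose q t := levy_re nu t ^+ 2 + levy_im nu t ^+ 2 / 2.
have q0 t : 0 <= q t by rewrite addr_ge0 ?divr_ge0 ?sqr_ge0.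
pose Q := 2 * q theta + 2^-1 * q (2 * theta).
have Q0 : 0 <= Q by rewrite addr_ge0// mulr_ge0.
pose T4 := theta ^+ 4 * v + 1.
have T40 : 0 < T4 by rewrite ltr_wpDl// mulr_ge0// exprn_ge0// ltW.
pose b := Num.sqrt (k / T4).
have b2 : b ^+ 2 = k / T4 by rewrite sqr_sqrtr// divr_ge0// ltW.
(* The mean of (1 - cos (theta L(h)))^2 is at least h k - h^2 Q, and h0 makes h^2 Q <= h k / 4. On
   |L(h)| <= b the integrand is at most theta^4 b^2 L(h)^2 / 4, of mean at most h k / 4 by the
   choice of b. The remaining h k / 2 is at most 4 P(|L(h)| > b), which gives c = k / 8. *)
exists b, (k / 8), (k / (4 * (Q + 1))).
split; [by rewrite sqrtr_gt0 divr_gt0|by rewrite divr_gt0| by rewrite divr_gt0// mulr_gt0// ltr_wpDl|].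
move=> h h0 hle.
have hQ : h * Q <= k / 4.
  have Q1 : 0 < 4 * (Q + 1) by rewrite mulr_gt0// ltr_wpDl.
  move: hle; rewrite ler_pdivlMr// => hle.
  have : 0 <= h by rewrite ltW.
  by move: hle Q0; nra.
pose p := fine (P [set w | (b < `|L h w|)%R]).
have mA : measurable [set w | b < `|L h w|].
  rewrite -[X in measurable X]setTI.
  have mabs : measurable_fun setT (fun w => `|L h w|) by exact: measurableT_comp.
  by have := measurable_fun_ltr (measurable_cst b) mabs => /(_ measurableT [set true]); apply.
have pE : P [set w | (b < `|L h w|)%R] = p%:E by rewrite /p fineK// fin_num_measure.
rewrite pE lee_fin.
have lower : h * k - h ^+ 2 * Q <= 2 * (1 - \int[P]_w cos (theta * L h w)) -
    2^-1 * (1 - \int[P]_w cos (2 * theta * L h w)).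
  rewrite !(levy_char_re HL _ (ltW h0)).
  have e1 := exp_cos_expansion (h * levy_im nu theta) (mulr_ge0 (ltW h0) (levy_re_ge0 nu theta)).
  have e2 := exp_cos_expansion (h * levy_im nu (2 * theta))
    (mulr_ge0 (ltW h0) (levy_re_ge0 nu (2 * theta))).
  move: e1 e2; rewrite !ler_norml => /andP[e1 _] /andP[_ e2].
  have f t : (h * levy_re nu t) ^+ 2 + (h * levy_im nu t) ^+ 2 / 2 = h ^+ 2 * q t.
    by rewrite /q; ring.
  rewrite !f in e1 e2; rewrite /k /jump_energy /Q.
  move: e1 e2; set x1 := expR _ * _; set x2 := expR _ * _.
  set y1 := levy_re nu theta; set y2 := levy_re nu (2 * theta); set z1 := q _; set z2 := q _.
  by move=> e1 e2; lra.
have upper : (\int[P]_w ((1 - cos (theta * L h w)) ^+ 2)%:E <=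
    (4 * p + theta ^+ 4 * b ^+ 2 / 4 * (v * h))%:E)%E.
  apply: (@le_trans _ _ (\int[P]_w (4%:E * (\1_[set w | (b < `|L h w|)%R] w)%:E +
     (theta ^+ 4 * b ^+ 2 / 4)%:E * ((L h w) ^+ 2)%:E))%E); last first.
    have c0 : 0 <= theta ^+ 4 * b ^+ 2 / 4.
      by rewrite divr_ge0// mulr_ge0 ?sqr_ge0// exprn_ge0// ltW.
    have m1 : measurable_fun setT (fun w => (\1_[set w | (b < `|L h w|)%R] w)%:E : \bar R).
      by apply/measurable_EFinP; exact: measurable_indic.
    have m2 := measurable_sqr_EFin (mL h).
    have n2 w : (0 <= ((L h w) ^+ 2)%:E)%E by rewrite lee_fin sqr_ge0.
    have m3 : measurable_fun setT (fun w => (4%R : R)%:E * (\1_[set w | (b < `|L h w|)%R] w)%:E)%E.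
      exact: emeasurable_funM.
    have m4 : measurable_fun setT (fun w => (theta ^+ 4 * b ^+ 2 / 4)%:E * ((L h w) ^+ 2)%:E)%E.
      exact: emeasurable_funM.
    rewrite ge0_integralD//; last by move=> w _; rewrite mule_ge0 ?lee_fin ?sqr_ge0.
    rewrite !ge0_integralZl_EFin//.
    by rewrite integral_indic// setIT [X in (_ * X + _)%E]pE (L_sq HL (ltW h0)) -!EFinM -EFinD.
  apply: ge0_le_integral => //.
  - apply: measurable_sqr_EFin; apply: measurable_funB => //; exact: measurable_cosZ.
  - apply: emeasurable_funD; apply: emeasurable_funM => //.
      by apply/measurable_EFinP; exact: measurable_indic.
    exact: measurable_sqr_EFin.
  - move=> w _; rewrite -!EFinM -EFinD lee_fin.
    have u0 := one_sub_cos_ge0 (theta * L h w).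
    have u1 := one_sub_cos_le (theta * L h w).
    have u2 : 1 - cos (theta * L h w) <= 2 by have := cos_geN1 (theta * L h w); lra.
    rewrite indicE; have [bL|bL] := ltP b `|L h w|.
      rewrite mem_set//= mulr1.
      apply: (@le_trans _ _ 4); first by move: u0 u2; set u := 1 - cos _; nra.
      by rewrite lerDl mulr_ge0 ?sqr_ge0// divr_ge0// mulr_ge0 ?sqr_ge0// exprn_ge0// ltW.
    rewrite memNset/= ?mulr0 ?add0r; last by move/(lt_le_trans)/(_ bL); rewrite ltxx.
    apply: (@le_trans _ _ (((theta * L h w) ^+ 2 / 2) ^+ 2)).
      by rewrite lerXn2r ?nnegrE// divr_ge0 ?sqr_ge0.
    have Lb : (L h w) ^+ 2 <= b ^+ 2.
      by rewrite -[leLHS]real_normK ?num_real// lerXn2r ?nnegrE ?sqrtr_ge0.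
    have L0 : 0 <= (L h w) ^+ 2 by rewrite sqr_ge0.
    have t40 : 0 <= theta ^+ 4 by rewrite exprn_ge0// ltW.
    have -> : ((theta * L h w) ^+ 2 / 2) ^+ 2 = theta ^+ 4 * (L h w) ^+ 2 / 4 * (L h w) ^+ 2.
      by field.
    by rewrite ler_wpM2r// ler_wpM2r// ler_wpM2l.
move: upper; rewrite sq_small_time ?(ltW h0)// lee_fin => upper.
have hbv : theta ^+ 4 * b ^+ 2 * v <= k.
  rewrite b2 mulrAC mulrA ler_pdivrMr// mulrC ler_wpM2l ?(ltW k0)//.
  by rewrite /T4 lerDl.
have f1 : theta ^+ 4 * b ^+ 2 / 4 * (v * h) <= h * k / 4.
  have := ler_wpM2r (ltW h0) hbv; set x := theta ^+ 4 * b ^+ 2; lra.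
have f2 : h ^+ 2 * Q <= h * (k / 4) by rewrite expr2 -mulrA ler_wpM2l// ltW.
have hk : 0 <= h * k by rewrite mulr_ge0// ltW.
by move: (le_trans lower upper) f1 f2 hk; set X := _ / 4 * _; lra.
Qed.

End jumps.

(** * Measurability of finite quantifiers *)

Section finite_quantifiers.
Context {d : measure_display} {T : measurableType d}.

Lemma measurable_ex_fin (I : finType) (Q : I -> T -> Prop) :
  (forall i, measurable [set u | Q i u]) -> measurable [set u | exists i, Q i u].
Proof.
move=> mQ; rewrite (_ : [set u | _] = \bigcup_(i in [set: I]) [set u | Q i u]).
  by apply: fin_bigcup_measurable => //; exact: finite_finset.
apply/seteqP; split=> u; first by case=> i Qi; exists i.
by case=> i _ Qi; exists i.
Qed.

Lemma measurable_all_fin (I : finType) (Q : I -> T -> Prop) :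
  (forall i, measurable [set u | Q i u]) -> measurable [set u | forall i, Q i u].
Proof.
move=> mQ; rewrite (_ : [set u | _] = \bigcap_(i in [set: I]) [set u | Q i u]).
  by apply: fin_bigcap_measurable => //; exact: finite_finset.
by apply/seteqP; split=> u h i; [move=> _|]; exact: h.
Qed.

Lemma measurable_and_cst (b : bool) (Q : T -> Prop) :
  measurable [set u | Q u] -> measurable [set u | b /\ Q u].
Proof.
case: b => mQ; first by have -> : [set u | true /\ Q u] = [set u | Q u]
  by apply/seteqP; split=> u; [case|].
by have -> : [set u | false /\ Q u] = set0 by apply/seteqP; split=> u // -[].
Qed.

Lemma measurable_preimage d' (T' : measurableType d') (f : T -> T') (A : set T') :
  measurable_fun setT f -> measurable A -> measurable (f @^-1` A).
Proof. by move=> mf mA; rewrite -[X in measurable X]setTI; exact: mf. Qed.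

Lemma measurable_lt_norm {R : realType} (f : T -> R) (a : R) :
  measurable_fun setT f -> measurable [set u | a < `|f u|].
Proof.
move=> mf; rewrite -[X in measurable X]setTI.
have mabs : measurable_fun setT (fun w => `|f w|) by exact: measurableT_comp.
by have := measurable_fun_ltr (measurable_cst a) mabs => /(_ measurableT [set true]); apply.
Qed.

End finite_quantifiers.

(** * A Levy-type inequality for symmetric independent vectors *)

Section laws.
Context {R : realType} {dsp : measure_display} {Omega : measurableType dsp}.
Variable P : probability Omega R.

Definition box n (B : 'I_n -> set R) : set (n.-tuple R) :=
  [set u | forall i, B i (tnth u i)].

Lemma measurable_box n (B : 'I_n -> set R) :
  (forall i, measurable (B i)) -> measurable (box B).
Proof.
move=> mB; apply: measurable_all_fin => i.
by rewrite -[X in measurable X]setTI; exact: measurable_tnth.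
Qed.

Let boxes n : set (set (n.-tuple R)) :=
  [set A | exists2 B : 'I_n -> set R, (forall i, measurable (B i)) & A = box B].

Let measurable_tuple_boxes n : @measurable _ (n.-tuple R) = <<s @boxes n >>.
Proof.
apply/seteqP; split; last first.
  apply: smallest_sub; first exact: sigma_algebra_measurable.
  by move=> _ [B mB ->]; exact: measurable_box.
apply: smallest_sub; first exact: smallest_sigma_algebra.
move=> A; rewrite -bigcup_seq => -[i _ [B mB <-]].
apply: sub_sigma_algebra; exists (fun j => if j == i then B else setT).
  by move=> j; case: ifP.
rewrite setTI; apply/seteqP; split=> u; rewrite /box /=.
  by move=> Bu j; case: eqP => // ->.
by move=> /(_ i); rewrite eqxx.
Qed.

Lemma tuple_law_unique n (X Y : Omega -> n.-tuple R) :
  measurable_fun setT X -> measurable_fun setT Y ->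
  (forall B, (forall i, measurable (B i)) -> P (X @^-1` box B) = P (Y @^-1` box B)) ->
  forall A, measurable A -> P (X @^-1` A) = P (Y @^-1` A).
Proof.
move=> mX mY XY A mA.
pose X' : {RV P >-> n.-tuple R} := mfun_Sub (mem_set mX : X \in mfun).
pose Y' : {RV P >-> n.-tuple R} := mfun_Sub (mem_set mY : Y \in mfun).
apply: (@measure_unique _ _ _ (@boxes n) (fun=> setT) _ _ _ _ (distribution P X') (distribution P Y')) => //.
- exact: measurable_tuple_boxes.
- move=> _ _ [B mB ->] [C mC ->]; exists (fun i => B i `&` C i).
    by move=> i; exact: measurableI.
  by apply/seteqP; split=> u; [move=> [h1 h2] i; split|move=> h; split=> i; have [] := h i].
- by move=> _; exists (fun=> setT) => //; apply/seteqP; split.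
- by rewrite bigcup_const//; exists 0%N.
- by move=> _ [B mB ->]; exact: XY.
- by move=> _; apply: (@le_lt_trans _ _ 1%E); [exact: probability_le1|exact: ltry].
Qed.

Lemma pair_law_unique d1 d2 (T1 : measurableType d1) (T2 : measurableType d2)
    (X Y : Omega -> T1 * T2) :
  measurable_fun setT X -> measurable_fun setT Y ->
  (forall A B, measurable A -> measurable B ->
     P (X @^-1` (A `*` B)) = P (Y @^-1` (A `*` B))) ->
  forall E, measurable E -> P (X @^-1` E) = P (Y @^-1` E).
Proof.
move=> mX mY XY E mE.
pose X' : {RV P >-> (T1 * T2)%type} := mfun_Sub (mem_set mX : X \in mfun).
pose Y' : {RV P >-> (T1 * T2)%type} := mfun_Sub (mem_set mY : Y \in mfun).
apply: (@measure_unique _ _ _ [set A `*` B | A in measurable & B in measurable]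
  (fun=> setT) _ _ _ _ (distribution P X') (distribution P Y')) => //.
- exact: measurable_prod_measurableType.
- move=> _ _ [A mA [B mB <-]] [A' mA' [B' mB' <-]]; rewrite -setXI.
  by exists (A `&` A'); [exact: measurableI|exists (B `&` B') => //; exact: measurableI].
- by move=> _; exists setT => //; exists setT => //; rewrite setXTT.
- by rewrite bigcup_const//; exists 0%N.
- by move=> _ [A mA [B mB <-]]; exact: XY.
- by move=> _; apply: (@le_lt_trans _ _ 1%E); [exact: probability_le1|exact: ltry].
Qed.

Variables (n : nat) (X : 'I_n -> Omega -> R).
Hypothesis mX : forall i, measurable_fun setT (X i).
Hypothesis indX : mutually_independent P X.
Hypothesis symX : forall i B, measurable B ->
  P (X i @^-1` B) = P ((fun w => - X i w) @^-1` B).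

Definition flip (k : 'I_n) (u : n.-tuple R) : n.-tuple R :=
  [tuple if i == k then - tnth u i else tnth u i | i < n].
Definition vec (w : Omega) : n.-tuple R := [tuple X i w | i < n].

Lemma measurable_vec : measurable_fun setT vec.
Proof.
apply/measurable_fun_tnthP => i.
by rewrite (_ : _ \o _ = X i)//; apply/funext => w; rewrite /= tnth_mktuple.
Qed.

Lemma measurable_flip k : measurable_fun setT (flip k).
Proof.
apply/measurable_fun_tnthP => i.
rewrite (_ : _ \o _ = fun u => if i == k then - tnth u i else tnth u i); last first.
  by apply/funext => w; rewrite /= tnth_mktuple.
case: (i == k); last exact: measurable_tnth.
by apply: measurableT_comp => //; exact: measurable_tnth.
Qed.

(** Boxes determine the law, and on a box independence leaves only the k-th factor to compare, where
    symmetry applies. *)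
Lemma flip_law k A : measurable A ->
  P (vec @^-1` A) = P ((fun w => flip k (vec w)) @^-1` A).
Proof.
apply: tuple_law_unique; first exact: measurable_vec.
  exact: measurableT_comp (measurable_flip k) measurable_vec.
move=> B mB.
have mN (C : set R) : measurable C -> measurable [set x : R | C (- x)].
  move=> mC; rewrite -[X in measurable X]setTI.
  by apply: (_ : measurable_fun setT (fun x : R => - x)) => //; exact: measurableT_comp.
pose B' i := if i == k then [set x | B i (- x)] else B i.
have mB' i : measurable (B' i) by rewrite /B'; case: ifP => // _; exact: mN.
transitivity (P (\bigcap_(i in [set: 'I_n]) X i @^-1` B i)).
  congr (P _); apply/seteqP; split=> w /= h i; first by move=> _; have := h i; rewrite tnth_mktuple.
  by rewrite tnth_mktuple; exact: h.
rewrite indX//.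
transitivity (P (\bigcap_(i in [set: 'I_n]) X i @^-1` B' i)); last first.
  congr (P _); apply/seteqP; split=> w /= h i.
    by have := h i I; rewrite !tnth_mktuple /B'; case: ifP => // /eqP ->.
  by move=> _; have := h i; rewrite !tnth_mktuple /B'; case: ifP => // /eqP ->.
rewrite indX//; apply: eq_bigr => i _; rewrite /B'; case: ifP => // _.
by rewrite [LHS](symX i (mB i)).
Qed.

Context d2 (T2 : measurableType d2).
Variable Z : Omega -> T2.
Hypothesis mZ : measurable_fun setT Z.
Hypothesis indXZ : forall A B, measurable A -> measurable B ->
  P (vec @^-1` A `&` Z @^-1` B) = (P (vec @^-1` A) * P (Z @^-1` B))%E.

(** Z stands for what the flip leaves alone; below it is a sample of the process that drives
    negative times. *)
Lemma flip_joint_law k (E : set (n.-tuple R * T2)) : measurable E ->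
  P ((fun w => (vec w, Z w)) @^-1` E) = P ((fun w => (flip k (vec w), Z w)) @^-1` E).
Proof.
have mv := measurable_vec.
have mf := measurableT_comp (measurable_flip k) mv.
apply: pair_law_unique.
- exact: measurable_fun_pair.
- exact: measurable_fun_pair.
move=> A B mA mB.
have mfA : measurable (flip k @^-1` A).
  by rewrite -[X in measurable X]setTI; exact: measurable_flip.
transitivity (P (vec @^-1` A `&` Z @^-1` B)); first by congr (P _).
rewrite indXZ// (flip_law k mA).
transitivity (P (vec @^-1` (flip k @^-1` A) `&` Z @^-1` B)); last by congr (P _).
by rewrite indXZ.
Qed.

Section levy_inequality.
Variables (N : nat) (c : 'I_n -> 'I_N -> R) (zeta : 'I_N -> T2 -> R) (a : R).
Hypothesis mzeta : forall j, measurable_fun setT (zeta j).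

Let lin j (u : n.-tuple R) (z : T2) := \sum_(i < n) c i j * tnth u i + zeta j z.
Let hit (i : 'I_n) (u : n.-tuple R) := exists j, a < `|c i j * tnth u i|.
(** Only absolute values of coordinates enter, so [first k] is invariant under [flip k], while the
    events for different k are disjoint. *)
Let first (k : 'I_n) (u : n.-tuple R) :=
  hit k u /\ forall i : 'I_n, ~ ((i < k)%N /\ hit i u).

Let hit_flip i k u : hit i (flip k u) <-> hit i u.
Proof.
rewrite /hit /flip; split=> -[j]; rewrite tnth_mktuple => h; exists j; move: h.
  by case: ifP => // _; rewrite mulrN normrN.
by case: ifP => // _; rewrite mulrN normrN.
Qed.

Let first_flip k u : first k (flip k u) <-> first k u.
Proof.
rewrite /first; split=> -[/hit_flip h1 h2]; split=> // i [ik hi]; apply: (h2 i); split=> //.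
  by apply/hit_flip.
by move/hit_flip: hi.
Qed.

Let lin_flip k j u z : lin j (flip k u) z = lin j u z - 2 * (c k j * tnth u k).
Proof.
rewrite /lin (bigD1 k)//= [in RHS](bigD1 k)//= tnth_mktuple eqxx.
rewrite (eq_bigr (fun i => c i j * tnth u i)); first by ring.
by move=> i /negbTE ik; rewrite tnth_mktuple ik.
Qed.

Let mlin j : measurable_fun setT (fun p : n.-tuple R * T2 => lin j p.1 p.2).
Proof.
apply: measurable_funD.
  apply: measurable_sum => i.
  apply: measurable_funM => //.
  exact: (measurableT_comp (measurable_tnth i) measurable_fst).
exact: (measurableT_comp (mzeta j) measurable_snd).
Qed.

Let mhit i : measurable [set u | hit i u].
Proof.
apply: measurable_ex_fin => j; apply: measurable_lt_norm.
by apply: measurable_funM => //; exact: measurable_tnth.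
Qed.

Let mfirst k : measurable [set u | first k u].
Proof.
apply: measurableI; first exact: mhit.
apply: measurable_all_fin => i; apply: measurableC.
exact: measurable_and_cst.
Qed.

Let E k : set (n.-tuple R * T2) :=
  [set p | first k p.1] `&` [set p | exists j, a < `|lin j p.1 p.2|].
Let mE k : measurable (E k).
Proof.
apply: measurableI.
  by apply: (measurable_preimage (f := fst)) => //; exact: mfirst.
by apply: measurable_ex_fin => j; exact: measurable_lt_norm.
Qed.

Let pair w := (vec w, Z w).
Let pair_flip k w := (flip k (vec w), Z w).

Let F k := [set w | first k (vec w)].
Let mF k : measurable (F k).
Proof. exact: measurable_preimage measurable_vec (mfirst k). Qed.

Let mpair : measurable_fun setT pair.
Proof. by apply: measurable_fun_pair => //; exact: measurable_vec. Qed.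

Let mpair_flip k : measurable_fun setT (pair_flip k).
Proof.
apply: measurable_fun_pair => //.
exact: measurableT_comp (measurable_flip k) measurable_vec.
Qed.

Let trivF : trivIset setT F.
Proof.
apply/trivIsetP => i k _ _ ik; rewrite -subset0 => w [[hi fi] [hk fk]].
have [lt|gt|e] := ltngtP i k.
- by apply: (fk i).
- by apply: (fi k).
- by move/eqP: ik; apply; exact: val_inj.
Qed.

(* If the k-th term exceeds a, then so does the sum or the sum with the k-th
   term flipped, and the two have the same law on F k. *)
Let F_le k : (P (F k) <= 2%:E * P (pair @^-1` E k))%E.
Proof.
have mpre : measurable (pair @^-1` E k).
  exact: measurable_preimage.
have mpref : measurable (pair_flip k @^-1` E k).
  exact: measurable_preimage.
have -> : (2%:E * P (pair @^-1` E k) = P (pair @^-1` E k) + P (pair_flip k @^-1` E k))%E.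
  by rewrite -(flip_joint_law k (mE k)) -[2%:E]/(1%:E + 1%:E)%E ge0_muleDl ?lee_fin// mul1e.
apply: (le_trans _ (measureU2 P mpre mpref)).
apply: le_measure; rewrite ?inE//; first exact: measurableU.
move=> w Fw; have [[j hj] _] := Fw.
have ff : first k (flip k (vec w)) by apply/first_flip.
have := lin_flip k j (vec w) (Z w).
have [h|h] := ltP a `|lin j (vec w) (Z w)|; first by left; split=> //; exists j.
move=> e; right; split=> //; exists j; rewrite /= e ltNge; apply/negP => h2.
have := ler_normB (lin j (vec w) (Z w)) (lin j (vec w) (Z w) - 2 * (c k j * tnth (vec w) k)).
rewrite opprB addrCA subrr addr0 normrM (ger0_norm (_ : 0 <= 2))//.
by move: hj h h2; set x := `|_|; set y := `|_|; set z := `|_|; lra.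
Qed.

(** The bounds [F_le] add up over the disjoint events [first k]. The constant 2 is the same for all
    N because one flip acts on all the sums j simultaneously. *)
Lemma levy_inequality :
  (P [set w | exists i j, (a < `|c i j * X i w|)%R] <=
   2%:E * P [set w | exists j, (a < `|(\sum_(i < n) c i j * X i w)%R + zeta j (Z w)|)%R])%E.
Proof.
have mU : measurable (\big[setU/set0]_(k < n) F k).
  by apply: bigsetU_measurable => k _; exact: mF.
have mpre k : measurable (pair @^-1` E k).
  exact: measurable_preimage.
have mU2 : measurable (\big[setU/set0]_(k < n) pair @^-1` E k).
  by apply: bigsetU_measurable => k _; exact: mpre.
have triv2 : trivIset setT (fun k => pair @^-1` E k).
  apply/trivIsetP => i k _ _ ik; have /trivIsetP := trivF => /(_ i k I I ik).
  by rewrite -!subset0 => s w [[h1 _] [h2 _]]; apply: (s w).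
have le1 : (P (\big[setU/set0]_(k < n) F k) <=
    2%:E * P (\big[setU/set0]_(k < n) pair @^-1` E k))%E.
  rewrite !measure_semi_additive_ord// ge0_sume_distrr//.
  by apply: lee_sum => k _; exact: F_le.
apply: le_trans (le_trans le1 _).
  apply: le_measure; rewrite ?inE//.
    do 2 apply: measurable_ex_fin => ?; apply: measurable_lt_norm.
    exact: measurable_funM.
  move=> w [i [j hj]].
  pose hitb (i : 'I_n) := [exists j, a < `|c i j * X i w|].
  have hi : hitb i by apply/existsP; exists j.
  rewrite -bigcup_seq.
  case: (arg_minnP (fun i : 'I_n => i : nat) hi) => k /existsP[jk hk] kmin.
  exists k; first by rewrite /= mem_index_enum.
  split; first by exists jk; rewrite tnth_mktuple.
  move=> l [lk [jl hl]]; have hlb : hitb l.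
    by apply/existsP; exists jl; move: hl; rewrite tnth_mktuple.
  by have := kmin l hlb; rewrite leqNgt lk.
apply: lee_wpmul2l => //; apply: le_measure; rewrite ?inE//.
  apply: measurable_ex_fin => j; apply: measurable_lt_norm.
  apply: measurable_funD; last exact: measurableT_comp (mzeta j) mZ.
  by apply: measurable_sum => i; exact: measurable_funM.
rewrite -bigcup_seq => w [k _ [_ [j hj]]]; exists j; move: hj; rewrite /lin/=.
by under eq_bigr do rewrite tnth_mktuple.
Qed.

End levy_inequality.

(** By independence the complement has probability at most the product of the 1 - p_i, and 1 - p <=
    exp(- p). *)
Lemma indep_ex_ge (b : R) (J : pred 'I_n) (p : 'I_n -> R) :
  (forall i, J i -> ((p i)%:E <= P [set w | (b < `|X i w|)%R])%E) ->
  ((1 - expR (- \sum_(i < n | J i) p i))%:E <=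
     P [set w | exists2 i, J i & (b < `|X i w|)%R])%E.
Proof.
move=> hp.
have mlt i : measurable [set w | b < `|X i w|] by exact: measurable_lt_norm.
pose B (i : 'I_n) := if J i then ~` [set x : R | b < `|x|] else setT.
have mB i : measurable (B i).
  rewrite /B; case: ifP => // _; apply: measurableC.
  exact: (@measurable_lt_norm _ _ R id).
have mex : measurable [set w | exists2 i, J i & b < `|X i w|].
  rewrite (_ : [set w | _] = [set w | exists i, J i /\ b < `|X i w|]); last first.
    by apply/seteqP; split=> w; case=> i; [exists i|case; exists i].
  by apply: measurable_ex_fin => i; exact: measurable_and_cst.
have compl : P (~` [set w | exists2 i, J i & (b < `|X i w|)%R]) =
    (\prod_(i < n) P (X i @^-1` B i))%E.
  rewrite -indX//; congr (P _); apply/seteqP; split=> w /= h.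
    by move=> i _ /=; rewrite /B; case: ifP => // Ji /= bi; apply: h; exists i.
  by case=> i Ji bi; have := h i I; rewrite /= /B Ji.
have prodle : (\prod_(i < n) P (X i @^-1` B i) <= (expR (- \sum_(i < n | J i) p i))%:E)%E.
  have pE i : P (X i @^-1` B i) = (fine (P (X i @^-1` B i)))%:E.
    by rewrite fineK// fin_num_measure//; exact: measurable_preimage.
  under eq_bigr do rewrite pE.
  rewrite prodEFin lee_fin -sumrN expR_sum [leRHS]big_mkcond/=.
  apply: ler_prod => i _; rewrite fine_ge0//= -lee_fin -pE /B.
  case: ifPn => Ji; last by apply: probability_le1; rewrite preimage_setT.
  rewrite preimage_setC probability_setC; last exact: mlt.
  have := hp i Ji; rewrite -(fineK (fin_num_measure P _ (mlt i))) => h.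
  rewrite -EFinB lee_fin; rewrite lee_fin in h.
  by have := expR_ge1Dx (- p i); lra.
have := probability_setC P mex; rewrite compl => e.
have pf := fin_num_measure P _ mex.
move: e prodle => ->; rewrite -(fineK pf) -EFinB !lee_fin; lra.
Qed.

End laws.

(** * Lower bound for maxima of integrals of step functions *)

Section partitions.
Context {R : realType}.
Implicit Types (u : nat -> R) (phi : seq (R * (R * R))).

Definition endpoints phi : seq R := [seq p.2.1 | p <- phi] ++ [seq p.2.2 | p <- phi].

Lemma mem_endpoints phi p : p \in phi -> p.2.1 \in endpoints phi /\ p.2.2 \in endpoints phi.
Proof.
move=> pphi; rewrite !mem_cat; split; apply/orP; [left|right].
  exact: (map_f (fun q : R * (R * R) => q.2.1)).
exact: (map_f (fun q : R * (R * R) => q.2.2)).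
Qed.

(** The sorted list is continued by its last entry, so u is defined on all of nat; repetitions in s
    only create empty gaps. *)
Lemma sorted_enumeration (s : seq R) : 0 \in s -> {in s, forall x, 0 <= x} ->
  exists (u : nat -> R) (n : nat), [/\ {homo u : i j / (i <= j)%N >-> i <= j}, u 0%N = 0 &
    {in s, forall x, exists2 k, (k <= n)%N & u k = x}].
Proof.
move=> s0 spos; pose s' := sort <=%R s.
have ss' : sorted <=%R s' by apply: sort_sorted; exact: le_total.
have memE x : (x \in s') = (x \in s) by rewrite mem_sort.
have sz : (0 < size s')%N by case: (s') (memE 0) => //; rewrite s0.
have le_nth i j : (i <= j)%N -> (j < size s')%N -> nth 0 s' i <= nth 0 s' j.
  move=> ij js; apply: (sorted_leq_nth le_trans le_refl) => //; rewrite inE//.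
  exact: leq_ltn_trans js.
exists (fun k => nth 0 s' (minn k (size s').-1)), (size s').-1; split.
- move=> i j ij; apply: le_nth; last by rewrite (leq_ltn_trans (geq_minr _ _))// prednK.
  by rewrite leq_min geq_minr (leq_trans (geq_minl _ _)).
- rewrite min0n; apply/eqP; rewrite eq_le spos ?andbT; last by rewrite -memE mem_nth.
  have h : (index 0%R s' < size s')%N by rewrite index_mem memE.
  by have := le_nth 0%N (index 0%R s') isT h; rewrite nth_index ?memE.
- move=> x xs; have h : (index x s' < size s')%N by rewrite index_mem memE.
  have h2 : (index x s' <= (size s').-1)%N by rewrite -ltnS prednK.
  by exists (index x s') => //; rewrite (minn_idPl h2) nth_index// memE.
Qed.

Lemma partition_gap u (i j : nat) : {homo u : i j / (i <= j)%N >-> i <= j} ->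
  u j < u i.+1 -> u j <= u i.
Proof.
move=> hu h; have [ij|ji] := ltnP i j; last exact: hu.
by move: h; rewrite ltNge (hu _ _ ij).
Qed.

Lemma increment_partition (M : R -> R) u (n i j : nat) :
  {homo u : i j / (i <= j)%N >-> i <= j} -> (j <= n)%N -> u 0%N <= u i -> u i <= u j ->
  M (u j) - M (u i) = \sum_(k < n) \1_(`]u i, u j]) (u k.+1) * (M (u k.+1) - M (u k)).
Proof.
move=> hu jn i0 ij.
(* M stopped at the ends of [u i, u j]: its increment over the whole partition is the one sought,
   and its increments over gaps outside the interval vanish. *)
pose K r := M (Num.max (u i) (Num.min r (u j))).
have Kl r : r <= u i -> K r = M (u i).
  by move=> h; rewrite /K (min_idPl (le_trans h ij)) (max_idPl h).
have Kr r : u j <= r -> K r = M (u j).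
  by move=> h; rewrite /K (min_idPr h) (max_idPr ij).
have Km r : u i <= r -> r <= u j -> K r = M r.
  by move=> h h'; rewrite /K (min_idPl h') (max_idPr h).
have -> : M (u j) - M (u i) = K (u n) - K (u 0%N) by rewrite (Kl _ i0) (Kr _ (hu _ _ jn)).
rewrite -(telescope_sumr (fun k => K (u k)) (leq0n n)) big_mkord.
apply: eq_bigr => k _; rewrite indicE mem_setE in_itv/=.
have uk := hu k k.+1 (leqnSn k).
have [h1|h1] := leP (u k.+1) (u i).
  by rewrite !Kl ?(le_trans uk)// subrr mul0r.
have [h2|h2] := leP (u k.+1) (u j); last first.
  by rewrite mul0r !Kr ?subrr//; [exact: partition_gap|exact: ltW].
rewrite mul1r !Km//; [exact: partition_gap|exact: le_trans h2|exact: ltW].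
Qed.

Lemma step_sum_partition (M : R -> R) u n phi :
  {homo u : i j / (i <= j)%N >-> i <= j} -> u 0%N = 0 ->
  all (fun p => p.2.1 <= p.2.2) phi ->
  {in endpoints phi, forall x, 0 <= x /\ exists2 k, (k <= n)%N & u k = x} ->
  \sum_(p <- phi) p.1 * (M p.2.2 - M p.2.1) =
  \sum_(k < n) step_function phi (u k.+1) * (M (u k.+1) - M (u k)).
Proof.
move=> hu u0 /allP hphi hend.
under [RHS]eq_bigr do rewrite /step_function mulr_suml.
rewrite exchange_big /= big_seq [RHS]big_seq; apply: eq_bigr => p pphi.
have [e1 e2] := mem_endpoints pphi.
have [p0 [i _ ip]] := hend _ e1; have [_ [j jn jp]] := hend _ e2.
rewrite -ip -jp (@increment_partition M u n i j)// ?u0 ?ip ?jp ?hphi//.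
by rewrite mulr_sumr; apply: eq_bigr => k _; rewrite mulrA.
Qed.

(** The intervals are open on the left and closed on the right, so a step function is constant on
    each gap ]u k, u k.+1] with the value taken at the right end; endpoints below 0 do not separate
    points of the gap. *)
Lemma step_function_partition u phi k y :
  {homo u : i j / (i <= j)%N >-> i <= j} -> u 0%N = 0 ->
  {in endpoints phi, forall x, x <= 0 \/ exists k, u k = x} ->
  u k < y -> y <= u k.+1 -> step_function phi y = step_function phi (u k.+1).
Proof.
move=> hu u0 hend ky yk; rewrite /step_function !big_seq; apply: eq_bigr => p pphi.
have uk0 : 0 <= u k by rewrite -u0 hu.
have y0 : 0 < y by exact: le_lt_trans ky.
have key x : x \in endpoints phi -> (x < y) = (x < u k.+1).
  move=> /hend[x0|[j <-]]; first by rewrite !(le_lt_trans x0)// (lt_le_trans y0).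
  apply/idP/idP => h; first exact: lt_le_trans yk.
  exact: le_lt_trans (partition_gap hu h) ky.
have [e1 e2] := mem_endpoints pphi.
congr (_ * _); rewrite !indicE !mem_setE !in_itv/= (key _ e1).
by rewrite ![_ <= p.2.2]leNgt (key _ e2).
Qed.

Lemma partition_interval u n y : {homo u : i j / (i <= j)%N >-> i <= j} ->
  u 0%N < y -> y <= u n -> exists2 k, (k < n)%N & u k < y /\ y <= u k.+1.
Proof.
move=> hu y0 yn; have ex : exists k, y <= u k by exists n.
case: (ex_minnP ex) => -[|k] yk kmin; first by move: y0; rewrite ltNge yk.
exists k; first exact: kmin.
by split=> //; rewrite ltNge; apply/negP => /kmin; rewrite ltnn.
Qed.

(** The set is covered by the gaps on which some step function satisfies Q. As 1 is a partition
    point, a gap that meets ]0, 1] stays inside it. *)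
Lemma lebesgue_step_le (N : nat) (phi : 'I_N -> seq (R * (R * R))) u n (Q : R -> Prop) :
  {homo u : i j / (i <= j)%N >-> i <= j} -> u 0%N = 0 ->
  (forall j, {in endpoints (phi j), forall x, x <= 0 \/ exists k, u k = x}) ->
  (exists2 k, (k <= n)%N & u k = 1) -> measurable [set x : R | Q x] ->
  (lebesgue_measure [set y | [/\ (0 < y)%R, (y <= 1)%R &
      exists j, Q (step_function (phi j) y)]] <=
   (\sum_(k < n | (u k.+1 <= 1)%R && `[< exists j, Q (step_function (phi j) (u k.+1)) >])
     (u k.+1 - u k))%:E)%E.
Proof.
move=> hu u0 hend [m mn um] mQ.
pose J k := (u k.+1 <= 1) && `[< exists j, Q (step_function (phi j) (u k.+1)) >].
pose A k : set R := if J k then `]u k, u k.+1]%classic else set0.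
have mA k : measurable (A k) by rewrite /A; case: ifP.
have mG : measurable [set y : R | [/\ 0 < y, y <= 1 & exists j, Q (step_function (phi j) y)]].
  rewrite (_ : [set y : R | _] = `]0%R, 1%R]%classic `&`
      [set y | exists j, Q (step_function (phi j) y)]); last first.
    by apply/seteqP; split=> y; rewrite /= in_itv/=; [case=> -> -> h|case=> /andP[]].
  apply: measurableI => //; apply: measurable_ex_fin => j.
  exact: (measurable_preimage (measurable_step_function (phi j)) mQ).
apply: (@le_trans _ _ (lebesgue_measure (\big[setU/set0]_(k < n) A k))).
  apply: le_measure; rewrite ?inE//; first by apply: bigsetU_measurable => k _; exact: mA.
  move=> y [y0 y1 [j Qj]]; rewrite -bigcup_mkord.
  have [||k km [ky yk]] := @partition_interval u m y hu; rewrite ?u0 ?um//.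
  exists k; first exact: leq_trans mn.
  rewrite /A /J; have -> : u k.+1 <= 1 by rewrite -um hu.
  rewrite asboolT/=; first by rewrite in_itv/= ky yk.
  by exists j; rewrite -(step_function_partition hu u0 (hend j) ky yk).
apply: le_trans (Boole_inequality _ _) _ => // => [k _|]; first exact: mA.
rewrite -sumEFin [leRHS]big_mkcond/=.
rewrite le_eqVlt; apply/orP; left; apply/eqP; apply: eq_bigr => k _.
rewrite /A /J; case: ifP => _; last by rewrite measure0.
by rewrite lebesgue_measure_itv/= lte_fin EFinB; case: ltgtP (hu k k.+1 (leqnSn k)) => // -> _; rewrite subee.
Qed.

End partitions.

Section almost_everywhere.
Context {R : realType} {d : measure_display} {T : measurableType d}.
Variable mu : {measure set T -> \bar R}.

Lemma measure_ae_le (A B : set T) : measurable A -> measurable B ->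
  {ae mu, forall x, A x -> B x} -> (mu A <= mu B)%E.
Proof.
move=> mA mB [N [mN N0 sub]].
apply: (@le_trans _ _ (mu (B `|` N))).
  apply: le_measure; rewrite ?inE//; first exact: measurableU.
  move=> x Ax; have [Bx|nBx] := pselect (B x); first by left.
  by right; apply: sub => /(_ Ax).
by apply: le_trans (measureU2 _ mB mN) _; rewrite [X in (_ + X)%E]N0 adde0.
Qed.

Lemma measure_ae_eq (A B : set T) : measurable A -> measurable B ->
  {ae mu, forall x, A x <-> B x} -> mu A = mu B.
Proof.
move=> mA mB h; apply/eqP; rewrite eq_le; apply/andP; split; apply: measure_ae_le => //.
- by apply: filterS h => x [].
- by apply: filterS h => x [].
Qed.

End almost_everywhere.

Lemma measurable_nth (R : realType) (n i : nat) :
  measurable_fun setT (fun u : n.-tuple R => nth 0 u i).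
Proof.
have [h|h] := ltnP i n; last first.
  rewrite (_ : (fun u => _) = cst 0) ?measurable_cst//.
  by apply/funext => u; rewrite nth_default// size_tuple.
rewrite (_ : (fun u => _) = fun u => tnth u (Ordinal h)); first exact: measurable_tnth.
by apply/funext => u; rewrite (tnth_nth 0).
Qed.

Section step_integrals.
Context {R : realType} {dsp : measure_display} {Omega : measurableType dsp}.
Variable P : probability Omega R.
Variable nu : {measure set (measurableTypeR R) -> \bar R}.
Variable L : R -> {RV P >-> R}.
Hypothesis HL : driving_levy_process nu L.
Hypothesis symL : symmetric_fdd P L.

Lemma symmetric_marginal t (B : set R) : measurable B ->
  P (L t @^-1` B) = P ((fun w => - L t w) @^-1` B).
Proof.
move=> mB.
have mA : measurable ((fun x : 1.-tuple R => tnth x ord0) @^-1` B).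
  exact: measurable_preimage (measurable_tnth ord0) mB.
transitivity (P (sample L [tuple t] @^-1` ((fun x : 1.-tuple R => tnth x ord0) @^-1` B))).
  by congr (P _); apply/seteqP; split=> w; rewrite /= tnth_mktuple (tnth_nth 0).
rewrite (symL (t := [tuple t]) (fun _ => I) mA).
by congr (P _); apply/seteqP; split=> w; rewrite /= tnth_mktuple (tnth_nth 0).
Qed.

(** Expresses the integrals over negative times as measurable functions of one finite sample, the
    form in which [independent_processes] can be applied to L1 and L2. *)
Lemma neg_step_integral (X : R -> {RV P >-> R}) (N : nat) (psi : 'I_N -> seq (R * (R * R))) :
  (forall t, 0 <= t -> {ae P, forall w, L (- t) w = - X t w}) ->
  (forall j, {in endpoints (psi j), forall x, x <= 0}) ->
  exists (m : nat) (s : m.-tuple R) (zeta : 'I_N -> m.-tuple R -> R),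
    [/\ forall i, 0 <= tnth s i, forall j, measurable_fun setT (zeta j) &
        {ae P, forall w, forall j, step_integral L (psi j) w = zeta j (sample X s w)}].
Proof.
move=> LX psi0.
pose ts := flatten [seq [seq - x | x <- endpoints (psi j)] | j <- enum 'I_N].
have ts0 x : x \in ts -> 0 <= x.
  move=> /flatten_mapP[j _ /mapP[y yp ->]]; rewrite oppr_ge0; exact: psi0 yp.
have tsP j x : x \in endpoints (psi j) -> - x \in ts.
  by move=> xp; apply/flatten_mapP; exists j; rewrite ?mem_enum//; apply: map_f.
(* Reads L(x) = - X(- x) off the sample, at the position of - x in [ts], which contains it whenever
   x is an endpoint. *)
pose rd (u : (size ts).-tuple R) (x : R) := - nth 0 u (index (- x) ts).
pose zeta j u := \sum_(p <- psi j) p.1 * (rd u p.2.2 - rd u p.2.1).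
have mrd x : measurable_fun setT (rd^~ x).
  by apply: measurableT_comp => //; exact: measurable_nth.
exists (size ts), (in_tuple ts), zeta; split.
- by move=> i; apply: ts0; exact: mem_tnth.
- move=> j; rewrite (_ : zeta j = fun u =>
    \sum_(p <- psi j) (fun u => p.1 * (rd u p.2.2 - rd u p.2.1)) u)//.
  by apply: measurable_sum => p; apply: measurable_funM => //; exact: measurable_funB.
have : {ae P, forall w, forall i : nat, L (- nth 0 ts i) w = - X (nth 0 ts i) w}.
  apply: ae_foralln => i; apply: LX.
  by have [h|h] := ltnP i (size ts); [exact/ts0/mem_nth|rewrite nth_default].
apply: filterS => w hw j; rewrite /step_integral /zeta.
have key x : x \in endpoints (psi j) -> L x w = rd (sample X (in_tuple ts) w) x.
  move=> /tsP xt; have := hw (index (- x) ts); rewrite nth_index// opprK => ->.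
  have h : (index (- x) ts < size ts)%N by rewrite index_mem.
  rewrite /rd; congr (- _); rewrite (_ : nth _ _ _ = tnth (sample X (in_tuple ts) w) (Ordinal h)).
    by rewrite tnth_mktuple (tnth_nth 0)/= nth_index.
  by rewrite (tnth_nth 0).
rewrite !big_seq; apply: eq_bigr => p pp; have [e1 e2] := mem_endpoints pp.
by rewrite /increment !key.
Qed.

Section max_of_step_integrals.
Variables (N : nat) (phi : 'I_N -> seq (R * (R * R))).
Hypothesis phi_le : forall j, all (fun p => p.2.1 <= p.2.2) (phi j).
Variables (a b c h0 : R).
Hypotheses (a0 : 0 < a) (c0 : 0 < c) (h00 : 0 < h0).
Hypothesis jumps : forall h, 0 < h -> h <= h0 -> ((c * h)%:E <= P [set w | (b < `|L h w|)%R])%E.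

(** On the gaps where some step function is at least a / b in absolute value, an increment larger
    than b makes a contribution larger than a. These gaps have total length at least m, so
    [indep_ex_ge] gives such an increment with probability at least 1 - exp(- c m), and
    [levy_inequality] passes from contributions to sums. *)
Lemma max_step_integral_ge (m : R) :
  (m%:E <= lebesgue_measure [set y | [/\ (0 < y)%R, (y <= 1)%R &
      exists j, (a <= b * `|step_function (phi j) y|)%R]])%E ->
  ((1 - expR (- (c * m)))%:E <=
     2%:E * P [set w | exists j, (a < `|step_integral L (phi j) w|)%R])%E.
Proof.
move=> hm.
have [L1 [L2 [[H1 H2 H12 HI] [pos neg]]]] := driving_increments_law HL.
pose psi j := nonneg_part (phi j).
have psi_le j : all (fun p => p.2.1 <= p.2.2) (psi j).
  rewrite all_map; apply: sub_all (phi_le j) => p /= p12.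
  by rewrite ge_max !le_max p12 lexx !orbT.
have psi_end j x : x \in endpoints (psi j) -> 0 <= x.
  rewrite mem_cat => /orP[|] /mapP[p /mapP[q _ ->] ->] /=; by rewrite le_max lexx orbT.
(* The grid k / M joins the endpoints so that gaps inside [0, 1] have length at most h0, as [jumps]
   requires, and so that 1 is a partition point. *)
pose M := (Num.truncn h0^-1).+1.
have M0 : 0 < M%:R :> R by [].
have Mh : M%:R^-1 <= h0.
  by rewrite invf_ple ?posrE// ltW// truncnS_gt.
pose s : seq R := 0 :: [seq k%:R / M%:R | k <- iota 0 M.+1] ++
  flatten [seq endpoints (psi j) | j <- enum 'I_N].
have s_grid k : (k <= M)%N -> k%:R / M%:R \in s.
  move=> kM; rewrite in_cons mem_cat (map_f (fun k => k%:R / M%:R : R)) ?orbT//.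
  by rewrite mem_iota.
have s_end j x : x \in endpoints (psi j) -> x \in s.
  move=> xj; rewrite in_cons mem_cat (_ : x \in flatten _) ?orbT//.
  by apply/flatten_mapP; exists j => //; rewrite mem_enum.
have s_pos : {in s, forall x, 0 <= x}.
  move=> x; rewrite in_cons mem_cat => /or3P[/eqP -> //|/mapP[k _ ->]|].
    by rewrite divr_ge0.
  by move=> /flatten_mapP[j _ /psi_end].
have [u [n [hu u0 uend]]] := sorted_enumeration (mem_head _ _ : 0 \in s) s_pos.
have upos k : 0 <= u k by rewrite -u0 hu.
have uS k : u k <= u k.+1 by exact: hu.
have u1 : exists2 k, (k <= n)%N & u k = 1.
  by apply: uend; rewrite (_ : 1 = M%:R / M%:R) ?s_grid// divff// gt_eqF.
have mesh k : u k.+1 <= 1 -> u k.+1 - u k <= h0.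
  move=> k1; apply: le_trans Mh; rewrite leNgt; apply/negP => big.
  pose i := (Num.truncn (u k * M%:R)).+1.
  have i1 : u k * M%:R < i%:R by rewrite truncnS_gt.
  have i2 : i%:R <= u k * M%:R + 1.
    by rewrite /i -natr1 lerD2r truncn_le// mulr_ge0.
  have i3 : i%:R / M%:R < u k.+1.
    rewrite ltr_pdivrMr//; apply: le_lt_trans i2 _.
    have := big; rewrite -(ltr_pM2r M0) mulVf ?gt_eqF// mulrBl; lra.
  have iM : (i <= M)%N.
    rewrite -(ler_nat R); have := lt_le_trans i3 k1.
    by rewrite ltr_pdivrMr// mul1r => /ltW.
  have [j _ uj] := uend _ (s_grid i iM).
  have := @partition_gap _ u k j hu; rewrite uj => /(_ i3).
  by rewrite ler_pdivrMr// leNgt i1.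
pose X (k : 'I_n) := increment L1 (u k) (u k.+1).
have mX k : measurable_fun setT (X k) by exact: measurable_funB.
have indX : mutually_independent P X.
  by apply: (levy_independent_increments H1) => //.
have lawX (k : 'I_n) (B : set R) : measurable B ->
    P (X k @^-1` B) = P (L (u k.+1 - u k) @^-1` B).
  move=> mB; have hk : 0 <= u k.+1 - u k by rewrite subr_ge0.
  have := levy_stationary_increments H1 (upos k) hk mB.
  rewrite addrC subrK => ->; apply: measure_ae_eq.
  - by apply: measurable_preimage => //; exact: measurable_funB.
  - exact: measurable_preimage.
  by apply: filterS2 (pos _ hk) (levy_start H1) => w e1 e2; rewrite /= /increment e1 e2 subr0.
have symX (k : 'I_n) (B : set R) : measurable B ->
    P (X k @^-1` B) = P ((fun w => - X k w) @^-1` B).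
  move=> mB; rewrite lawX// symmetric_marginal//.
  have mN : measurable [set x : R | B (- x)].
    by apply: (measurable_preimage (f := fun x : R => - x)) => //; exact: measurableT_comp.
  by rewrite -[RHS]/(P (X k @^-1` [set x | B (- x)])) lawX.
have [mz [st [zeta [st0 mzeta zetaE]]]] :=
  @neg_step_integral L2 N (fun j => nonpos_part (phi j)) neg
    (fun j x => ltac:(rewrite mem_cat => /orP[|] /mapP[p /mapP[q _ ->] ->] /=; by rewrite ge_min lexx orbT)).
pose Z := sample L2 st.
have mZ : measurable_fun setT Z.
  apply/measurable_fun_tnthP => i.
  rewrite (_ : _ \o _ = L2 (tnth st i))//.
  by apply/funext => w; rewrite /= tnth_mktuple.
(* The increments as a function of the values of L1 at the partition points, since independence of
   L1 and L2 is stated for samples. *)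
pose D (v : n.+1.-tuple R) : n.-tuple R :=
  [tuple tnth v (lift ord0 i) - tnth v (widen_ord (leqnSn n) i) | i < n].
have mD : measurable_fun setT D.
  apply/measurable_fun_tnthP => i.
  rewrite (_ : _ \o _ = fun v => tnth v (lift ord0 i) - tnth v (widen_ord (leqnSn n) i)).
    by apply: measurable_funB; exact: measurable_tnth.
  by apply/funext => w; rewrite /= tnth_mktuple.
pose ut : n.+1.-tuple R := [tuple u i | i < n.+1].
have vecD w : vec X w = D (sample L1 ut w).
  by apply: eq_from_tnth => i; rewrite !tnth_mktuple /X /increment lift0.
have indXZ A B : measurable A -> measurable B ->
    P (vec X @^-1` A `&` Z @^-1` B) = (P (vec X @^-1` A) * P (Z @^-1` B))%E.
  move=> mA mB.
  have -> : vec X @^-1` A = sample L1 ut @^-1` (D @^-1` A).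
    by apply/seteqP; split=> w; rewrite /= vecD.
  apply: HI => //; [| |exact: measurable_preimage].
  - by move=> i; rewrite tnth_mktuple /= in_itv/= upos.
  - by move=> i; rewrite /= in_itv/= st0.
pose cf (i : 'I_n) j := step_function (psi j) (u i.+1).
pose J k := (u k.+1 <= 1) && `[< exists j, a <= b * `|step_function (psi j) (u k.+1)| >].
have mQ : measurable [set x : R | a <= b * `|x|].
  rewrite (_ : [set x | _] = ~` [set x : R | b * `|x| < a]).
    apply: measurableC; rewrite -[X in measurable X]setTI.
    have mabs : measurable_fun setT (fun x : R => b * `|x|).
      by apply: measurable_funM => //; exact: measurableT_comp.
    by have := measurable_fun_ltr mabs (measurable_cst a) => /(_ measurableT [set true]); apply.
  by apply/seteqP; split=> x /=; rewrite leNgt => /negP.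
have hm2 : m <= \sum_(k < n | J k) (u k.+1 - u k).
  rewrite -lee_fin; apply: le_trans hm _.
  apply: le_trans (lebesgue_step_le (phi := psi) hu u0 _ u1 mQ); last first.
    by move=> j x xj; right; have [k _ uk] := uend x (s_end j x xj); exists k.
  rewrite le_eqVlt; apply/orP; left; apply/eqP; congr (lebesgue_measure _).
  apply/seteqP; split=> y [y0 y1 [j hj]]; split=> //; exists j; move: hj;
    by rewrite step_function_nonneg y0 mulr1.
have mlt i : measurable [set w | b < `|X i w|] by exact: measurable_lt_norm.
have hp (k : 'I_n) : J k -> ((c * (u k.+1 - u k))%:E <= P [set w | (b < `|X k w|)%R])%E.
  (* Repeated partition points give gaps of length 0, which [jumps] excludes but for which the bound
     is 0. *)
  move=> /andP[/mesh k1 _]; have [e|ne] := eqVneq (u k.+1) (u k).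
    by rewrite e subrr mulr0.
  have mb : measurable [set x : R | b < `|x|] by exact: (@measurable_lt_norm _ _ R id).
  rewrite [leRHS](lawX k _ mb); apply: jumps => //.
  by rewrite subr_gt0 lt_neqAle eq_sym ne uS.
have e1 := indep_ex_ge mX indX hp.
have e2 := levy_inequality mX indX symX mZ indXZ cf a mzeta.
apply: (@le_trans _ _ (1 - expR (- \sum_(k < n | J k) c * (u k.+1 - u k)))%:E).
  by rewrite lee_fin lerB// ler_expR lerN2 -mulr_sumr ler_wpM2l// ltW.
apply: le_trans e1 _; apply: le_trans _ (le_trans e2 _).
  apply: le_measure; rewrite ?inE.
  - rewrite (_ : [set w | _] = [set w | exists i : 'I_n, J i /\ b < `|X i w|]); last first.
      by apply/seteqP; split=> w; case=> i; [exists i|case; exists i].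
    by apply: measurable_ex_fin => i; exact: measurable_and_cst.
  - do 2 apply: measurable_ex_fin => ?; apply: measurable_lt_norm.
    exact: measurable_funM.
  - move=> w [i /andP[_ /asboolP[j hj]] bX]; exists i, j; rewrite normrM.
    (* The strict inequality comes from |X i| > b; the coefficient is nonzero because a > 0. *)
    apply: (le_lt_trans hj); rewrite mulrC ltr_pM2l// normr_gt0.
    apply/eqP => z; have := a0; move: hj.
    by rewrite z normr0 mulr0 leNgt => /negP.
apply: lee_wpmul2l => //; apply: measure_ae_le.
- apply: measurable_ex_fin => j; apply: measurable_lt_norm; apply: measurable_funD.
    by apply: measurable_sum => i; exact: measurable_funM.
  exact: measurableT_comp (mzeta j) mZ.
- by apply: measurable_ex_fin => j; apply: measurable_lt_norm; exact: measurable_step_integral.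
have Lu : {ae P, forall w, forall k : nat, L (u k) w = L1 (u k) w}.
  by apply: ae_foralln => k; exact: pos.
apply: filterS2 Lu zetaE => w e3 e4 [j hj]; exists j.
rewrite step_integral_split e4 {1}/step_integral (@step_sum_partition _ (L^~ w) u n (psi j) hu u0 (psi_le j)).
  move: hj; congr (a < `|_ + _|); apply: eq_bigr => k _.
  by rewrite /cf /X /increment !e3.
by move=> x xj; split; [exact: psi_end xj|exact/uend/s_end/xj].
Qed.

End max_of_step_integrals.
End step_integrals.

(** * Unboundedness *)

Section Gamma_function.
Context {R : realType}.

(** The primitive may fail to be differentiable at 0, so the fundamental theorem is used on
    [1 / (n + 2), 1], followed by monotone convergence; n + 2 keeps the left end below 1. *)
Lemma integral_powR_unit_le (p : R) : - 1 < p ->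
  (\int[lebesgue_measure]_(x in `]0%R, 1%R]) (x `^ p)%:E <= ((p + 1)^-1)%:E)%E.
Proof.
move=> p1; have p10 : 0 < p + 1 by rewrite -ltrBlDr sub0r.
pose F n : set R := `[n.+2%:R^-1, 1]%classic.
have FU : \bigcup_n F n = `]0%R, 1%R]%classic.
  apply/seteqP; split=> x.
    by case=> n _; rewrite /F /= !in_itv/= => /andP[h ->]; rewrite (lt_le_trans _ h)// invr_gt0.
  rewrite /= in_itv/= => /andP[x0 x1]; exists (Num.truncn x^-1) => //.
  rewrite /F /= in_itv/= x1 andbT invf_ple ?posrE//.
  by apply: ltW; apply: lt_trans (truncnS_gt _) _; rewrite ltr_nat.
have : (\int[lebesgue_measure]_(x in F i) (x `^ p)%:E)%E @[i --> \oo] -->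
       (\int[lebesgue_measure]_(x in `]0%R, 1%R]) (x `^ p)%:E)%E.
  rewrite -FU; apply: ge0_nondecreasing_set_cvg_integral.
  - move=> n m nm; rewrite subsetEset /F => x /=; rewrite !in_itv/= => /andP[h ->].
    by rewrite (le_trans _ h)// lef_pV2 ?posrE// ler_nat.
  - by move=> n; exact: measurable_itv.
  - by move=> n; apply: measurable_funTS; apply/measurable_EFinP; exact: measurable_powR.
  - by move=> n x _; rewrite lee_fin powR_ge0.
move=> h; rewrite -(cvg_lim _ h)//; apply: lime_le; first by apply/cvg_ex; eexists; exact: h.
apply: nearW => n; have n1 : n.+2%:R^-1 < 1 :> R by rewrite invf_lt1 ?ltr1n.
have n0 : 0 < n.+2%:R^-1 :> R by rewrite invr_gt0.
have dF (x : R) : 0 < x -> is_derive x 1 (fun y : R => (p + 1)^-1 * (0 + y) `^ (p + 1)) (x `^ p).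
  move=> x0; have h0 : 0 < 0 + x by rewrite add0r.
  have := is_derive_shift_powR (p + 1) h0 => h1.
  apply: is_derive_eq.
  by rewrite /GRing.scale/= mulrA mulVf ?gt_eqF// mul1r addrK add0r.
have cF (x : R) : 0 < x -> {for x, continuous (fun y : R => (p + 1)^-1 * (0 + y) `^ (p + 1))}.
  by move=> /dF[d _]; apply: differentiable_continuous; apply/derivable1_diffP.
rewrite (continuous_FTC2 (F := fun y : R => (p + 1)^-1 * (0 + y) `^ (p + 1)) n1).
- by rewrite -EFinB lee_fin !add0r powR1 mulr1 lerBlDr lerDl mulr_ge0 ?powR_ge0// invr_ge0 ltW.
- apply: continuous_in_subspaceT => x; rewrite inE/= in_itv/= => /andP[h1 _].
  have x0 : 0 < 0 + x by rewrite add0r; exact: lt_le_trans h1.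
  rewrite (_ : (fun x : R => x `^ p) = (fun y : R => (0 + y) `^ p)); last first.
    by apply/funext => y; rewrite add0r.
  have [dx _] := is_derive_shift_powR p x0.
  exact/differentiable_continuous/derivable1_diffP.
- split.
  + by move=> x; rewrite in_itv/= => /andP[h1 _]; have [] := dF x (lt_trans n0 h1).
  + by apply: cvg_at_right_filter; exact: cF.
  + by apply: cvg_at_left_filter; exact: cF.
- by move=> x; rewrite in_itv/= => /andP[h1 _]; rewrite derive1E; have [_ ->] := dF x (lt_trans n0 h1).
Qed.

(** [Gamma] is a real-valued integral, equal to 0 by convention if the integral is infinite, so
    positivity includes finiteness: the integrand is at most x^(z - 1) on ]0, 1] and at most the
    exponential density beyond. *)
Lemma Gamma_gt0 (z : R) : 0 < z -> z <= 1 -> 0 < Gamma z.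
Proof.
move=> z0 z1; pose f (x : R) := x `^ (z - 1) * expR (- x).
have f0 x : 0 <= f x by rewrite mulr_ge0 ?powR_ge0 ?expR_ge0.
have mf : measurable_fun setT f.
  apply: measurable_funM; first exact: measurable_powR.
  by apply: measurableT_comp => //; exact: measurableT_comp.
have mf' (D : set R) : measurable_fun D (EFin \o f).
  by apply: measurable_funTS; apply/measurable_EFinP.
rewrite /Gamma /Rintegral; apply: fine_gt0; apply/andP; split.
  apply: (@lt_le_trans _ _ (\int[lebesgue_measure]_(x in `]0%R, 1%R]) (expR (- 1))%:E)%E).
    rewrite integral_cst//= lebesgue_measure_itv/= lte_fin ltr01 oppr0 adde0 mule1.
    by rewrite lte_fin expR_gt0.
  apply: (@le_trans _ _ (\int[lebesgue_measure]_(x in `]0%R, 1%R]) (f x)%:E)%E).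
    apply: ge0_le_integral => //=.
    - exact: mf'.
    - move=> x; rewrite in_itv/= => /andP[x0 x1]; rewrite lee_fin -[leLHS]mul1r.
      apply: ler_pM; rewrite ?expR_ge0//; last by rewrite ler_expR lerN2.
      rewrite -[leLHS](powRr0 x); apply: ger_powR; first by rewrite x0.
      by rewrite subr_le0.
  apply: ge0_subset_integral => //=; first exact: mf'.
    by move=> x _; rewrite lee_fin.
  by move=> x; rewrite /= !in_itv/= andbT => /andP[].
have me : measurable_fun setT (EFin \o exponential_pdf (1 : R)).
  by apply/measurable_EFinP; exact: measurable_exponential_pdf.
have mp : measurable_fun setT (fun x : R => (x `^ (z - 1) * \1_(`]0%R, 1%R]) x)%:E).
  apply/measurable_EFinP; apply: measurable_funM; first exact: measurable_powR.
  exact: measurable_indic.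
have p0 (x : R) : (0 <= (x `^ (z - 1) * \1_(`]0%R, 1%R]) x)%:E)%E.
  by rewrite lee_fin mulr_ge0 ?powR_ge0.
have e0 (x : R) : (0 <= (exponential_pdf 1 x)%:E)%E.
  by rewrite lee_fin exponential_pdf_ge0.
apply: (@le_lt_trans _ _ (\int[lebesgue_measure]_(x in `]0%R, +oo[)
    ((x `^ (z - 1) * \1_(`]0%R, 1%R]) x)%:E + (exponential_pdf 1 x)%:E))%E).
  apply: ge0_le_integral => //=.
  - by move=> x _; rewrite lee_fin; exact: f0.
  - exact: mf'.
  - by apply: measurable_funTS; exact: emeasurable_funD.
  - move=> x; rewrite in_itv/= andbT => x0; rewrite -EFinD lee_fin.
    rewrite exponential_pdfE ?(ltW x0)// mul1r mulN1r indicE mem_setE in_itv/= x0/=.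
    have [x1|x1] := leP x 1.
      rewrite mulr1; apply: (@le_trans _ _ (x `^ (z - 1))); last by rewrite lerDl expR_ge0.
      by rewrite ler_piMr ?powR_ge0// expR_le1 oppr_le0 ltW.
    rewrite mulr0 add0r ler_piMl ?expR_ge0// -[leRHS](powRr0 x).
    by apply: ler_powR; [exact: ltW|rewrite subr_le0].
rewrite ge0_integralD//; [|exact: measurable_funTS|exact: measurable_funTS].
apply: lte_add_pinfty.
  apply: (@le_lt_trans _ _ (\int[lebesgue_measure]_(x in `]0%R, 1%R]) (x `^ (z - 1))%:E)%E).
    rewrite [leRHS]integral_mkcond.
    apply: (@le_trans _ _ (\int[lebesgue_measure]_x (x `^ (z - 1) * \1_(`]0%R, 1%R]) x)%:E)%E).
      exact: ge0_subset_integral.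
    rewrite le_eqVlt; apply/orP; left; apply/eqP; apply: eq_integral => x _.
    by rewrite patchE indicE; case: ifP => _; rewrite ?mulr1 ?mulr0.
  apply: le_lt_trans (ltry _); apply: integral_powR_unit_le.
  by rewrite ltrBrDr addNr.
apply: (@le_lt_trans _ _ (\int[lebesgue_measure]_x (exponential_pdf 1 x)%:E)%E).
  exact: ge0_subset_integral.
by rewrite integral_exponential_pdf// ltry.
Qed.

End Gamma_function.

Section kernel_lower_bound.
Context {R : realType}.

(** For y > 0 the second power vanishes and the integral is nonnegative; the first exponential is at
    least exp(- lambda) because t - y <= 1. *)
Lemma g_II_ge (d lambda t y : R) : 0 < lambda -> 0 < y -> y < t -> t <= 1 ->
  (t - y) `^ d * expR (- lambda) <= g_II d lambda t y.
Proof.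
move=> l0 y0 yt t1; have t0 := lt_trans y0 yt; have ty : 0 < t - y by rewrite subr_gt0.
rewrite /g_II (@tempered_pow_le0 _ d lambda (- y)) ?oppr_le0 ?(ltW y0)// subr0.
apply: (@le_trans _ _ (tempered_pow d lambda (t - y))).
  rewrite tempered_pow_gt0// ler_wpM2l ?powR_ge0// ler_expR lerN2 ler_piMr ?(ltW l0)//.
  by rewrite lerBlDr (le_trans t1)// lerDl ltW.
rewrite lerDl mulr_ge0 ?(ltW l0)// /oriented_integral (ltW t0) /Rintegral fine_ge0//.
by apply: integral_ge0 => x _; rewrite lee_fin tempered_pow_ge0.
Qed.

Lemma powR_inv_nat_unbounded (d K : R) : d < 0 -> exists n : nat, K < n.+1%:R^-1 `^ d.
Proof.
move=> d0; pose x := (Num.max K 1 + 1) `^ (- d)^-1.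
have nd : 0 < - d by rewrite oppr_gt0.
have K1 : 0 < Num.max K 1 + 1 by rewrite ltr_wpDl// le_max ler01 orbT.
have x0 : 0 < x by rewrite powR_gt0.
exists (Num.truncn x); have xn : x <= (Num.truncn x).+1%:R by rewrite ltW// truncnS_gt.
have n0 : 0 < (Num.truncn x).+1%:R :> R by [].
rewrite -powR_inv1 ?ler0n// -powRrM mulN1r.
apply: (@lt_le_trans _ _ (x `^ (- d))).
  rewrite /x -powRrM mulVf ?gt_eqF// powRr1 ?ltW//.
  by rewrite (@le_lt_trans _ _ (Num.max K 1)) ?le_max ?lexx// ltrDl.
by apply: ge0_ler_powR; rewrite ?nnegrE ?(ltW nd) ?(ltW x0)// ltW.
Qed.

Lemma max_g_II_large (d lambda K : R) : 0 < lambda -> d < 0 ->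
  exists n : nat, forall y, 0 < y -> y < 1 ->
    exists2 i, (i < n.+1)%N & K < g_II d lambda (i.+1%:R / n.+1%:R) y.
Proof.
move=> l0 d0; have [n hn] := powR_inv_nat_unbounded (K * expR lambda) d0.
exists n => y y0 y1; have n0 : 0 < n.+1%:R :> R by [].
(* With this i, (i + 1) / (n + 1) is the first grid point beyond y, at distance at most 1 / (n + 1),
   where the negative power is large. *)
exists (Num.truncn (y * n.+1%:R)).
  by rewrite truncn_lt_nat ?mulr_ge0 ?(ltW y0)// -[ltRHS]mul1r ltr_pM2r.
set i := Num.truncn _.
have hi1 : y * n.+1%:R < i.+1%:R by rewrite truncnS_gt.
have hi2 : i%:R <= y * n.+1%:R by rewrite truncn_le// mulr_ge0// ltW.
have iy : y < i.+1%:R / n.+1%:R by rewrite ltr_pdivlMr.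
have i1 : i.+1%:R / n.+1%:R <= 1 :> R.
  rewrite ler_pdivrMr// mul1r ler_nat -(ltr_nat R); apply: le_lt_trans hi2 _.
  by rewrite -[ltRHS]mul1r ltr_pM2r.
apply: lt_le_trans (g_II_ge d l0 y0 iy i1).
rewrite expRN -ltr_pdivrMr ?invr_gt0 ?expR_gt0// invrK; apply: lt_le_trans hn _.
have gap0 : 0 < i.+1%:R / n.+1%:R - y by rewrite subr_gt0.
have gap : i.+1%:R / n.+1%:R - y <= n.+1%:R^-1.
  rewrite lerBlDr -(ler_pM2r n0) mulfVK ?gt_eqF// mulrDl mulVf ?gt_eqF// -natr1.
  by rewrite addrC lerD2l.
have nd : 0 <= - d by rewrite oppr_ge0 ltW.
rewrite -[d]opprK powRN [leRHS]powRN lef_pV2 ?posrE ?powR_gt0 ?invr_gt0//.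
by apply: ge0_ler_powR; rewrite ?nnegrE ?(ltW gap0) ?invr_ge0.
Qed.

End kernel_lower_bound.

Section approximation.
Context {R : realType} {d : measure_display} {T : measurableType d}.
Variable mu : {measure set T -> \bar R}.

(** If |f_i| > 2 a and |g_i| <= a then |f_i - g_i| > a, which Chebyshev bounds by e for each i. It
    serves twice: for kernels under Lebesgue measure and for integrals under P. *)
Lemma measure_max_close (D : set T) (n : nat) (f g : nat -> T -> R) (a e : R) :
  measurable D -> 0 < a -> 0 <= e ->
  (forall i, measurable_fun setT (f i)) -> (forall i, measurable_fun setT (g i)) ->
  (forall i, (i < n)%N -> (\int[mu]_x ((f i x - g i x) ^+ 2)%:E <= (a ^+ 2 * e)%:E)%E) ->
  (mu (D `&` [set x | exists i : 'I_n, (2 * a < `|f i x|)%R]) <=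
   mu (D `&` [set x | exists i : 'I_n, (a < `|g i x|)%R]) + (n%:R * e)%:E)%E.
Proof.
move=> mD a0 e0 mf mg h.
have mfg i : measurable_fun setT (fun x => f i x - g i x) by exact: measurable_funB.
pose A i := [set x | a < `|f i x - g i x|].
have mA i : measurable (A i) by exact: measurable_lt_norm.
have mU : measurable (\big[setU/set0]_(i < n) A i) by apply: bigsetU_measurable => i _; exact: mA.
have mh (k : nat -> T -> R) (b : R) : (forall i, measurable_fun setT (k i)) ->
    measurable (D `&` [set x | exists i : 'I_n, b < `|k i x|]).
  by move=> mk; apply: measurableI => //; apply: measurable_ex_fin => i; exact: measurable_lt_norm.
apply: (@le_trans _ _ (mu ((D `&` [set x | exists i : 'I_n, a < `|g i x|]) `|`
    \big[setU/set0]_(i < n) A i))).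
  apply: le_measure; rewrite ?inE; [exact: mh|by apply: measurableU => //; exact: mh|].
  move=> x [Dx [i hi]]; have [hg|hg] := ltP a `|g i x|; first by left; split=> //; exists i.
  right; rewrite -bigcup_mkord; exists i; first exact: ltn_ord.
  rewrite /A /=.
  by have := ler_normD (f i x - g i x) (g i x); rewrite subrK; move: hi hg; lra.
apply: le_trans (measureU2 _ (mh g a mg) mU) _; apply: leeD => //.
apply: le_trans (Boole_inequality _ _) _ => [k _|]; first exact: mA.
apply: (@le_trans _ _ (\sum_(i < n) e%:E)%E); last first.
  by rewrite sumEFin sumr_const card_ord mulr_natl.
apply: lee_sum => i _; have a20 : 0 < a ^+ 2 by rewrite exprn_gt0.
have := le_trans (sqint_markov mu a0 (mfg i)) (h i (ltn_ord i)).
by rewrite [(_ * e)%:E]EFinM lee_pmul2l// lte_fin.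
Qed.

End approximation.

Section unbounded_paths.
Context {R : realType} {dsp : measure_display} {Omega : measurableType dsp}.
Variable P : probability Omega R.
Variable nu : {measure set (measurableTypeR R) -> \bar R}.
Variable L : R -> {RV P >-> R}.
Hypothesis HL : driving_levy_process nu L.
Hypothesis symL : symmetric_fdd P L.
Variables (lambda d : R).
Hypotheses (l0 : 0 < lambda) (d0 : d < 0) (d2 : - 2^-1 < d).

Lemma max_wiener_integral_ge (Y : R -> {RV P >-> R}) :
  (forall t, wiener_integral L (g_II d lambda t) (Y t)) ->
  exists2 p : R, 0 < p & forall a, 0 < a -> exists n : nat,
    (p%:E <= P [set w | exists i : 'I_n.+1, (a < `|Y (i.+1%:R / n.+1%:R) w|)%R])%E.
Proof.
move=> hY; have [b [c [h0 [b0 c0 h00 jumps]]]] := small_time_jumps HL.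
pose q := 1 - expR (- (c * 2^-1)).
have q0 : 0 < q by rewrite subr_gt0 expR_lt1 oppr_lt0 mulr_gt0// invr_gt0.
exists (q / 4); first by rewrite divr_gt0.
move=> a a0; have a20 : 0 < 2 * a by rewrite mulr_gt0.
(* A kernel value K times a jump b is 2 a. The kernels are taken beyond 2 K and the sums beyond 2 a
   because each approximation by step functions halves the threshold. *)
pose K := 2 * a / b; have K0 : 0 < K by rewrite divr_gt0.
have [n hn] := max_g_II_large (2 * K) l0 d0; exists n.
pose t i : R := i.+1%:R / n.+1%:R.
have mgt i : measurable_fun setT (g_II d lambda (t i)).
  exact: Lfun_measurable (hY (t i)).1.
have n0 : 0 < n.+1%:R :> R by [].
(* The n + 1 errors e1 add up to 1/2, so the step functions are large on a set of measure at least
   1/2, the value in [q]. The errors e2 add up to q / 4, which leaves q / 2 - q / 4. *)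
pose e1 : R := 2^-1 / n.+1%:R; pose e2 : R := q / 4 / n.+1%:R.
have e10 : 0 < e1 by rewrite divr_gt0 ?invr_gt0.
have e20 : 0 < e2 by rewrite !divr_gt0.
have [phi phiP] : exists phi : nat -> seq (R * (R * R)), forall i,
    [/\ all (fun p => p.2.1 <= p.2.2) (phi i),
      (\int[lebesgue_measure]_x ((g_II d lambda (t i) x - step_function (phi i) x) ^+ 2)%:E <=
        (K ^+ 2 * e1)%:E)%E &
      (\int[P]_w ((step_integral L (phi i) w - Y (t i) w) ^+ 2)%:E <= (a ^+ 2 * e2)%:E)%E].
  suff h i : exists f : seq (R * (R * R)), [/\ all (fun p => p.2.1 <= p.2.2) f,
      (\int[lebesgue_measure]_x ((g_II d lambda (t i) x - step_function f x) ^+ 2)%:E <=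
        (K ^+ 2 * e1)%:E)%E &
      (\int[P]_w ((step_integral L f w - Y (t i) w) ^+ 2)%:E <= (a ^+ 2 * e2)%:E)%E].
    by exists (fun i => projT1 (cid (h i))) => i; case: cid.
  have [_ [f [f1 f2 f3]]] := hY (t i).
  have c1 : 0 < K ^+ 2 * e1 by rewrite mulr_gt0// exprn_gt0.
  have c2 : 0 < a ^+ 2 * e2 by rewrite mulr_gt0// exprn_gt0.
  have [m _ hm] := cvge0_near_le f2 c1; have [k _ hk] := cvge0_near_le f3 c2.
  exists (f (maxn m k)); split=> //; first exact/hm/leq_maxl.
  by rewrite sqint_sub_sym; exact/hk/leq_maxr.
have mphi i : measurable_fun setT (step_function (phi i)) by exact: measurable_step_function.
have := measure_max_close (mu := lebesgue_measure) (D := `]0%R, 1%R[%classic) (n := n.+1) (f := fun i => g_II d lambda (t i))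
  (g := fun i => step_function (phi i)) (measurable_itv _) K0 (ltW e10) mgt mphi
  (fun i _ => let: And3 _ h _ := phiP i in h).
rewrite (_ : `]0%R, 1%R[%classic `&` [set x | exists i : 'I_n.+1, 2 * K < `|g_II d lambda (t i) x|]
    = `]0%R, 1%R[%classic); last first.
  apply/seteqP; split=> [y []//|y y01]; split=> //.
  move: y01; rewrite /= in_itv/= => /andP[y0 y1]; have [i hi Ki] := hn y y0 y1.
  by exists (Ordinal hi); apply: lt_le_trans Ki (ler_norm _).
have leb01 : lebesgue_measure (`]0%R, 1%R[%classic : set R) = 1%E.
  by rewrite lebesgue_measure_itv/= lte_fin ltr01 oppr0 adde0.
rewrite [X in (X <= _)%E]leb01 /e1 mulrC divfK ?gt_eqF//.
set G := _ `&` _ => hG.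
have mphiK (i : 'I_n.+1) : measurable [set x : R | K < `|step_function (phi i) x|].
  exact: measurable_lt_norm.
have mG : measurable (G : set R).
  by apply: measurableI => //; exact: (measurable_ex_fin mphiK).
have G2 : ((2^-1)%:E <= lebesgue_measure [set y | [/\ (0 < y)%R, (y <= 1)%R &
      exists j : 'I_n.+1, (2 * a <= b * `|step_function (phi j) y|)%R]])%E.
  pose mu_G : \bar R := lebesgue_measure (G : set R).
  have hG' : (1 <= mu_G + (2^-1)%:E)%E by exact: hG.
  apply: (@le_trans _ _ mu_G).
    case: mu_G hG' => [r||]; first by rewrite -EFinD !lee_fin; lra.
      by move=> _; rewrite leey.
    by rewrite addNye leeNy_eq.
  apply: le_measure; rewrite ?inE//.
    rewrite (_ : [set y : R | _] = `]0%R, 1%R]%classic `&`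
      [set y | exists j : 'I_n.+1, ~ (b * `|step_function (phi j) y| < 2 * a)]); last first.
      apply/seteqP; split=> y; rewrite /= in_itv/=.
        by case=> -> -> [j hj]; split=> //; exists j; rewrite ltNge hj.
      by case=> /andP[-> ->] [j /negP hj]; split=> //; exists j; rewrite leNgt.
    apply: measurableI => //; apply: measurable_ex_fin => j; apply: measurableC.
    rewrite -[X in measurable X]setTI.
    have mabs : measurable_fun setT (fun y : R => b * `|step_function (phi j) y|).
      by apply: measurable_funM => //; exact: measurableT_comp.
    by have := measurable_fun_ltr mabs (measurable_cst (2 * a)) => /(_ measurableT [set true]); apply.
  move=> y [/=]; rewrite in_itv/= => /andP[y0 y1] [j hj]; split=> //; first exact: ltW.
  by exists j; move: hj; rewrite /K ltr_pdivrMr// [_ * b]mulrC => /ltW.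
have phile (j : 'I_n.+1) : all (fun p => p.2.1 <= p.2.2) (phi j) by have [] := phiP j.
have := max_step_integral_ge HL symL phile a20 c0 h00 jumps G2.
rewrite -/q => hq.
have := measure_max_close (mu := P) (D := setT) (n := n.+1) (f := fun i => step_integral L (phi i))
  (g := fun i => Y (t i) : Omega -> R) measurableT a0 (ltW e20)
  (fun i => measurable_step_integral L (phi i)) (fun i => measurable_funPT _)
  (fun i _ => let: And3 _ _ h := phiP i in h).
rewrite !setTI /e2 [n.+1%:R * _]mulrC divfK ?gt_eqF//.
set AI := [set _ | _]; set AY := [set _ | _] => hIY.
have mI : measurable AI.
  by apply: measurable_ex_fin => i; apply: measurable_lt_norm; exact: measurable_step_integral.
have mY : measurable AY by apply: measurable_ex_fin => i; exact: measurable_lt_norm.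
have {}hq : (q%:E <= 2%:E * P AI)%E by exact: hq.
have {}hIY : (P AI <= P AY + (q / 4)%:E)%E by exact: hIY.
suff : ((q / 4)%:E <= P AY)%E by [].
move: hq hIY; rewrite -(fineK (fin_num_measure P _ mI)) -(fineK (fin_num_measure P _ mY)).
by rewrite -EFinM -EFinD !lee_fin; lra.
Qed.

(** The events that some grid value exceeds k + 1 decrease in k and have probability at least p,
    hence so does their intersection, a measurable set of paths unbounded on [0, 1]. A continuous
    path would be bounded on the compact [-1, 1]. *)
Lemma TFLP_II_unbounded (S : R -> {RV P >-> R}) : is_TFLP_II L d lambda S ->
  with_positive_probability P
    [set w | ~ continuous (S ^~ w) /\ locally_unbounded (S ^~ w)].
Proof.
move=> HS.
pose Y t := projT1 (cid (HS t)).
have YP t : wiener_integral L (g_II d lambda t) (Y t) by rewrite /Y; case: cid => ? [].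
have SY t : {ae P, forall w, S t w = (Gamma (d + 1))^-1 * Y t w}.
  by rewrite /Y; case: cid => ? [].
have [p p0 hp] := max_wiener_integral_ge YP.
have G0 : 0 < Gamma (d + 1) by apply: Gamma_gt0; have := d0; have := d2; lra.
pose t (n : nat) (i : nat) : R := i.+1%:R / n.+1%:R.
pose U (k : nat) := [set w | exists n, exists i : 'I_n.+1, k.+1%:R < `|S (t n i) w|].
pose V k n := [set w | exists i : 'I_n.+1, k.+1%:R < `|S (t n i) w|].
have mV k n : measurable (V k n).
  by apply: measurable_ex_fin => i; exact: measurable_lt_norm.
have mU k : measurable (U k).
  rewrite (_ : U k = \bigcup_n V k n); last first.
    by apply/seteqP; split=> w; [case=> n hn; exists n|case=> n _ hn; exists n].
  exact: bigcup_measurable.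
have pU k : (p%:E <= P (U k))%E.
  have a0 : 0 < Gamma (d + 1) * k.+1%:R by rewrite mulr_gt0.
  have [n hn] := hp _ a0; apply: le_trans hn _.
  apply: (@le_trans _ _ (P (V k n))); last first.
    by apply: le_measure; rewrite ?inE// => w hw; exists n.
  apply: measure_ae_le => //.
    by apply: measurable_ex_fin => i; exact: measurable_lt_norm.
  have h : {ae P, forall w, forall i : nat, S (t n i) w = (Gamma (d + 1))^-1 * Y (t n i) w}.
    by apply: ae_foralln => i.
  apply: filterS h => w hw [i hi]; exists i; rewrite hw normrM normfV.
  by rewrite (gtr0_norm G0) ltr_pdivlMl.
have cvU : P (U k) @[k --> \oo] --> P (\bigcap_k U k).
  apply: nonincreasing_cvg_mu => //.
  - by apply: (@le_lt_trans _ _ 1%E); [exact: probability_le1|exact: ltry].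
  - exact: bigcap_measurable.
  - move=> k m km; rewrite subsetEset => w [n [i hi]]; exists n, i.
    by apply: le_lt_trans hi; rewrite ler_nat.
exists (\bigcap_k U k); split.
- exact: bigcap_measurable.
- move=> w hw.
  have t01 n (i : 'I_n.+1) : 0 <= t n i /\ t n i <= 1.
    by rewrite /t; split; [rewrite divr_ge0|rewrite ler_pdivrMr// mul1r ler_nat].
  have unb : ~ [bounded S x w | x in `[- 1, 1]%classic].
    move=> [M [_ hM]]; have := hM (Num.max M 0 + 1).
    rewrite ltr_pwDr// ?le_max ?lexx//= => /(_ isT) hb.
    have [n [i hi]] := hw (Num.truncn (Num.max M 0 + 1)) I.
    have [ti0 ti1] := t01 n i.
    have := hb (t n i); rewrite /= in_itv/= ti1 andbT (le_trans _ ti0)// => /(_ isT).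
    rewrite leNgt; apply/negP/negPn; apply: lt_trans hi.
    by rewrite truncnS_gt.
  split; last by exists 1.
  move=> cS; apply: unb.
  have cw : {within `[- 1, 1]%classic, continuous (S ^~ w)}.
    exact: continuous_subspaceT.
  have [M [Mr hM]] := compact_bounded (continuous_compact cw (@segment_compact _ _ _)).
  by exists M; split=> // r Mr' x x1; apply: (hM r Mr'); exists x.
apply: lt_le_trans (_ : p%:E <= _)%E => //; rewrite ?lte_fin//.
rewrite -(cvg_lim _ cvU)//; apply: lime_ge; last exact: nearW.
by apply/cvg_ex; eexists; exact: cvU.
Qed.

End unbounded_paths.

Unset Implicit Arguments.
Set Strict Implicit.

Theorem theorem2p12 (R : realType) (dsp : measure_display)
    (Omega : measurableType dsp) (P : probability Omega R)
    (nu : {measure set (measurableTypeR R) -> \bar R})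
    (L : R -> {RV P >-> R}) (lambda : R) :
  driving_levy_process nu L -> 0 < lambda ->
  (forall (d : R) (S : R -> {RV P >-> R}),
     0 < d -> d <= 2^-1 -> is_TFLP_II L d lambda S ->
     forall gamma : R, 0 < gamma -> gamma < d ->
     exists X : R -> {RV P >-> R},
       modification X S /\ locally_holder gamma X) /\
  (forall (d : R) (S : R -> {RV P >-> R}),
     - 2^-1 < d -> d < 0 -> is_TFLP_II L d lambda S -> symmetric_fdd P L ->
     with_positive_probability P
       [set w | ~ continuous (S ^~ w) /\ locally_unbounded (S ^~ w)]).
Proof.
move=> HL l0; split=> [d S d0 d2 HS gamma g0 gd | d S d2 d0 HS symL].
  exact: (TFLP_II_holder HL l0 d0 d2 HS g0 gd).
exact: (TFLP_II_unbounded HL symL l0 d0 d2 HS).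
Qed.
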